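(* Let $w:I\to(0,\infty)$ be a decreasing weight on $I=(0,a)$, $0<a\le\infty$, with $W(t)=\int_0^t w\,dm<\infty$ for all $t\in I$. Let $b=\int_I w\,dm\in(0,\infty]$, $J=(0,b)$, and let $E$ be a fully symmetric Banach function space on $J$ with support $J$ and fundamental function $\phi_E$. (i) The class $Q_{E,w}$ is a solid linear subspace of $L_1+M_W$ such that for all $f\in Q_{E,w}$ $$\|f\|_{L_1+M_W}\le C\|f\|_{Q_{E,w}}\quad\text{with}\quad C\le\frac{1\wedge b}{\phi_E(1\wedge b)}.$$ (ii) The functional $\|\cdot\|_{Q_{E,w}}$ is a norm on $Q_{E,w}$. (iii) $Q_{E,w}$ equipped with the norm $\|\cdot\|_{Q_{E,w}}$ is the smallest fully symmetric Banach function space (on $I$ with Lebesgue measure) containing the class $M_{E,w}$. (iv) $(Q_{E,w})'=\Lambda_{E',w}$ with equality of norms.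
   Context: $m$ is Lebesgue measure; functions are identified when equal a.e.; ''decreasing'' means non-increasing; $s\wedge t=\min\{s,t\}$. $L^0=L^0(I)$ is the space of real Lebesgue measurable functions on $I$. For a measure $\mu$ and a $\mu$-measurable $f$ on $\Omega$, $d_f^\mu(s)=\mu\{|f|>s\}$ and $f^{*,\mu}(t)=\inf\{s>0:d_f^\mu(s)\le t\}$ for $0\le t<\mu(\Omega)$; $f^*$ is the rearrangement for $\mu=m$, and $f^{*,w}$ the rearrangement with respect to the measure $w\,dm$ on $I$, a function on $J$. For functions on the same interval ($I$ or $J$), $f\prec g$ means $\int_0^x f^*\,dm\le\int_0^x g^*\,dm$ for all $x$ in the interval. A Banach function space on an interval is a solid linear subspace $E$ of $L^0$ with full support, complete under a monotone norm ($|f|\le|g|$ a.e. implies $\|f\|_E\le\|g\|_E$). It is fully symmetric if equimeasurable functions have equal norms and $f\prec g$, $f\in L^0$, $g\in E$ imply $f\in E$ and $\|f\|_E\le\|g\|_E$. ''Support $J$'' means $\chi_A\in E$ whenever $m(A)<\infty$. $\phi_E(t)=\|\chi_A\|_E$ for $m(A)=t$. The Köthe dual $F'$ of a Banach function space $F$ (on $J$ or $I$, Lebesgue measure) is the set of measurable $f$ with $\|f\|_{F'}=\sup\{\int|fg|\,dm:\|g\|_F\le1\}<\infty$. For a fully symmetric space $F$ on $J$: $F_w=\{f\in L^0(I):f^{*,w}\in F\}$, $\|f\|_{F_w}=\|f^{*,w}\|_F$; $\Lambda_{F,w}=\{f\in L^0(I):f^*\in F_w\}$, $\|f\|_{\Lambda_{F,w}}=\|f^*\|_{F_w}$;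 $M_{F,w}=\{f\in L^0(I): f^*/w\in F_w\}$ with gauge $\|f\|_{M_{F,w}}=\|f^*/w\|_{F_w}$. $Q_{E,w}$ is the set of $f\in L^0(I)$ such that $f\prec g$ for some $g\in M_{E,w}$, with $\|f\|_{Q_{E,w}}=\inf\{\|g\|_{M_{E,w}}: f\prec g\}$. The Marcinkiewicz space is $M_W=\{f\in L^0(I):\|f\|_{M_W}=\sup_{x\in I}\frac{1}{W(x)}\int_0^x f^*\,dm<\infty\}$, and $L_1+M_W$ carries the norm $\|f\|_{L_1+M_W}=\inf\{\|h\|_1+\|g\|_{M_W}: f=h+g,\ h\in L_1(I),\ g\in M_W\}$. *)

(* Defs.v *)
From HB Require Import structures.
From mathcomp Require Import all_boot all_order all_algebra.
From mathcomp Require Import all_classical all_reals all_analysis.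
Set Implicit Arguments.
Unset Strict Implicit.
Unset Printing Implicit Defensive.
Import Order.TTheory GRing.Theory Num.Theory.
Import numFieldNormedType.Exports.
Local Open Scope classical_set_scope.
Local Open Scope ring_scope.

(* Conventions.  An element of L^0(D), for D an interval (0, a), is represented
   by a total function R -> R that is Borel measurable on D; its values outside
   D are irrelevant.  As functions are identified when equal a.e., and every
   Lebesgue measurable function is a.e. equal to a Borel one, this is the space
   of classes of Lebesgue measurable functions.  No quotient is formed: "a.e."
   appears explicitly wherever two functions are compared.
   Rearrangements may take the value +oo, hence they are \bar R-valued. *)

Section defs.
Context {R : realType}.
Implicit Types (a x : \bar R) (w f g h : R -> R) (D : set R).

Local Notation leb := (@lebesgue_measure R).

Definition oint a : set R := [set t | 0 < t /\ (t%:E < a)%E].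

Definition L0 D : set (R -> R) := [set f | measurable_fun D f].

Definition ae_on D (P : R -> Prop) : Prop := {ae leb, forall t, D t -> P t}.

(* A class of functions with a gauge; the gauge is only meaningful on the
   class.  No property is required here: M_{F,w} below need not be linear. *)
Record gauged_class := GaugedClass {
  gset :> set (R -> R) ;
  gauge : (R -> R) -> R }.

Implicit Types (E F : gauged_class).

Definition distribution (mu : set R -> \bar R) D f (s : R) : \bar R :=
  mu (D `&` [set t | s < `|f t|]).

Definition rearrangement (mu : set R -> \bar R) D f (t : R) : \bar R :=
  ereal_inf [set s%:E | s in
    [set s : R | 0 < s /\ (distribution mu D f s <= t%:E)%E]].

Definition prec D f g : Prop := forall t, D t ->
  (\int[leb]_(s in `]0%R, t[) rearrangement leb D f s <=
   \int[leb]_(s in `]0%R, t[) rearrangement leb D g s)%E.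

Definition equimeasurable D f g : Prop :=
  forall s, distribution leb D f s = distribution leb D g s.

Definition linear_subspace (S : set (R -> R)) : Prop :=
  [/\ S (fun=> 0),
      forall f g, S f -> S g -> S (fun t => f t + g t) &
      forall (c : R) f, S f -> S (fun t => c * f t)].

Definition solid D (S : set (R -> R)) : Prop :=
  forall f g, S f -> L0 D g -> ae_on D (fun t => `|g t| <= `|f t|) -> S g.

Definition full_support D (S : set (R -> R)) : Prop :=
  forall A, measurable A -> A `<=` D -> (0 < leb A)%E ->
  exists2 f, S f & ~ ae_on A (fun t => f t = 0).

Definition is_norm D E : Prop :=
  [/\ forall f, gset E f -> 0 <= gauge E f,
      forall f, gset E f -> gauge E f = 0 -> ae_on D (fun t => f t = 0),
      forall (c : R) f, gset E f -> gauge E (fun t => c * f t) = `|c| * gauge E f &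
      forall f g, gset E f -> gset E g ->
        gauge E (fun t => f t + g t) <= gauge E f + gauge E g].

Definition monotone_gauge D E : Prop :=
  forall f g, gset E f -> gset E g -> ae_on D (fun t => `|f t| <= `|g t|) ->
  gauge E f <= gauge E g.

Definition gauge_complete E : Prop :=
  forall u : nat -> R -> R, (forall n, gset E (u n)) ->
  (forall e : R, 0 < e -> exists N : nat, forall m n : nat,
     (N <= m)%N -> (N <= n)%N -> gauge E (fun t => u m t - u n t) < e) ->
  exists2 f, gset E f &
    (fun n => gauge E (fun t => u n t - f t)) @ \oo --> (0 : R).

Record banach_function_space D E : Prop := BanachFunctionSpace {
  bfs_L0 : E `<=` L0 D ;
  bfs_linear : linear_subspace E ;
  bfs_solid : solid D E ;
  bfs_full : full_support D E ;
  bfs_norm : is_norm D E ;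
  bfs_monotone : monotone_gauge D E ;
  bfs_complete : gauge_complete E }.

Record fully_symmetric_space D E : Prop := FullySymmetricSpace {
  fs_bfs : banach_function_space D E ;
  fs_equimeasurable : forall f g, gset E f -> gset E g -> equimeasurable D f g ->
    gauge E f = gauge E g ;
  fs_prec : forall f g, L0 D f -> gset E g -> prec D f g ->
    gset E f /\ gauge E f <= gauge E g }.

(* "E has support D" *)
Definition has_support D E : Prop :=
  forall A, measurable A -> A `<=` D -> (leb A < +oo)%E -> gset E (\1_A).

Definition is_fundamental_function D E (phi : R -> R) : Prop :=
  forall (t : R) A, measurable A -> A `<=` D -> leb A = t%:E ->
  phi t = gauge E (\1_A).

Definition kothe_sup D F f : \bar R :=
  ereal_sup [set (\int[leb]_(t in D) (`|f t * g t|)%:E)%E | g in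
    [set g | gset F g /\ gauge F g <= 1]].

Definition kothe_dual D F : gauged_class :=
  GaugedClass [set f | L0 D f /\ (kothe_sup D F f < +oo)%E]
              (fun f => fine (kothe_sup D F f)).

(* Membership in F of a function on D with values in \bar R: it must agree a.e.
   with an element of F.  Its norm is then gauge F (fine \o u). *)
Definition emem D F (u : R -> \bar R) : Prop :=
  ae_on D (fun t => u t \is a fin_num) /\ gset F (fine \o u).

Definition primitive w (t : R) : \bar R :=
  (\int[leb]_(s in `]0%R, t[) (w s)%:E)%E.

Definition total_mass a w : \bar R := (\int[leb]_(t in oint a) (w t)%:E)%E.

Record decreasing_weight a w : Prop := DecreasingWeight {
  weight_gt0 : forall t, oint a t -> 0 < w t ;
  weight_noninc : forall s t, oint a s -> oint a t -> s <= t -> w t <= w s ;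
  weight_locint : forall t, oint a t -> (primitive w t < +oo)%E }.

Definition weighted_measure w (A : set R) : \bar R :=
  (\int[leb]_(t in A) (w t)%:E)%E.

(* In the next definitions I = (0, a), and F is a class of functions on
   J = (0, b) with b the total mass of w. *)
Definition F_w a w F : gauged_class :=
  let fstar f := rearrangement (weighted_measure w) (oint a) f in
  GaugedClass
    [set f | L0 (oint a) f /\ emem (oint (total_mass a w)) F (fstar f)]
    (fun f => gauge F (fine \o fstar f)).

Definition Lambda a w F : gauged_class :=
  let fstar f := rearrangement leb (oint a) f in
  GaugedClass
    [set f | L0 (oint a) f /\ emem (oint a) (F_w a w F) (fstar f)]
    (fun f => gauge (F_w a w F) (fine \o fstar f)).

Definition M_class a w F : gauged_class :=
  let quot f t := (rearrangement leb (oint a) f t * ((w t)^-1)%:E)%E in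
  GaugedClass
    [set f | L0 (oint a) f /\ emem (oint a) (F_w a w F) (quot f)]
    (fun f => gauge (F_w a w F) (fine \o quot f)).

Definition Q_space a w E : gauged_class :=
  let M := M_class a w E in
  GaugedClass
    [set f | L0 (oint a) f /\ exists2 g, gset M g & prec (oint a) f g]
    (fun f => inf [set gauge M g | g in [set g | gset M g /\ prec (oint a) f g]]).

Definition L1 a : gauged_class :=
  GaugedClass
    [set f | leb.-integrable (oint a) (EFin \o f)]
    (fun f => fine (\int[leb]_(t in oint a) (`|f t|)%:E)%E).

Definition marcinkiewicz_sup a w f : \bar R :=
  ereal_sup [set (((fine (primitive w t))^-1)%:E *
    \int[leb]_(s in `]0%R, t[) rearrangement leb (oint a) f s)%E | t in oint a].

Definition marcinkiewicz a w : gauged_class :=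
  GaugedClass
    [set f | L0 (oint a) f /\ (marcinkiewicz_sup a w f < +oo)%E]
    (fun f => fine (marcinkiewicz_sup a w f)).

Definition sum_class D E F : gauged_class :=
  let decomp f (p : (R -> R) * (R -> R)) :=
    [/\ gset E p.1, gset F p.2 & ae_on D (fun t => f t = p.1 t + p.2 t)] in
  GaugedClass
    [set f | L0 D f /\ exists p, decomp f p]
    (fun f => inf [set gauge E p.1 + gauge F p.2 | p in decomp f]).

Definition L1_plus_M a w : gauged_class :=
  sum_class (oint a) (L1 a) (marcinkiewicz a w).

Definition isometrically_equal E F : Prop :=
  gset E = gset F /\ (forall f, gset E f -> gauge E f = gauge F f).

Definition smallest_fully_symmetric_containing D (S : set (R -> R)) E : Prop :=
  [/\ fully_symmetric_space D E, S `<=` E &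
      forall X, fully_symmetric_space D X -> S `<=` X -> E `<=` X].

End defs.
Arguments gauged_class R : clear implicits.

(* Main.v *)
Require Import Defs.
From mathcomp Require Import all_boot all_order all_algebra.
From mathcomp Require Import all_classical all_reals all_analysis.
From mathcomp Require Import measurable_realfun lra.
Set Implicit Arguments.
Unset Strict Implicit.
Unset Printing Implicit Defensive.
Import Order.TTheory GRing.Theory Num.Theory.
Import numFieldNormedType.Exports.
Local Open Scope classical_set_scope.
Local Open Scope ring_scope.

(* Write [K_f x] for the integral of [f^*] over [(0, x)]. That [f] has norm less than [c] in
   Q_{E,w} means that [K_f] is dominated by the primitive of a decreasing function [u w],
   where [u^{*,w}] is itself dominated, in the sense of Hardy and Littlewood, by some [h] in
   [E] of norm less than [c]. Such pairs [(u, h)] can be added, even along a series, because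
   [f |-> K_f x] is countably subadditive; this gives linearity, the triangle inequality and
   completeness.

   For the embedding, [K_f x <= al + be W(x)] with [al + be <= t0 / phi t0 * c]: take for
   [be] the value of [h^*] at [t0] and for [al] the integral of [(h^* - be)^+]. Sorting the
   values of [|f|] in decreasing order, one lowers them greedily just as much as is needed
   to keep the integral below [be W]; concavity of [W] shows that what remains is still
   decreasing and that the total loss is at most [al].

   For the Koethe dual, the upper bound is the Hardy-Littlewood inequality used on [I] for
   the Lebesgue measure and for [w dm]. For the lower bound, let [h] in [E] have norm at most
   [1]; the integral of [(h^* o W) w f^*] is that of [h^*] times the rearrangement of [f^*]
   with respect to [w dm]. Approximate the decreasing function [(h^* o W) w] by staircases,
   and use for each step [(0, t)] a function [0 <= g <= 1] with integral at most [t] for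
   which the integral of [g |f|] is nearly [K_f t]. *)

(** * Initial intervals and the layer-cake formula *)

(** [M_{E,w}] need not be linear: [(f + g)^*] is not bounded pointwise by [f^* + g^*], only its
    integrals over initial intervals are bounded by theirs. Hence pairs [(u, h)] where [u * w] is
    merely decreasing and [h] bounds [u^{*,w}] only through integrals; both conditions survive
    addition. No measure-preserving map is used: rearrangements enter through the equivalence of
    [s < f^*(t)] and [t < d_f(s)], and through layer cakes, which make each integral of [f^*] one of
    [min(x, d_f)].

    The constant [t0 / phi t0] comes from averaging: the mean of [h^*] over [(0, t0)], spread as a
    constant on that interval, is dominated by [h]. For [b > 1], [al + be * y] is the tangent at
    [t0 = 1] of the concave integral of [h^*].

    The obstacle in the embedding is to carry over to [f] a splitting natural for [f^*]. Values of
    [|f|] are grouped in levels of ratio [q > 1], which costs a factor [q] and an error [e] for the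
    largest values; the part of [|f|] below the limit of [f^*] at infinity is set aside beforehand.
    Since [q] and [e] are arbitrary, they disappear from the norm estimate. *)

Notation leb := lebesgue_measure.

Section oint.
Context {R : realType}.
Implicit Types (x y : \bar R) (t : R).

Lemma oint_EFin t : oint t%:E = `]0, t[%classic.
Proof. by apply/seteqP; split => s; rewrite /oint /= in_itv/= lte_fin; [case=> -> ->|move/andP]. Qed.

Lemma oint_pinfty : oint +oo%E = `]0, +oo[%classic :> set R.
Proof.
by apply/seteqP; split => s; rewrite /oint /= in_itv/= andbT ltry; [case|split].
Qed.

Lemma oint_ninfty : oint -oo%E = set0 :> set R.
Proof. by apply/seteqP; split => s //= []. Qed.

Lemma oint_neq0 x : (0 < x)%E -> exists t, oint x t.
Proof.
case: x => [r|_|//]; last by exists 1; split; rewrite ?ltry.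
by rewrite lte_fin => r0; exists (r / 2); split; rewrite ?lte_fin; lra.
Qed.

Lemma measurable_oint x : measurable (oint x).
Proof.
by case: x => [r||]; rewrite ?oint_EFin ?oint_pinfty ?oint_ninfty.
Qed.

Lemma lebesgue_measure_oint x : (0 <= x)%E -> leb (oint x) = x.
Proof.
case: x => [r|_|//]; last by rewrite oint_pinfty lebesgue_measure_itv/= ltry.
rewrite oint_EFin lee_fin lebesgue_measure_itv/= lte_fin sube0.
by rewrite le_eqVlt => /predU1P[<-|->//]; rewrite ltxx.
Qed.

Lemma ointI x y : oint x `&` oint y = oint (Order.min x y).
Proof.
apply/seteqP; split => t /=; rewrite /oint /= lt_min.
  by move=> [[-> ->] [_ ->]].
by move=> [-> /andP[-> ->]].
Qed.

Lemma sub_oint x y : (x <= y)%E -> oint x `<=` oint y.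
Proof. by move=> xy t [t0 tx]; split => //; exact: lt_le_trans xy. Qed.

End oint.
#[global] Hint Extern 0 (measurable (oint _)) => apply: measurable_oint : core.

Section layer_cake.
Context {R : realType}.
Local Notation leb := (@leb R).
Implicit Types (rho u : R -> \bar R) (A : set R) (l : R).

(** Tonelli for the density [rho] on the planar region between the height [l] and the graph of [u].
    The cut at [l] serves for excesses [(|f| - l)^+]; the cut at 0 is the usual layer cake. *)
Lemma layer_cake_above l A rho u : measurable A ->
  measurable_fun A rho -> measurable_fun A u ->
  (forall t, A t -> 0 <= rho t)%E ->
  (\int[leb]_(t in A) (rho t * leb [set s | (l < s)%R /\ s%:E < u t]) =
   \int[leb]_(s in `]l, +oo[) \int[leb]_(t in A `&` [set t | s%:E < u t]) rho t)%E.
Proof.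
move=> mA mrho mu rho0.
pose u' := (u \_ A)%E; pose rho' := (rho \_ A)%E.
have mu' : measurable_fun setT u' by apply: (measurable_restrictT _ mA).1.
have mrho' : measurable_fun setT rho' by apply: (measurable_restrictT _ mA).1.
have rho'0 t : (0 <= rho' t)%E by apply: erestrict_ge0.
pose P := [set z : R * R | A z.1 /\ l < z.2 /\ (z.2%:E < u' z.1)%E].
have mP : measurable P.
  have -> : P = (fst @^-1` A) `&` ((snd @^-1` `]l, +oo[%classic) `&`
      (setT `&` [set z : R * R | (z.2%:E < u' z.1)%E])).
    by apply/seteqP; split => z; rewrite /P/= in_itv/= andbT => -[]; tauto.
  apply: measurableI; first by rewrite -[X in measurable X]setTI; exact: measurable_fst.
  apply: measurableI; first by rewrite -[X in measurable X]setTI; exact: measurable_snd.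
  apply: (@measurable_lte _ _ R setT _ (EFin \o snd) (u' \o fst)) => //.
    by apply/measurable_EFinP; exact: measurable_snd.
  by apply: measurableT_comp => //; exact: measurable_fst.
pose F z := (rho' z.1 * (\1_P z)%:E)%E.
have mF : measurable_fun setT F.
  apply: emeasurable_funM; first by apply: measurableT_comp => //; exact: measurable_fst.
  by apply/measurable_EFinP; exact: measurable_indic.
have F0 z : (0 <= F z)%E by rewrite mule_ge0// lee_fin.
have := @fubini_tonelli _ _ _ _ R leb leb F mF F0.
have mPs t : measurable [set s | P (t, s)].
  by have := measurable_xsection t mP; rewrite /xsection; congr measurable;
    apply/seteqP; split => s /=; rewrite inE.
have mPt s : measurable [set t | P (t, s)].
  by have := measurable_ysection s mP; rewrite /ysection; congr measurable;
    apply/seteqP; split => t /=; rewrite inE.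
have -> : (\int[leb]_t \int[leb]_s F (t, s) =
    \int[leb]_(t in A) (rho t * leb [set s | (l < s)%R /\ s%:E < u t]))%E.
  rewrite [RHS]integral_mkcond; apply: eq_integral => t _.
  have F1 s : \1_P (t, s) = \1_[set s | P (t, s)] s :> R.
    by rewrite !indicE; congr (_ %:R); apply/idP/idP; rewrite !inE.
  under eq_integral do rewrite /F /= F1.
  have mi : measurable_fun [set: R] (fun s => (\1_[set s | P (t, s)] s)%:E : \bar R).
    by apply/measurable_EFinP; exact: measurable_indic.
  rewrite ge0_integralZl//.
  rewrite integral_indic//; last exact: mPs.
  rewrite /rho' /patch.
  case: ifPn => [tA|_]; last by rewrite mul0e.
  congr (_ * leb _)%E; apply/seteqP; split => s /=; rewrite /P/= /u' /patch tA.
    by move=> [[_ [? ?]] _].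
  by move: tA; rewrite inE.
move->.
rewrite [RHS]integral_mkcond; apply: eq_integral => s _.
rewrite /patch.
have PE t : F (t, s) = if l < s then (rho \_ (A `&` [set t | (s%:E < u t)%E])) t else 0%E.
  rewrite /F /= indicE /rho' /patch; case: ifPn => [tA|tA]; last first.
    rewrite mul0e; case: ifPn => // _; case: ifPn => //.
    by rewrite in_setI (negbTE tA).
  rewrite in_setI tA /=; case: ifPn => ls; last first.
    by rewrite memNset ?mule0// /P/= (negbTE ls) => -[_ []].
  case: ifPn => [/set_mem/= su|/negP su].
    rewrite mem_set ?mule1// /P/= /u' /patch tA; split=> //; exact: set_mem.
  rewrite memNset ?mule0// /P/= /u' /patch tA => -[_ [_ su']].
  by apply: su; rewrite mem_set.
under eq_integral do rewrite PE.
rewrite mem_setE in_itv/= andbT; case: ifPn => ls; last by rewrite integral0.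
by rewrite -integral_mkcond.
Qed.

Lemma layer_cake A rho u : measurable A ->
  measurable_fun A rho -> measurable_fun A u ->
  (forall t, A t -> 0 <= rho t)%E -> (forall t, A t -> 0 <= u t)%E ->
  (\int[leb]_(t in A) (rho t * u t) =
   \int[leb]_(s in oint +oo) \int[leb]_(t in A `&` [set t | s%:E < u t]) rho t)%E.
Proof.
move=> mA mrho mu rho0 u0; rewrite oint_pinfty -layer_cake_above//.
apply: eq_integral => t; rewrite inE => At.
by rewrite -[RHS]/(_ * leb (oint _))%E lebesgue_measure_oint// u0.
Qed.

End layer_cake.

(** * Rearrangements with respect to a density *)

Lemma nonincreasing_emeasurable (R : realType) (f : R -> \bar R) :
  (forall x y, x <= y -> (f y <= f x)%E) -> measurable_fun setT f.
Proof.
move=> fd mT; apply: (measurability _ (ErealGenOInfty.measurableE R)) => // _ [_ [x ->] <-].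
rewrite setTI; apply: is_interval_measurable => s t /=.
rewrite !in_itv/= !andbT => fs ft u /andP[su ut].
by rewrite in_itv/= andbT (lt_le_trans ft)// fd.
Qed.

Lemma lt_ereal_subV (R : realType) (t : R) (x : \bar R) : (t%:E < x)%E ->
  exists n : nat, forall m : nat, (n <= m)%N -> (t%:E < x - (m.+1%:R^-1)%:E)%E.
Proof.
case: x => [r tr|_|//]; last by exists 0%N => m _; rewrite ltry.
exists (Num.truncn (r - t)^-1) => m mn; rewrite -EFinB lte_fin ltrBrDl -ltrBrDr.
rewrite invf_plt ?posrE ?subr_gt0//.
by rewrite (lt_le_trans (truncnS_gt _))// ler_nat.
Qed.

(** Monotone convergence along intervals that end strictly before [x], whether [x] is finite or not.
    It carries bounds known at the points of [oint x] to the whole interval, on which the integral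
    may be infinite a priori. *)
Lemma integral_oint_le (R : realType) (x c : \bar R) (g : R -> \bar R) :
  measurable_fun (oint x) g -> (forall t, oint x t -> (0 <= g t)%E) ->
  (forall t, oint x t -> (\int[leb]_(s in oint t%:E) g s <= c)%E) -> (0 <= c)%E ->
  (\int[leb]_(s in oint x) g s <= c)%E.
Proof.
move=> mg g0 gc c0.
have [x0|x0] := leP x 0%E.
  rewrite (_ : oint x = set0) ?integral_set0//.
  apply/seteqP; split => // t [t0 tx]; have := lt_le_trans tx x0.
  by rewrite lte_fin ltNge (ltW t0).
(* The minimum of [n] and [x - 1/(n+1)] is below [x] in both cases: the first term decides for
   infinite [x], the second for finite [x]. *)
pose F (n : nat) : set R := oint (Order.min n%:R%:E (x - (n.+1%:R^-1)%:E)%E).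
have Fx n : F n `<=` oint x.
  apply: sub_oint; rewrite ge_min; apply/orP; right.
  by rewrite geeDl// lee_fin oppr_le0.
have ndF : {homo F : n m / (n <= m)%N >-> (n <= m)%O}.
  move=> n m nm; apply/subsetPset; apply: sub_oint.
  rewrite le_min !ge_min lee_fin ler_nat nm/=.
  by rewrite leeD2l ?orbT// lee_fin lerN2 lef_pV2 ?posrE// ler_nat.
have -> : oint x = \bigcup_i F i.
  apply/seteqP; split => [t [t0 tx]|t [n _ /Fx]//].
  have [n1 n1t] : exists n1 : nat, t < n1%:R.
    by exists (Num.truncn t).+1; rewrite truncnS_gt.
  have [n2 n2t] : exists n2 : nat, forall m : nat, (n2 <= m)%N -> (t%:E < x - (m.+1%:R^-1)%:E)%E.
    exact: lt_ereal_subV.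
  exists (maxn n1 n2) => //; split => //; rewrite lt_min n2t ?leq_maxr// andbT lte_fin.
  by rewrite (lt_le_trans n1t)// ler_nat leq_maxl.
have := @ge0_nondecreasing_set_cvg_integral _ (measurableTypeR R) R F g leb ndF _ _ _.
have gF : forall i, measurable_fun (F i) g by move=> i; apply: measurable_funS (@Fx i) mg.
have g0F : forall i t, F i t -> (0 <= g t)%E by move=> i t /Fx/g0.
move=> /(_ (fun i => measurable_oint _) gF g0F) /cvg_lim <-//.
apply: lime_le.
  apply: ereal_nondecreasing_is_cvgn => n m nm; apply: ge0_subset_integral;
    [exact: measurable_oint|exact: measurable_oint|exact: gF|exact: g0F|].
  by apply/subsetPset; exact: ndF.
apply: nearW => n; rewrite /F.
case E : (Order.min _ _) => [r| |]; last by rewrite oint_ninfty integral_set0.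
- have [r0|r0] := ltP 0 r.
    have rx : (r%:E <= x)%E.
      rewrite -E ge_min; apply/orP; right.
      by rewrite geeDl// lee_fin oppr_le0.
    move: rx; rewrite le_eqVlt => /predU1P[rx|rx]; last exact: gc.
    exfalso; move: E; rewrite -rx => /eqP; rewrite lt_eqF//.
    by rewrite gt_min; apply/orP; right; rewrite -EFinB lte_fin ltrBlDr ltrDl.
  rewrite (_ : oint _ = set0) ?integral_set0//.
  apply/seteqP; split => // t [t0]; rewrite lte_fin => tr.
  by have := lt_le_trans tr r0; rewrite ltNge (ltW t0).
- by move: E => /eqP; rewrite lt_eqF// gt_min ltry.
Qed.

Lemma measurable_integral_noninc (R : realType) (D : set R) (phi : R -> \bar R)
    (B : R -> set R) (A : set R) :
  measurable D -> measurable_fun D phi -> (forall t, D t -> 0 <= phi t)%E ->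
  (forall s, measurable (B s)) -> (forall s, B s `<=` D) ->
  (forall s s', s <= s' -> B s' `<=` B s) ->
  measurable_fun A (fun s => \int[leb]_(t in B s) phi t)%E.
Proof.
move=> mD mphi phi0 mB BD nB; apply: measurable_funTS; apply: nonincreasing_emeasurable => s s' ss'.
apply: ge0_subset_integral; [exact: mB|exact: mB| | |exact: nB].
- by apply: measurable_funS mphi.
- by move=> t /BD; exact: phi0.
Qed.

Lemma lee_lt_real (R : realType) (x y : \bar R) : (0 <= y)%E ->
  (forall r : R, 0 <= r -> (r%:E < x)%E -> (r%:E <= y)%E) -> (x <= y)%E.
Proof.
move=> y0 H; rewrite leNgt; apply/negP => yx.
move: y0 H yx; case: y => [y||]; rewrite ?leye_eq//.
  rewrite lee_fin => y0 H; case: x H => [x||]//.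
  - move=> H; rewrite lte_fin => yx; have := H ((x + y) / 2).
    by rewrite !lte_fin lee_fin; lra.
  - move=> H _; have := H (y + 1).
    by rewrite ltry lee_fin => h; have := h ltac:(lra) isT; lra.
by move=> _ _; rewrite ltNge leey.
Qed.

Lemma integral_oint_cst (R : realType) (x c : \bar R) : (0 <= x)%E ->
  (\int[leb]_(t in oint x) c = c * x)%E.
Proof.
move=> x0; have := integral_cst (@leb R) (@measurable_oint R x) c.
by move=> /= ->; rewrite lebesgue_measure_oint.
Qed.

Lemma rearrangement_ge0 {R : realType} {mu : set R -> \bar R} {D : set R}
    (f : R -> R) (t : R) : (0 <= rearrangement mu D f t)%E.
Proof. by apply: le_ereal_inf_tmp => _ [s [s0 _] <-]; rewrite lee_fin ltW. Qed.

Lemma rearrangement_noninc {R : realType} {mu : set R -> \bar R} {D : set R}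
    (f : R -> R) (s t : R) :
  s <= t -> (rearrangement mu D f t <= rearrangement mu D f s)%E.
Proof.
move=> st; apply: ereal_inf_le_tmp => _ [r [r0 dr] <-]; exists r => //; split => //.
by apply: le_trans dr _; rewrite lee_fin.
Qed.

Lemma measurable_rearrangement {R : realType} {mu : set R -> \bar R} {D : set R}
    (f : R -> R) (A : set R) : measurable_fun A (rearrangement mu D f).
Proof.
apply: measurable_funTS; apply: nonincreasing_emeasurable.
exact: rearrangement_noninc.
Qed.

Lemma mul_rearrangement_le {R : realType} {mu : set R -> \bar R} {D : set R}
    (f : R -> R) (t : R) : 0 <= t ->
  (t%:E * rearrangement mu D f t <= \int[leb]_(s in oint t%:E) rearrangement mu D f s)%E.
Proof.
move=> t0; rewrite muleC.
rewrite -integral_oint_cst ?lee_fin//.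
apply: ge0_le_integral => //.
- by move=> s _; exact: rearrangement_ge0.
- exact: measurable_rearrangement.
- by move=> s [_]; rewrite lte_fin => st; apply: rearrangement_noninc; exact: ltW.
Qed.

Lemma rearrangement_fin {R : realType} {mu : set R -> \bar R} {D : set R}
    (f : R -> R) (t : R) :
  0 < t -> (\int[leb]_(s in oint t%:E) rearrangement mu D f s < +oo)%E ->
  rearrangement mu D f t \is a fin_num.
Proof.
move=> t0 h; rewrite ge0_fin_numE ?rearrangement_ge0//.
have := le_lt_trans (mul_rearrangement_le f (ltW t0)) h.
case: (rearrangement mu D f t) => [r _||]//; first by rewrite ltry.
by rewrite gt0_muley ?lte_fin// ltxx.
Qed.

Lemma measurable_fine_comp (R : realType) (A : set R) (u : R -> \bar R) :
  measurable_fun A u -> measurable_fun A (fine \o u).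
Proof. exact: (measurableT_comp (@fine_measurable R setT measurableT)). Qed.

Section rearr.
Context {R : realType} {D : set R} {rho : R -> R}.
Hypotheses (mD : measurable D) (mrho : measurable_fun D rho)
  (rho0 : forall t, D t -> 0 <= rho t).
Local Notation leb := (@leb R).
Implicit Types (f g : R -> R) (s t l : R) (x y : \bar R).
Local Notation mu := (weighted_measure rho).
Local Notation d := (Defs.distribution mu D).
Local Notation star := (rearrangement mu D).

Let mrhoE : measurable_fun D (EFin \o rho).
Proof. exact/measurable_EFinP. Qed.
Let rhoE0 t : D t -> (0 <= (rho t)%:E)%E.
Proof. by move=> /rho0; rewrite lee_fin. Qed.

Lemma le_weighted_measure A B : measurable A -> measurable B -> A `<=` B -> B `<=` D ->
  (mu A <= mu B)%E.
Proof.
move=> mA mB AB BD; apply: ge0_subset_integral => //.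
- by apply: measurable_funS BD _.
- by move=> t /BD; exact: rhoE0.
Qed.

Lemma weighted_measure_ge0 A : A `<=` D -> (0 <= mu A)%E.
Proof. by move=> AD; apply: integral_ge0 => t /AD; exact: rhoE0. Qed.

Lemma distribution_ge0 f s : (0 <= d f s)%E.
Proof. by apply: weighted_measure_ge0; exact: subIsetl. Qed.

Lemma measurable_superlevel f s : measurable_fun D f ->
  measurable (D `&` [set t | s < `|f t|]).
Proof.
move=> mf; have := @emeasurable_fun_o_infty _ _ R D (fun t => (`|f t|)%:E) mD _ s%:E.
by apply; apply/measurable_EFinP; exact: measurableT_comp.
Qed.

Lemma distribution_noninc f s s' : measurable_fun D f -> s <= s' -> (d f s' <= d f s)%E.
Proof.
move=> mf ss'; apply: le_weighted_measure; try exact: measurable_superlevel.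
- by move=> t [Dt /= h]; split => //=; exact: le_lt_trans h.
- exact: subIsetl.
Qed.

Lemma weighted_measure_bigcup_gt (F : nat -> set R) y :
  {homo F : n m / (n <= m)%N >-> (n <= m)%O} -> (forall i, measurable (F i)) ->
  (forall i, F i `<=` D) -> (y < mu (\bigcup_i F i))%E -> exists i, (y < mu (F i))%E.
Proof.
move=> ndF mF FD yF.
have := @ge0_nondecreasing_set_cvg_integral _ (measurableTypeR R) R F (EFin \o rho) leb ndF _ _ _.
have gF i : measurable_fun (F i) (EFin \o rho) by apply: measurable_funS (FD i) mrhoE.
have g0F : forall i t, F i t -> (0 <= (EFin \o rho) t)%E by move=> i t /FD/rhoE0.
move=> /(_ mF gF g0F) cF.
apply: contrapT => H; have : (mu (\bigcup_i F i) <= y)%E; last by rewrite leNgt yF.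
rewrite -[X in (X <= _)%E](cvg_lim _ cF)//; apply: lime_le.
  by apply/cvg_ex; exists (mu (\bigcup_i F i)).
by apply: nearW => n; rewrite leNgt; apply/negP => yFn; apply: H; exists n.
Qed.

(** The set [|f| > s] is the increasing union of the sets [|f| > s + 1/(n+1)]. *)
Lemma distribution_right_cts f s y : measurable_fun D f -> (y < d f s)%E ->
  exists2 s', s < s' & (y < d f s')%E.
Proof.
move=> mf yd; pose F (n : nat) := D `&` [set t | s + n.+1%:R^-1 < `|f t|].
have ndF : {homo F : n m / (n <= m)%N >-> (n <= m)%O}.
  move=> n m nm; apply/subsetPset => t [Dt /= h]; split => //=.
  by apply: le_lt_trans h; rewrite lerD2l lef_pV2 ?posrE// ler_nat.
have FE : \bigcup_i F i = D `&` [set t | s < `|f t|].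
  apply/seteqP; split => [t [n _ [Dt /= h]]|t [Dt /= h]].
    by split => //=; apply: lt_trans h; rewrite ltrDl.
  exists (Num.truncn (`|f t| - s)^-1) => //; split => //=.
  by rewrite -ltrBrDl invf_plt ?posrE ?subr_gt0// truncnS_gt.
have [|||i yi] := @weighted_measure_bigcup_gt F y ndF.
- by move=> i; exact: measurable_superlevel.
- by move=> i; exact: subIsetl.
- by rewrite FE.
by exists (s + i.+1%:R^-1); rewrite ?ltrDl.
Qed.

(** The equivalence on which all work with rearrangements rests. The infimum in [star f t] runs over
    levels whose distribution is at most [t]; right continuity of [d f] prevents such levels from
    accumulating at [s] when [t < d f s]. *)
Lemma rearrangement_gt f s t : measurable_fun D f -> 0 <= s ->
  (s%:E < star f t)%E = (t%:E < d f s)%E.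
Proof.
move=> mf s0; apply/idP/idP => [|ts].
  rewrite !ltNge; apply: contra => dst; apply/lee_addgt0Pr => e e0.
  (* The infimum runs over positive levels and [s] may be 0, whence [s + e]. *)
  apply: ereal_inf_lbound; exists (s + e) => //; split; first by rewrite /= ltr_wpDl.
  by apply: le_trans dst; apply: distribution_noninc; rewrite // lerDl ltW.
have [s' ss' ts'] := distribution_right_cts mf ts.
apply: (@lt_le_trans _ _ s'%:E); first by rewrite lte_fin.
apply: le_ereal_inf_tmp => _ [r [r0 dr] <-]; rewrite lee_fin leNgt; apply/negP => rs'.
have := le_trans (distribution_noninc mf (ltW rs')) dr.
by rewrite leNgt ts'.
Qed.

Lemma measurable_distribution f A : measurable_fun D f -> measurable_fun A (d f).
Proof.
move=> mf; apply: measurable_funTS; apply: nonincreasing_emeasurable => s s'.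
exact: distribution_noninc.
Qed.

Lemma superlevel_rearrangement f s x : measurable_fun D f -> 0 <= s ->
  oint x `&` [set t | (s%:E < star f t)%E] = oint (Order.min x (d f s)).
Proof.
move=> mf s0; rewrite -ointI; apply/seteqP; split => t [[t0 tx]] /=.
  by rewrite rearrangement_gt.
by move=> [_ td]; rewrite rearrangement_gt.
Qed.

(** Layer cake: the superlevel set of [star f] at [s], cut at [x], is an initial interval of length
    [min x (d f s)]. Inequalities between integrals of rearrangements thus become inequalities
    between distribution functions. *)
Lemma integral_rearrangement f x : measurable_fun D f -> (0 <= x)%E ->
  (\int[leb]_(t in oint x) star f t =
   \int[leb]_(s in oint +oo) Order.min x (d f s))%E.
Proof.
move=> mf x0.
have := @layer_cake R (oint x) (cst 1%E) (star f) (@measurable_oint R x).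
move=> /(_ (measurable_cst _) (@measurable_rearrangement R mu D f _)).
move=> /(_ (fun _ _ => lee01) (fun t _ => rearrangement_ge0 f t)).
under eq_integral do rewrite /cst mul1e.
move=> ->; apply: eq_integral => s; rewrite inE => -[s0 _].
rewrite superlevel_rearrangement ?(ltW s0)//.
rewrite /cst integral_oint_cst ?mul1e//.
by rewrite le_min x0 distribution_ge0.
Qed.

Lemma integral_excess f l : measurable_fun D f -> 0 <= l ->
  (\int[leb]_(t in D) ((Num.max (`|f t| - l) 0) * rho t)%:E =
   \int[leb]_(s in `]l, +oo[) d f s)%E.
Proof.
move=> mf l0.
have mfE : measurable_fun D (fun t => `|f t|%:E).
  by apply/measurable_EFinP; exact: measurableT_comp.
have := layer_cake_above l mD mrhoE mfE rhoE0.
rewrite /weighted_measure /Defs.distribution => <-.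
apply: eq_integral => t _; rewrite mulrC EFinM; congr (_ * _)%E.
rewrite (_ : [set s | _] = `]l, `|f t|[%classic); last first.
  by apply/seteqP; split => s /=; rewrite in_itv/= lte_fin => /andP.
rewrite lebesgue_measure_itv/= lte_fin -EFinB.
by case: ltP => h; [rewrite max_l// subr_ge0 ltW|rewrite max_r// subr_le0].
Qed.

Lemma integral_rearrangement_split f l x : measurable_fun D f -> 0 <= l -> (0 <= x)%E ->
  (\int[leb]_(t in oint x) star f t =
   \int[leb]_(s in oint l%:E) Order.min x (d f s) +
   \int[leb]_(s in `]l, +oo[) Order.min x (d f s))%E.
Proof.
move=> mf l0 x0; rewrite integral_rearrangement//.
have mm A : measurable_fun A (fun s => Order.min x (d f s)).
  by apply: measurable_mine; [exact: measurable_cst|exact: measurable_distribution].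
have m0 s : (0 <= Order.min x (d f s))%E by rewrite le_min x0 distribution_ge0.
(* For [l = 0] the closed half-line contains the point 0, which is not in [oint +oo]; it is removed
   here and restored below as a null set. *)
have -> : oint +oo = `]0, l[ `|` `[l, +oo[ `\ 0 :> set R.
  rewrite oint_pinfty; apply/seteqP; split => s /=; rewrite !in_itv/= !andbT.
    move=> s0; case: (ltP s l) => sl; [left|right]; rewrite ?s0//.
    by split => // s0'; rewrite s0' ltxx in s0.
  move=> [/andP[]//|[ls /eqP s0]]; rewrite lt_neqAle eq_sym s0/=.
  exact: le_trans ls.
rewrite ge0_integral_setU//; [|exact: measurableD|exact: mm|]; last first.
  apply/disj_setPS => s /=; rewrite !in_itv/= andbT => -[/andP[_ sl]] [].
  by rewrite leNgt sl.
rewrite integral_setD1; [|exact: measurableD|exact: mm].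
by rewrite -(integral_itv_obnd_cbnd (mm _)) oint_EFin.
Qed.

(** In the layer cake, [min x (d f s)] is bounded by [x] for [s] below [l] and by [d f s] above
    [l]. *)
Lemma integral_rearrangement_le f l x : measurable_fun D f -> 0 <= l -> (0 <= x)%E ->
  (\int[leb]_(t in oint x) star f t <=
   \int[leb]_(t in D) ((Num.max (`|f t| - l) 0) * rho t)%:E + l%:E * x)%E.
Proof.
move=> mf l0 x0; rewrite (integral_rearrangement_split mf l0)// integral_excess//.
have md A : measurable_fun A (d f) by exact: measurable_distribution.
have mm A : measurable_fun A (fun s => Order.min x (d f s)).
  by apply: measurable_mine => //; exact: measurable_cst.
have m0 s : (0 <= Order.min x (d f s))%E by rewrite le_min x0 distribution_ge0.
rewrite addeC; apply: leeD.
  by apply: ge0_le_integral; [| |exact: mm|exact: md|] => // s _; rewrite ge_min lexx orbT.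
rewrite muleC -integral_oint_cst ?lee_fin//.
by apply: ge0_le_integral; [| |exact: mm| |] => // s _; rewrite ge_min lexx.
Qed.

(** At [l = f^*(t)] these two bounds are exact: [d f s > t] for [s < l] and [d f s <= t] for
    [s > l]. *)
Lemma integral_rearrangement_eq f l t : measurable_fun D f -> 0 <= t -> star f t = l%:E ->
  (\int[leb]_(t in D) ((Num.max (`|f t| - l) 0) * rho t)%:E + l%:E * t%:E <=
   \int[leb]_(s in oint t%:E) star f s)%E.
Proof.
move=> mf t0 ft; have l0 : 0 <= l by rewrite -lee_fin -ft rearrangement_ge0.
have x0 : (0 <= t%:E)%E by rewrite lee_fin.
rewrite (integral_rearrangement_split mf l0)// integral_excess//.
have md A : measurable_fun A (d f) by exact: measurable_distribution.
have mm A : measurable_fun A (fun s => Order.min t%:E (d f s)).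
  by apply: measurable_mine => //; exact: measurable_cst.
have m0 s : (0 <= Order.min t%:E (d f s))%E by rewrite le_min x0 distribution_ge0.
rewrite addeC; apply: leeD; last first.
  apply: ge0_le_integral; [| |exact: md|exact: mm|] => // [s _|s].
    exact: distribution_ge0.
  rewrite /= in_itv/= andbT => ls.
  rewrite le_min lexx andbT leNgt -rearrangement_gt// ?ft ?(ltW (le_lt_trans l0 ls))//.
  by rewrite lte_fin -leNgt ltW.
rewrite muleC -integral_oint_cst ?lee_fin//.
apply: ge0_le_integral; [| | |exact: mm|] => // s [s0]; rewrite lte_fin => sl.
by rewrite le_min lexx/= ltW// -rearrangement_gt// ?ft ?lte_fin// ltW.
Qed.

Lemma measurable_excess f l : measurable_fun D f ->
  measurable_fun D (fun t => ((Num.max (`|f t| - l) 0) * rho t)%:E).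
Proof.
move=> mf; apply/measurable_EFinP; apply: measurable_funM => //.
apply: measurable_maxr => //; apply: measurable_funB => //.
exact: measurableT_comp.
Qed.

(* Both sides are minima over [l] of [\int (|f| - l)^+ + l * t], the minimum being
   attained at [l = f^*(t)]. *)
Lemma integral_rearrangementD f g t : measurable_fun D f -> measurable_fun D g -> 0 <= t ->
  (\int[leb]_(s in oint t%:E) star (fun s => (f s + g s)%R) s <=
   \int[leb]_(s in oint t%:E) star f s + \int[leb]_(s in oint t%:E) star g s)%E.
Proof.
move=> mf mg; rewrite le_eqVlt => /predU1P[<-|t0].
  by rewrite oint_EFin set_itvoo0 !integral_set0 adde0.
have i0 h : (0 <= \int[leb]_(s in oint t%:E) star h s)%E.
  by apply: integral_ge0 => s _; exact: rearrangement_ge0.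
have [fy|fy] := leP +oo%E (\int[leb]_(s in oint t%:E) star f s)%E.
  by move: fy; rewrite leye_eq => /eqP->; rewrite addye ?leey// gt_eqF// (lt_le_trans _ (i0 g)).
have [gy|gy] := leP +oo%E (\int[leb]_(s in oint t%:E) star g s)%E.
  by move: gy; rewrite leye_eq => /eqP->; rewrite addey ?leey// gt_eqF// (lt_le_trans _ (i0 f)).
have fl := fineK (rearrangement_fin t0 fy); have gl := fineK (rearrangement_fin t0 gy).
set l := fine _ in fl; set m := fine _ in gl.
have l0 : 0 <= l by rewrite fine_ge0// rearrangement_ge0.
have m0 : 0 <= m by rewrite fine_ge0// rearrangement_ge0.
have mfg : measurable_fun D (fun s => f s + g s) by exact: measurable_funD.
apply: le_trans (leeD (integral_rearrangement_eq mf (ltW t0) (esym fl))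
                      (integral_rearrangement_eq mg (ltW t0) (esym gl))).
apply: (le_trans (integral_rearrangement_le mfg (addr_ge0 l0 m0) _)); first by rewrite lee_fin ltW.
rewrite addeACA -muleDl//; apply: leeD => //.
rewrite -ge0_integralD//; [| | | |].
- apply: ge0_le_integral => //.
  + by move=> s Ds; rewrite lee_fin mulr_ge0 ?rho0// le_max lexx orbT.
  + exact: measurable_excess.
  + by apply: emeasurable_funD; exact: measurable_excess.
  + move=> s Ds; rewrite -EFinD lee_fin -mulrDl ler_wpM2r ?rho0//.
    have fgs := ler_normD (f s) (g s).
    have h0 (x : R) : 0 <= Num.max x 0 by rewrite le_max lexx orbT.
    have h1 (x : R) : x <= Num.max x 0 by rewrite le_max lexx.
    rewrite ge_max addr_ge0// andbT.
    apply: le_trans (lerD (h1 (`|f s| - l)) (h1 (`|g s| - m))); lra.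
- by move=> s Ds; rewrite lee_fin mulr_ge0 ?rho0// le_max lexx orbT.
- exact: measurable_excess.
- by move=> s Ds; rewrite lee_fin mulr_ge0 ?rho0// le_max lexx orbT.
- exact: measurable_excess.
Qed.

Lemma le_weighted_measure_ae A B : measurable A -> measurable B -> A `<=` D -> B `<=` D ->
  leb.-negligible (A `\` B) -> (mu A <= mu B)%E.
Proof.
move=> mA mB AD BD N; have mAB : measurable (A `\` B) by exact: measurableD.
have AB0 : leb (A `\` B) = 0%E by apply/negligibleP.
have mrA : measurable_fun A (EFin \o rho) by apply: measurable_funS mrhoE.
rewrite /weighted_measure (@ge0_negligible_integral _ (measurableTypeR R) R leb _ _ _ mAB mA mrA _ AB0); last first.
  by move=> t /AD/rhoE0.
by rewrite setDD; apply: le_weighted_measure => //; exact: measurableI.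
Qed.

Lemma eq_rearrangement (mu1 mu2 : set R -> \bar R) D1 D2 (f g : R -> R) :
  (forall s, 0 < s -> Defs.distribution mu1 D1 f s = Defs.distribution mu2 D2 g s) ->
  rearrangement mu1 D1 f = rearrangement mu2 D2 g.
Proof.
move=> fg; apply/funext => t; congr ereal_inf.
by apply/seteqP; split => _ [s [s0 h] <-]; exists s => //; split => //; move: h; rewrite fg.
Qed.

Lemma le_distribution f g s : measurable_fun D f -> measurable_fun D g ->
  ae_on D (fun t => `|f t| <= `|g t|) -> (d f s <= d g s)%E.
Proof.
move=> mf mg fg; apply: le_weighted_measure_ae; try exact: measurable_superlevel;
  try exact: subIsetl.
apply: negligibleS fg => t [[Dt /= sf] ng] /(_ Dt) h; apply: ng; split => //=.
exact: lt_le_trans h.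
Qed.

Lemma le_rearrangement f g t : measurable_fun D f -> measurable_fun D g ->
  ae_on D (fun t => `|f t| <= `|g t|) -> (star f t <= star g t)%E.
Proof.
move=> mf mg fg; apply: ereal_inf_le_tmp => _ [s [s0 h] <-]; exists s => //; split => //.
by apply: le_trans h; exact: le_distribution.
Qed.

Lemma rearrangement0 t : 0 <= t -> star (fun=> 0) t = 0%E.
Proof.
move=> t0; apply/eqP; rewrite eq_le rearrangement_ge0 andbT leNgt.
rewrite rearrangement_gt//.
rewrite /Defs.distribution (_ : _ `&` _ = set0) ?/weighted_measure ?integral_set0.
  by rewrite lte_fin -leNgt.
by apply/seteqP; split => // s [_ /=]; rewrite normr0 ltxx.
Qed.

Lemma rearrangementZ f c t : measurable_fun D f -> 0 <= t ->
  (star (fun s => (c * f s)%R) t <= `|c|%:E * star f t)%E.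
Proof.
move=> mf t0; have [->|c0] := eqVneq c 0.
  under [X in rearrangement _ _ X]eq_fun do rewrite mul0r.
  by rewrite rearrangement0// normr0 mul0e.
have mcf : measurable_fun D (fun s => c * f s) by exact: measurable_funM.
rewrite leNgt; apply/negP => h.
case f0 : (star f t) => [r| |]; last 2 first.
- by move: h; rewrite f0 gt0_muley ?lte_fin ?normr_gt0// ltNge leey.
- by have := @rearrangement_ge0 _ mu D f t; rewrite f0.
have r0 : 0 <= r by rewrite -lee_fin -f0 rearrangement_ge0.
move: h; rewrite f0 -EFinM rearrangement_gt ?mulr_ge0//.
have -> : d (fun s => c * f s) (`|c| * r) = d f r.
  rewrite /Defs.distribution; congr (weighted_measure _ (_ `&` _)).
  by apply/seteqP; split => s /=; rewrite normrM ltr_pM2l ?normr_gt0.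
by rewrite -rearrangement_gt// f0 ltxx.
Qed.

(* [|f| <= sum_k |f_k|] a.e.; the level sets of [f] are exhausted by those of the
   partial sums. *)
Lemma integral_rearrangement_nneseries f (u : nat -> R -> R) t :
  measurable_fun D f -> (forall k, measurable_fun D (u k)) -> 0 <= t ->
  ae_on D (fun s => (`|f s|%:E <= \sum_(0 <= k <oo) `|u k s|%:E)%E) ->
  (\int[leb]_(s in oint t%:E) star f s <=
   \sum_(0 <= k <oo) \int[leb]_(s in oint t%:E) star (u k) s)%E.
Proof.
move=> mf mu_ t0 fu; pose S n s := \sum_(0 <= k < n) `|u k s|.
have mS n : measurable_fun D (S n).
  by apply: measurable_sum => k; exact: measurableT_comp.
have S0 n s : 0 <= S n s by apply: sumr_ge0.
have ndS s : {homo S^~ s : n m / (n <= m)%N >-> n <= m}.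
  move=> n m nm /=; rewrite /S (@big_cat_nat _ _ _ n 0%N m)//=.
  by rewrite lerDl; apply: sumr_ge0.
have SK n : (\int[leb]_(s in oint t%:E) star (S n) s <=
    \sum_(0 <= k < n) \int[leb]_(s in oint t%:E) star (u k) s)%E.
  elim: n => [|n IH].
    rewrite big_geq// (eq_integral (cst 0%E)) ?integral0// => s; rewrite inE => -[s0 _].
    rewrite (_ : S 0%N = fun=> 0); first by rewrite rearrangement0// ltW.
    by apply/funext => r; rewrite /S big_geq.
  rewrite big_nat_recr//=; apply: le_trans (leeD IH (lexx _)).
  have -> : S n.+1 = fun s => S n s + `|u n s|.
    by apply/funext => r; rewrite /S big_nat_recr.
  have mun : measurable_fun D (fun r => `|u n r|) by exact: measurableT_comp.
  apply: (le_trans (@integral_rearrangementD (S n) (fun r => `|u n r|) t (mS n) mun t0)).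
  apply: leeD; first exact: lexx.
  apply: ge0_le_integral => //.
  - by move=> s _; exact: rearrangement_ge0.
  - exact: measurable_rearrangement.
  - exact: measurable_rearrangement.
  - move=> s _; apply: le_rearrangement => //.
    by apply: aeW => r _; rewrite normr_id.
have ndstar s : {homo (fun n => star (S n) s) : n m / (n <= m)%N >-> (n <= m)%E}.
  move=> n m nm; apply: le_rearrangement => //.
  by apply: aeW => r _; rewrite !ger0_norm// ndS.
have star_le s : 0 < s -> (star f s <= limn (fun n => star (S n) s))%E.
  move=> s0; have lim_ge n : (star (S n) s <= limn (fun n => star (S n) s))%E.
    rewrite (cvg_lim _ (ereal_nondecreasing_cvgn (ndstar s)))//.
    by apply: ereal_sup_ubound; exists n.
  apply: lee_lt_real => [|r r0].
    by apply: le_trans (lim_ge 0%N); exact: rearrangement_ge0.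
  rewrite rearrangement_gt// => sdf.
  pose F n := D `&` [set t | r < `|S n t|].
  have ndF : {homo F : n m / (n <= m)%N >-> (n <= m)%O}.
    move=> n m nm; apply/subsetPset => x [Dx /= rx]; split => //=.
    by apply: (lt_le_trans rx); rewrite !ger0_norm// ndS.
  have mF n : measurable (F n) by exact: measurable_superlevel.
  have FD n : F n `<=` D by exact: subIsetl.
  have [|n] := @weighted_measure_bigcup_gt F s%:E ndF mF FD.
    apply: (lt_le_trans sdf); apply: le_weighted_measure_ae.
    - exact: measurable_superlevel.
    - exact: bigcup_measurable.
    - exact: subIsetl.
    - by apply: bigcup_sub.
    - apply: negligibleS fu => x [[Dx /= rx] nx] /(_ Dx) h; apply: nx.
      have /ereal_sup_gt[_ [n _ <-] rn] : (r%:E < ereal_sup (range (fun n => (S n x)%:E)))%E.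
        apply: lt_le_trans (_ : `|f x|%:E <= _)%E; first by rewrite lte_fin.
        apply: (le_trans h); apply: lime_le; first exact: is_cvg_nneseries.
        by apply: nearW => n; rewrite sumEFin; apply: ereal_sup_ubound; exists n.
      by exists n => //; split => //=; rewrite ger0_norm// -lte_fin.
  by rewrite -/(Defs.distribution _ _ _ _) -rearrangement_gt// => /ltW h; exact: le_trans (lim_ge n).
apply: (@le_trans _ _ (\int[leb]_(s in oint t%:E) limn (fun n => star (S n) s))%E).
  apply: ge0_le_integral => //.
  - by move=> s _; exact: rearrangement_ge0.
  - exact: measurable_rearrangement.
  - apply: (emeasurable_fun_cvg (fun n => star (S n))).
      by move=> n; exact: measurable_rearrangement.
    by move=> s _; exact: ereal_nondecreasing_is_cvgn.
  - by move=> s [s0 _]; exact: star_le.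
rewrite monotone_convergence//; last 2 first.
- by move=> n; exact: measurable_rearrangement.
- by move=> n s _; exact: rearrangement_ge0.
apply: lee_lim.
- apply: ereal_nondecreasing_is_cvgn => n m nm; apply: ge0_le_integral => //.
  + by move=> s _; exact: rearrangement_ge0.
  + exact: measurable_rearrangement.
  + exact: measurable_rearrangement.
  + by move=> s _; exact: ndstar.
- apply: is_cvg_nneseries => n _ _; apply: integral_ge0 => s _; exact: rearrangement_ge0.
- by apply: nearW.
Qed.

Lemma superlevel_rearrangement_idem f x s : measurable_fun D f ->
  (forall t, oint x t -> star f t \is a fin_num) -> 0 <= s -> (d f s <= x)%E ->
  Defs.distribution leb (oint x) (fine \o star f) s = d f s.
Proof.
move=> mf ffin s0 dx; rewrite -[RHS](@lebesgue_measure_oint R) ?distribution_ge0//.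
rewrite -[in RHS](min_idPr dx) -superlevel_rearrangement//; congr (leb _).
apply/seteqP; split => t [xt] /=.
  rewrite -lte_fin => h; split => //=; rewrite -(fineK (ffin _ xt)).
  by rewrite ger0_norm ?fine_ge0 ?rearrangement_ge0// in h.
move=> h; split => //=; rewrite -lte_fin ger0_norm ?fine_ge0 ?rearrangement_ge0//.
by rewrite fineK// ffin.
Qed.

(** Equimeasurability: the superlevel set of [star f] at [s] has length [d f s], which never exceeds
    the length [mu D] of the interval. Finiteness is asked at every point because [fine] sends [+oo]
    to 0. *)
Lemma rearrangement_idem f : measurable_fun D f ->
  (forall t, oint (mu D) t -> star f t \is a fin_num) ->
  rearrangement leb (oint (mu D)) (fine \o star f) = star f.
Proof.
move=> mf ffin; apply: eq_rearrangement => s s0.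
apply: superlevel_rearrangement_idem => //; first exact: ltW.
by apply: le_weighted_measure => //; exact: measurable_superlevel.
Qed.

(* Hardy's lemma; only the fact that the superlevel sets of the weight [star f]
   are initial intervals is used. *)
Lemma hardy_le f (phi psi : R -> \bar R) x : measurable_fun D f -> (0 <= x)%E ->
  measurable_fun (oint x) phi -> (forall t, oint x t -> 0 <= phi t)%E ->
  measurable_fun (oint x) psi -> (forall t, oint x t -> 0 <= psi t)%E ->
  (forall t, oint x t ->
    \int[leb]_(s in oint t%:E) phi s <= \int[leb]_(s in oint t%:E) psi s)%E ->
  (\int[leb]_(t in oint x) (phi t * star f t) <=
   \int[leb]_(t in oint x) (psi t * star f t))%E.
Proof.
move=> mf x0 mphi phi0 mpsi psi0 H.
rewrite !layer_cake//; try exact: measurable_rearrangement;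
  try by move=> *; exact: rearrangement_ge0.
have m0 s : (0 <= Order.min x (d f s))%E by rewrite le_min x0 distribution_ge0.
have sub s : oint (Order.min x (d f s)) `<=` oint x by apply: sub_oint; rewrite ge_min lexx.
have E s (th : R -> \bar R) : oint +oo s -> (\int[leb]_(t in oint x `&` [set t | s%:E < star f t]) th t =
    \int[leb]_(t in oint (Order.min x (d f s))) th t)%E.
  by move=> [s0 _]; rewrite superlevel_rearrangement// ltW.
under eq_integral => s /set_mem s0 do rewrite (E s)//.
under [leRHS]eq_integral => s /set_mem s0 do rewrite (E s)//.
have mint (th : R -> \bar R) : measurable_fun (oint x) th -> (forall t, oint x t -> 0 <= th t)%E ->
    measurable_fun (oint +oo) (fun s => \int[leb]_(t in oint (Order.min x (d f s))) th t)%E.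
  move=> mth th0; apply: (measurable_integral_noninc (@measurable_oint R x) mth) => // s s' ss'.
  apply: sub_oint; rewrite le_min !ge_min lexx/=.
  by rewrite (distribution_noninc mf ss') orbT.
apply: ge0_le_integral; [by []| |exact: mint|exact: mint|].
  by move=> s _; apply: integral_ge0 => t /sub/phi0.
move=> s _; apply: integral_oint_le.
- exact: measurable_funS mphi.
- by move=> t /sub/phi0.
- move=> t mt; apply: (le_trans (H _ (sub _ _ mt))).
  apply: ge0_subset_integral => //.
  + exact: measurable_funS mpsi.
  + by move=> r /sub/psi0.
  + by apply: sub_oint; case: mt => _ /ltW.
- by apply: integral_ge0 => t /sub/psi0.
Qed.

End rearr.

(** * The Hardy-Littlewood inequality for a measure with density *)

Section hardy_littlewood.
Context {R : realType} {D : set R} {rho : R -> R}.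
Hypotheses (mD : measurable D) (mrho : measurable_fun D rho)
  (rho0 : forall t, D t -> 0 <= rho t).
Local Notation leb := (@leb R).
Implicit Types (f g : R -> R) (s t l : R) (x y : \bar R).
Local Notation mu := (weighted_measure rho).
Local Notation d := (Defs.distribution mu D).
Local Notation star := (rearrangement mu D).

(** At each level the part of [A] where [|f| > s] has measure at most both [mu A] and [d f s], and
    the layer cake of [star f] on [oint (mu A)] integrates the minimum of the two. *)
Lemma integral_le_rearrangement f A : measurable A -> A `<=` D -> measurable_fun D f ->
  (\int[leb]_(t in A) (rho t * `|f t|)%:E <= \int[leb]_(s in oint (mu A)) star f s)%E.
Proof.
move=> mA AD mf; have mfA : measurable_fun A f by exact: measurable_funS mf.
have mrA : measurable_fun A rho by exact: measurable_funS mrho.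
have r0A t : A t -> 0 <= rho t by move=> /AD/rho0.
rewrite (integral_rearrangement mD mrho rho0 mf); last exact: (weighted_measure_ge0 r0A).
under eq_integral do rewrite EFinM.
rewrite (@layer_cake _ A (EFin \o rho) (fun t => `|f t|%:E)) //; first last.
  by apply/measurable_EFinP; exact: measurableT_comp.
  exact/measurable_EFinP.
apply: ge0_le_integral => //.
- by move=> s _; apply: integral_ge0 => t [/r0A h _]; rewrite /= lee_fin.
- have := @measurable_distribution _ A rho mA mrA r0A f (oint +oo) mfA.
  by [].
- apply: measurable_mine; first exact: measurable_cst.
  exact: measurable_distribution.
- move=> s _; rewrite (_ : [set t | _] = [set t | s < `|f t|]); last first.
    by apply/seteqP; split => t /=; rewrite lte_fin.
  rewrite -/(weighted_measure _ _) le_min; apply/andP; split.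
    apply: (le_weighted_measure mA mrA r0A) => //; exact: measurable_superlevel.
  apply: (le_weighted_measure mD mrho rho0); try exact: measurable_superlevel.
  + by move=> t [/AD].
  + exact: subIsetl.
Qed.

(** Only [f] is sliced. On the set [|f| > s] the integral of [rho |g|] is at most that of [star g]
    up to [d f s], and this initial interval is the superlevel set of [star f] at [s]. *)
Lemma hardy_littlewood f g : measurable_fun D f -> measurable_fun D g ->
  (\int[leb]_(t in D) (rho t * `|f t * g t|)%:E <=
   \int[leb]_(s in oint (mu D)) (star g s * star f s))%E.
Proof.
move=> mf mg.
have mg' : measurable_fun D (fun t => (rho t * `|g t|)%:E).
  by apply/measurable_EFinP; apply: measurable_funM => //; exact: measurableT_comp.
have g'0 t : D t -> (0 <= (rho t * `|g t|)%:E)%E by move=> Dt; rewrite lee_fin mulr_ge0 ?rho0.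
have -> : (\int[leb]_(t in D) (rho t * `|f t * g t|)%:E =
    \int[leb]_(t in D) ((rho t * `|g t|)%:E * `|f t|%:E))%E.
  by apply: eq_integral => t _; rewrite -EFinM normrM [`|f t| * _]mulrC mulrA.
rewrite (@layer_cake _ D (fun t => (rho t * `|g t|)%:E) (fun t => `|f t|%:E)) //; last first.
  by apply/measurable_EFinP; exact: measurableT_comp.
rewrite layer_cake//; try exact: measurable_rearrangement;
  try by move=> *; exact: rearrangement_ge0.
have dD s : (d f s <= mu D)%E.
  apply: (le_weighted_measure mD mrho rho0) => //; exact: measurable_superlevel.
apply: ge0_le_integral => //.
- by move=> s _; apply: integral_ge0 => t [/g'0].
- apply: (measurable_integral_noninc mD mg' g'0).
  + by move=> s; exact: measurable_superlevel.
  + by move=> s; exact: subIsetl.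
  + by move=> s s' ss' t [Dt /= h]; split => //=; exact: le_lt_trans h.
- apply: (@measurable_integral_noninc _ (oint (mu D)) (star g)) => //.
  + exact: measurable_rearrangement.
  + by move=> t _; exact: rearrangement_ge0.
  + move=> s; apply: emeasurable_fun_o_infty => //; exact: measurable_rearrangement.
  + move=> s s' ss' t [Dt /= h]; split => //=; apply: le_lt_trans h.
    by rewrite lee_fin.
- move=> s [s0 _]; rewrite (superlevel_rearrangement mD mrho rho0)// ?(ltW s0)//.
  rewrite (min_idPr (dD s)).
  rewrite (_ : [set t | (s%:E < `|f t|%:E)%E] = [set t | s < `|f t|]); last first.
    by apply/seteqP; split => t /=; rewrite lte_fin.
  by apply: integral_le_rearrangement => //; exact: measurable_superlevel.
Qed.

End hardy_littlewood.

(** Lebesgue measure is treated as the density 1, so that one theory covers [m] on [I], [m] on [J]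
    and [w dm] on [I]. *)
Lemma distribution_leb (R : realType) (D : set R) (f : R -> R) (s : R) : measurable D ->
  measurable_fun D f ->
  Defs.distribution (@leb R) D f s = Defs.distribution (weighted_measure (cst 1)) D f s.
Proof.
move=> mD mf; rewrite /Defs.distribution /weighted_measure.
have := integral_cst (@leb R) (@measurable_superlevel _ _ mD f s mf) 1%E.
by rewrite mul1e => <-.
Qed.

Lemma rearrangement_leb (R : realType) (D : set R) (f : R -> R) : measurable D ->
  measurable_fun D f ->
  rearrangement (@leb R) D f = rearrangement (weighted_measure (cst 1)) D f.
Proof. by move=> mD mf; apply: eq_rearrangement => s _; exact: distribution_leb. Qed.

(** * The weight and its primitive *)

Lemma nonincreasing_on_emeasurable (R : realType) (x : \bar R) (f : R -> \bar R) :
  (forall s t, oint x s -> oint x t -> s <= t -> (f t <= f s)%E) -> measurable_fun (oint x) f.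
Proof.
move=> fd mT; apply: (measurability _ (ErealGenOInfty.measurableE R)) => // _ [_ [y ->] <-].
apply: is_interval_measurable => s t /=.
rewrite !in_itv/= !andbT => -[[s0 sx] fs] [[t0 tx] ft] u /andP[su ut].
have xu : oint x u by split; [exact: lt_le_trans su|apply: le_lt_trans tx; rewrite lee_fin].
by split => //; rewrite in_itv/= andbT (lt_le_trans ft)// fd.
Qed.

(** The set where [k] exceeds [k t + e] lies in [(0, t)]. Equality may fail at the jumps of [k],
    since rearrangements are right continuous. *)
Lemma rearrangement_nonincreasing_le (R : realType) (x : \bar R) (k : R -> R) (t : R) :
  (forall s t, oint x s -> oint x t -> s <= t -> k t <= k s) ->
  (forall s, oint x s -> 0 <= k s) -> oint x t ->
  (rearrangement leb (oint x) k t <= (k t)%:E)%E.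
Proof.
move=> kd k0 xt.
have mk : measurable_fun (oint x) k.
  apply/measurable_EFinP; apply: nonincreasing_on_emeasurable => r s xr xs rs.
  by rewrite lee_fin kd.
apply/lee_addgt0Pr => e e0; apply: ereal_inf_lbound; exists (k t + e) => //; split => /=.
  by rewrite ltr_wpDl// k0.
case: (xt) => t0 _.
rewrite -(@lebesgue_measure_oint R t%:E) ?lee_fin ?(ltW t0)//.
apply: le_measure; rewrite ?inE//; first exact: measurable_superlevel.
move=> s [xs /=]; rewrite ger0_norm ?k0// => ks; split; first by case: xs.
rewrite lte_fin ltNge; apply/negP => ts.
by have := lt_le_trans ks (kd _ _ xt xs ts); lra.
Qed.

Section weight.
Context {R : realType} {a : \bar R} {w : R -> R}.
Hypotheses (a0 : (0 < a)%E) (dw : decreasing_weight a w).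
Local Notation leb := (@leb R).
Local Notation I := (oint a).
Local Notation b := (total_mass a w).
Local Notation mu := (weighted_measure w).

Lemma weight_ge0 t : I t -> 0 <= w t.
Proof. by move=> /(weight_gt0 dw)/ltW. Qed.

Lemma measurable_weight : measurable_fun I w.
Proof.
apply/measurable_EFinP; apply: nonincreasing_on_emeasurable => s t Is It st.
by rewrite lee_fin (weight_noninc dw).
Qed.

Lemma primitiveE t : primitive w t = mu (oint t%:E).
Proof. by rewrite /primitive /weighted_measure oint_EFin. Qed.

Lemma sub_I t : I t -> oint t%:E `<=` I.
Proof. by move=> [_ /ltW]; exact: sub_oint. Qed.

Lemma primitive_fin t : I t -> primitive w t \is a fin_num.
Proof.
move=> It; rewrite ge0_fin_numE; first exact: (weight_locint dw).
rewrite primitiveE; apply: (weighted_measure_ge0 weight_ge0); exact: sub_I.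
Qed.

Lemma weighted_measure_oint_gt0 x : (0 < x)%E -> (x <= a)%E -> (0 < mu (oint x))%E.
Proof.
move=> x0 xa; have xI : oint x `<=` I by exact: sub_oint.
rewrite lt_neqAle (weighted_measure_ge0 weight_ge0)// andbT eq_sym; apply/eqP => H.
have mwx : measurable_fun (oint x) (EFin \o w).
  by apply: measurable_funS (xI) _ => //; apply/measurable_EFinP; exact: measurable_weight.
have : (\int[leb]_(t in oint x) `|(w t)%:E| = 0)%E.
  by rewrite -[RHS]H; apply: eq_integral => t /set_mem/xI/weight_ge0 ?; rewrite gee0_abs// lee_fin.
move=> H0; have [N [mN N0 hN]] := (ae_eq_integral_abs leb (@measurable_oint R x) mwx).1 H0.
have : (leb (oint x) <= leb N)%E.
  apply: le_measure; rewrite ?inE// => t xt; apply: hN => /= /(_ xt) [w0].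
  by have := weight_gt0 dw (xI _ xt); rewrite w0 ltxx.
by rewrite N0 lebesgue_measure_oint ?(ltW x0)// leNgt x0.
Qed.

Lemma primitive_gt0 t : I t -> (0 < primitive w t)%E.
Proof. by move=> [t0 ta]; rewrite primitiveE weighted_measure_oint_gt0// ltW. Qed.

(** The mass up to [s] is finite and a bounded piece [[s, r[] has positive mass. The intermediate
    [r] is there because [x] may be infinite. *)
Lemma weighted_measure_oint_lt (s : R) x : 0 <= s -> (s%:E < x)%E -> (x <= a)%E ->
  (mu (oint s%:E) < mu (oint x))%E.
Proof.
move=> s0 sx xa; have xI : oint x `<=` I by exact: sub_oint.
have Is : 0 < s -> I s by move=> ?; split => //; exact: lt_le_trans xa.
have [sp|] := ltP 0 s; last first.
  move=> s0'; have -> : s = 0 by apply/eqP; rewrite eq_le s0 s0'.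
  rewrite oint_EFin set_itvoo0 {1}/weighted_measure integral_set0.
  by apply: weighted_measure_oint_gt0 => //; exact: le_lt_trans sx; rewrite lee_fin.
have fs : mu (oint s%:E) \is a fin_num by rewrite -primitiveE primitive_fin//; exact: Is.
have [r sr rx] : exists2 r, s < r & (r%:E <= x)%E.
  case: (x) sx => [y||]//; first by rewrite lte_fin => sy; exists y.
  by move=> _; exists (s + 1); rewrite ?leey// ltrDl.
have sI : oint s%:E `<=` I by exact: sub_I (Is sp).
have rI t : `[s, r[%classic t -> I t.
  rewrite /= in_itv/= => /andP[st tr]; split; first exact: lt_le_trans st.
  by apply: lt_le_trans xa; apply: lt_le_trans rx; rewrite lte_fin.
have wr : measurable_fun `[s, r[ (EFin \o w).
  by apply: measurable_funS rI _ => //; apply/measurable_EFinP; exact: measurable_weight.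
have E : (mu (oint s%:E) + mu `[s, r[ <= mu (oint x))%E.
  rewrite /weighted_measure -ge0_integral_setU//.
  - apply: ge0_subset_integral => //; first exact: measurableU.
    + by apply: measurable_funS (xI) _ => //; apply/measurable_EFinP; exact: measurable_weight.
    + by move=> t /xI/weight_ge0; rewrite lee_fin.
    + move=> t [[t0 ts]|]; first by split => //; exact: lt_trans sx.
      rewrite /= in_itv/= => /andP[st tr]; split; first exact: lt_le_trans st.
      by apply: lt_le_trans rx; rewrite lte_fin.
  - apply/measurable_funU => //; split => //.
    by apply: measurable_funS (sI) _ => //; apply/measurable_EFinP; exact: measurable_weight.
  - by move=> t [/sI|/rI] /weight_ge0; rewrite lee_fin.
  - apply/disj_setPS => t [[_ ts]]; rewrite /= in_itv/= => /andP[st _].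
    by move: ts; rewrite lte_fin ltNge st.
apply: lt_le_trans E; rewrite lteDl//.
rewrite lt_neqAle eq_sym; apply/andP; split; last first.
  by apply: integral_ge0 => t /rI/weight_ge0; rewrite lee_fin.
apply/eqP => H.
have : (\int[leb]_(t in `[s, r[) `|(w t)%:E| = 0)%E.
  by rewrite -[RHS]H; apply: eq_integral => t /set_mem/rI/weight_ge0 ?; rewrite gee0_abs// lee_fin.
move=> H0; have [N [mN N0 hN]] := (ae_eq_integral_abs leb (measurable_itv _) wr).1 H0.
have : (leb `[s, r[%classic <= leb N)%E.
  apply: le_measure; rewrite ?inE// => t xt; apply: hN => /= /(_ xt) [w0].
  by have := weight_gt0 dw (rI _ xt); rewrite w0 ltxx.
rewrite N0 lebesgue_measure_itv/= lte_fin sr -EFinB lee_fin; lra.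
Qed.

Lemma primitive_lt s t : 0 <= s -> I t -> s < t -> (primitive w s < primitive w t)%E.
Proof.
by move=> s0 [_ /ltW ta] st; rewrite !primitiveE weighted_measure_oint_lt// lte_fin.
Qed.

Lemma primitive_le_total t : I t -> (primitive w t < b)%E.
Proof.
by move=> [t0 ta]; rewrite primitiveE; apply: weighted_measure_oint_lt => //; exact: ltW.
Qed.

Lemma total_gt0 : (0 < b)%E.
Proof. exact: weighted_measure_oint_gt0. Qed.

(** Intermediate values: the primitive of [w] is continuous, vanishes at 0, and exceeds [c]
    somewhere in [I] because its supremum is [b]. *)
Lemma primitive_surj c : oint b c -> exists2 t, I t & primitive w t = c%:E.
Proof.
move=> [c0 cb].
have [t1 It1 ct1] : exists2 t1, I t1 & (c%:E < primitive w t1)%E.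
  apply: contrapT => H; move: cb; rewrite ltNge => /negP; apply.
  apply: integral_oint_le => //.
  - by apply/measurable_EFinP; exact: measurable_weight.
  - by move=> t /weight_ge0; rewrite lee_fin.
  - move=> t It; rewrite -/(weighted_measure _ _) -primitiveE leNgt; apply/negP => h.
    by apply: H; exists t.
  - by rewrite lee_fin ltW.
have t10 : 0 < t1 by case: It1.
(* The weight is controlled on [I] only; cut off at [t1] it becomes a total nonnegative function,
   integrable on [[0, t1]]. *)
pose f := (w \_ (oint t1%:E)).
have mf : measurable_fun setT f.
  apply: (measurable_restrictT _ (measurable_oint _)).1.
  by apply: measurable_funS (sub_I It1) measurable_weight.
have f0 t : 0 <= f t.
  by rewrite /f /patch; case: ifPn => // /set_mem /(sub_I It1) /weight_ge0.
have fE x : x <= t1 -> (\int[leb]_(t in `[0%R, x]) (f t)%:E)%E = primitive w x.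
  move=> xt1; rewrite primitiveE /weighted_measure.
  rewrite -integral_itv_obnd_cbnd; last by apply: measurable_funTS; exact/measurable_EFinP.
  rewrite -integral_itv_bndo_bndc; last by apply: measurable_funTS; exact/measurable_EFinP.
  rewrite oint_EFin; apply: eq_integral => t /set_mem; rewrite /= in_itv/= => /andP[t0 tx].
  by rewrite /f /patch mem_set//; split => //; rewrite lte_fin (lt_le_trans tx).
have intf : leb.-integrable `[0, t1] (EFin \o f).
  apply/integrableP; split; first by apply: measurable_funTS; exact/measurable_EFinP.
  under eq_integral do rewrite /= ger0_norm//.
  by rewrite fE//; have := primitive_fin It1; rewrite fin_numE => /andP[_]; rewrite -ltey.
have cf := parameterized_integral_continuous (ltW t10) intf.
have fE' x : x <= t1 -> parameterized_integral leb 0 x f = fine (primitive w x).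
  by move=> xt1; rewrite /parameterized_integral /Rintegral fE.
have [|x] := @IVT R _ 0 t1 c (ltW t10) cf.
  rewrite !fE'//; last exact: ltW.
  rewrite {1 3}/primitive set_itvoo0 integral_set0 /=.
  have ct : c <= fine (primitive w t1) by rewrite -lee_fin fineK ?primitive_fin// ltW.
  by rewrite ge_min le_max (ltW c0) ct orbT.
rewrite in_itv/= => /andP[x0 xt1]; rewrite fE'// => xc.
have xp : 0 < x.
  rewrite lt_neqAle x0 andbT; apply/eqP => x00; move: xc; rewrite -x00.
  by rewrite /primitive set_itvoo0 integral_set0/= => /eqP; rewrite lt_eqF.
have Ix : I x by split => //; case: It1 => _; apply: le_lt_trans; rewrite lee_fin.
by exists x => //; rewrite -xc fineK// primitive_fin.
Qed.

(** The set where the primitive is below [c] is an initial interval ending where the primitive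
    equals [c], unless [c] is out of reach. This is the change of variables behind the duality: the
    primitive pushes [w dm] forward to Lebesgue measure on [J]. *)
Lemma weighted_measure_sublevel x (c : \bar R) : (x <= a)%E -> (0 <= c)%E ->
  mu (oint x `&` [set t | (primitive w t < c)%E]) = Order.min (mu (oint x)) c.
Proof.
move=> xa c0; have xI : oint x `<=` I by exact: sub_oint.
have [xc|cx] := leP (mu (oint x)) c.
  congr (weighted_measure _ _); apply/seteqP; split => t; first by case.
  move=> xt; split => //=; apply: lt_le_trans xc.
  by case: xt => t0 tx; rewrite primitiveE weighted_measure_oint_lt// ltW.
move: c0; rewrite le_eqVlt => /predU1P[<-|c0].
  rewrite (_ : _ `&` _ = set0) ?/weighted_measure ?integral_set0//.
  apply/seteqP; split => // t [/xI It /=]; rewrite ltNge => /negP; apply.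
  by rewrite ltW// primitive_gt0.
have mub : (mu (oint x) <= b)%E.
  by apply: (le_weighted_measure _ measurable_weight weight_ge0).
case: c c0 cx => [c|_|//]; last by rewrite ltNge leey.
rewrite lte_fin => c0 cx.
have [t0 It0 t0c] : exists2 t, I t & primitive w t = c%:E.
  by apply: primitive_surj; split => //; exact: lt_le_trans mub.
have t0x : (t0%:E < x)%E.
  rewrite ltNge; apply/negP => xt0; move: cx; rewrite -t0c primitiveE ltNge => /negP; apply.
  apply: (le_weighted_measure _ measurable_weight weight_ge0) => //; last exact: sub_I.
  exact: sub_oint.
rewrite -[RHS]t0c primitiveE; congr (weighted_measure _ _).
apply/seteqP; split => t.
  move=> [xt /= tc]; split; first by case: xt.
  rewrite lte_fin ltNge; apply/negP; rewrite le_eqVlt => /predU1P[t0t|t0t].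
    by move: tc; rewrite -t0t t0c ltxx.
  have t00 : 0 <= t0 by case: It0 => /ltW.
  have := primitive_lt t00 (xI _ xt) t0t; rewrite t0c => ct.
  by have := lt_trans tc ct; rewrite ltxx.
move=> [tp tt0]; split; first by split => //; exact: lt_trans t0x.
by rewrite /= -t0c primitive_lt// ltW.
Qed.

End weight.

(** * Fully symmetric spaces *)

Lemma ae_on_exists (R : realType) (D A : set R) (P : R -> Prop) : measurable A ->
  (0 < leb A)%E -> A `<=` D -> ae_on D P -> exists2 t, A t & P t.
Proof.
move=> mA A0 AD [N [mN N0 hN]]; apply: contrapT => H.
have : (leb A <= leb N)%E.
  apply: le_measure; rewrite ?inE// => t At; apply: hN => /= /(_ (AD _ At)) Pt.
  by apply: H; exists t.
by rewrite N0 leNgt A0.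
Qed.

Lemma weighted_measure1 (R : realType) (x : \bar R) : (0 <= x)%E ->
  weighted_measure (cst 1 : R -> R) (oint x) = x.
Proof. by move=> x0; rewrite /weighted_measure /cst integral_oint_cst// mul1e. Qed.

Lemma precE (R : realType) (x : \bar R) (f g : R -> R) :
  prec (oint x) f g <-> forall t, oint x t ->
  (\int[leb]_(s in oint t%:E) rearrangement leb (oint x) f s <=
   \int[leb]_(s in oint t%:E) rearrangement leb (oint x) g s)%E.
Proof. by rewrite /prec; split => H t /H; rewrite oint_EFin. Qed.

Section interval.
Context {R : realType} {x : \bar R}.
Hypothesis x0 : (0 < x)%E.
Local Notation leb := (@leb R).
Local Notation star := (rearrangement leb (oint x)).
Implicit Types (f g : R -> R).

Let m1 : measurable_fun (oint x) (cst 1 : R -> R).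
Proof. exact: measurable_cst. Qed.
Let p1 t : oint x t -> 0 <= (cst 1 : R -> R) t := fun=> ler01.

(** The integral of [f^*] is concave in its endpoint and vanishes at 0. In layers this is
    [(t / s) * min s y <= min t y] for [t <= s]. *)
Lemma integral_rearrangement_concave f (s t : R) : measurable_fun (oint x) f ->
  0 < t -> t <= s ->
  ((t / s)%:E * \int[leb]_(r in oint s%:E) star f r <= \int[leb]_(r in oint t%:E) star f r)%E.
Proof.
move=> mf t0 ts; have s0 : 0 < s by exact: lt_le_trans ts.
rewrite !rearrangement_leb// !(integral_rearrangement _ m1 p1)// ?lee_fin ?(ltW s0) ?(ltW t0)//.
have mm (y : \bar R) A : measurable_fun A (fun r => Order.min y
    (Defs.distribution (weighted_measure (cst 1)) (oint x) f r)).
  by apply: measurable_mine; [exact: measurable_cst|exact: measurable_distribution].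
have m0 (y r : R) : 0 < y -> (0 <= Order.min y%:E
    (Defs.distribution (weighted_measure (cst 1%R)) (oint x) f r))%E.
  by move=> y0; rewrite le_min lee_fin ltW//= (distribution_ge0 p1).
rewrite -ge0_integralZl//; [|exact: mm| |].
- apply: ge0_le_integral => //.
  + by move=> r _; rewrite mule_ge0 ?m0// lee_fin divr_ge0// ltW.
  + by apply: emeasurable_funM; [exact: measurable_cst|exact: mm].
  + exact: mm.
  + move=> r _; have : (0 <= Defs.distribution (weighted_measure (cst 1%R)) (oint x) f r)%E.
      exact: (distribution_ge0 p1).
    set y := Defs.distribution _ _ _ _ => y0.
    have ts1 : t / s <= 1 by rewrite ler_pdivrMr// mul1r.
    have ts0 : 0 <= t / s by rewrite divr_ge0// ltW.
    rewrite le_min; apply/andP; split.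
      apply: (@le_trans _ _ ((t / s)%:E * s%:E)%E).
        by apply: lee_wpmul2l; rewrite ?lee_fin// ge_min lexx.
      by rewrite -EFinM divfK// gt_eqF.
    apply: (@le_trans _ _ ((t / s)%:E * y)%E).
      by apply: lee_wpmul2l; rewrite ?lee_fin// ge_min lexx orbT.
    by rewrite gee_pMl.
- by move=> r _; exact: m0.
- by rewrite lee_fin divr_ge0// ltW.
Qed.

Lemma le_integral_oint (f : R -> \bar R) (s t : \bar R) : (s <= t)%E ->
  measurable_fun (oint t) f -> (forall r, oint t r -> 0 <= f r)%E ->
  (\int[leb]_(r in oint s) f r <= \int[leb]_(r in oint t) f r)%E.
Proof. by move=> st mf f0; apply: ge0_subset_integral => //; exact: sub_oint. Qed.

Lemma integral_abs_oint_le f (t : R) : measurable_fun (oint x) f -> 0 < t -> (t%:E <= x)%E ->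
  (\int[leb]_(r in oint t%:E) `|f r|%:E <= \int[leb]_(r in oint t%:E) star f r)%E.
Proof.
move=> mf t0 tx; rewrite rearrangement_leb//.
have := @integral_le_rearrangement _ _ _ (@measurable_oint R x) m1 p1 f (oint t%:E).
rewrite weighted_measure1 ?lee_fin ?(ltW t0)//.
under eq_integral do rewrite /cst mul1r.
by apply => //; exact: sub_oint.
Qed.

Lemma rearrangement_leb_idem f : measurable_fun (oint x) f ->
  (forall t, oint x t -> star f t \is a fin_num) ->
  star (fine \o star f) = star f.
Proof.
move=> mf; rewrite (rearrangement_leb (@measurable_oint R x) mf) => ffin.
have := @rearrangement_idem _ _ _ (@measurable_oint R x) m1 p1 f mf.
by rewrite weighted_measure1; [apply|exact: ltW].
Qed.

End interval.

Section symmetric_space.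
Context {R : realType} {b : \bar R} {E : gauged_class R}.
Local Notation leb := (@leb R).
Local Notation J := (oint b).
Hypotheses (b0 : (0 < b)%E) (fE : fully_symmetric_space J E) (sE : has_support J E).
Implicit Types (f g h : R -> R).
Local Notation star := (rearrangement leb J).

Let m1 : measurable_fun J (cst 1 : R -> R).
Proof. exact: measurable_cst. Qed.
Let p1 t : J t -> 0 <= (cst 1 : R -> R) t := fun=> ler01.

Lemma E_L0 h : gset E h -> measurable_fun J h.
Proof. by case: fE => -[sub _ _ _ _ _ _] _ _ /sub. Qed.

Lemma E_gauge_ge0 h : gset E h -> 0 <= gauge E h.
Proof. by case: fE => -[_ _ _ _ [h0 _ _ _] _ _] _ _ /h0. Qed.

Lemma E_le g h : gset E h -> measurable_fun J g -> ae_on J (fun t => `|g t| <= `|h t|) ->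
  gset E g /\ gauge E g <= gauge E h.
Proof.
case: fE => -[_ _ so _ _ mono _] _ _ Eh mg gh.
have Eg : gset E g by exact: so gh.
by split => //; exact: mono.
Qed.

Lemma E_prec g h : gset E h -> measurable_fun J g ->
  (forall t, J t -> \int[leb]_(s in oint t%:E) star g s <=
                    \int[leb]_(s in oint t%:E) star h s)%E ->
  gset E g /\ gauge E g <= gauge E h.
Proof. by move=> Eh mg gh; apply: (fs_prec fE mg Eh); apply/precE. Qed.

Lemma E_scale (c : R) h : gset E h -> gset E (fun t => c * h t) /\
  gauge E (fun t => c * h t) = `|c| * gauge E h.
Proof.
by case: fE => -[_ [_ _ linZ] _ _ [_ _ nZ _] _ _] _ _ Eh; split; [exact: linZ|exact: nZ].
Qed.

Lemma E_add g h : gset E g -> gset E h -> gset E (fun t => g t + h t) /\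
  gauge E (fun t => g t + h t) <= gauge E g + gauge E h.
Proof.
by case: fE => -[_ [_ linD _] _ _ [_ _ _ nD] _ _] _ _ Eg Eh; split; [exact: linD|exact: nD].
Qed.

Lemma E_indic (s : R) : 0 < s -> (s%:E <= b)%E ->
  gset E (\1_(oint s%:E)) /\ 0 < gauge E (\1_(oint s%:E)).
Proof.
move=> s0 sb; have sJ : oint s%:E `<=` J by exact: sub_oint.
have Es : gset E (\1_(oint s%:E)).
  by apply: sE => //; rewrite lebesgue_measure_oint ?ltry// lee_fin ltW.
split=> //; rewrite lt_neqAle E_gauge_ge0// andbT eq_sym; apply/eqP => H.
case: fE => -[_ _ _ _ [_ n0 _ _] _ _] _ _.
have [|t ts] := ae_on_exists (@measurable_oint R s%:E) _ sJ (n0 _ Es H).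
  by rewrite lebesgue_measure_oint ?lte_fin// lee_fin ltW//.
by rewrite indicE mem_set//= => /eqP; rewrite oner_eq0.
Qed.

(** For real [r] below the integral of [h^*] up to [s], the constant [r / s] on [(0, s)] is
    dominated by [h]: before [s] by concavity of that integral, after [s] by monotonicity. Hence
    [r / s] times the norm of the indicator is at most the norm of [h]. Testing with such [r] also
    proves the integral finite. *)
Lemma E_integral_le h (s : R) : gset E h -> 0 < s -> (s%:E <= b)%E ->
  (\int[leb]_(t in oint s%:E) star h t <=
   (s / gauge E (\1_(oint s%:E)) * gauge E h)%:E)%E.
Proof.
move=> Eh s0 sb; have [Es gs] := E_indic s0 sb.
have mh := E_L0 Eh.
have g0 := E_gauge_ge0 Eh.
apply: lee_lt_real => [|r r0 rh]; first by rewrite lee_fin mulr_ge0// divr_ge0 ?ltW.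
pose f t := r / s * \1_(oint s%:E) t.
have mf : measurable_fun J f.
  by apply: measurable_funM => //; exact: measurable_indic.
have rs0 : 0 <= r / s by rewrite divr_ge0// ltW.
have f0 t : 0 <= f t by rewrite mulr_ge0.
have fd u v : J u -> J v -> u <= v -> f v <= f u.
  move=> Ju Jv uv; rewrite ler_wpM2l// !indicE.
  case: (boolP (v \in _)) => [/set_mem [_ vs]|_]; last by case: (_ \in _).
  by rewrite mem_set//; split; [case: Ju|apply: le_lt_trans vs; rewrite lee_fin].
have [Ef fh] : gset E f /\ gauge E f <= gauge E h.
  apply: (E_prec Eh mf) => t Jt; have t0 : 0 < t by case: Jt.
  have ftJ : oint t%:E `<=` J by apply: sub_oint; case: Jt => _ /ltW.
  apply: (@le_trans _ _ (\int[leb]_(u in oint t%:E) (f u)%:E)%E).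
    apply: ge0_le_integral => //.
    - by move=> u _; apply: rearrangement_ge0.
    - exact: measurable_rearrangement.
    - by apply/measurable_EFinP; apply: measurable_funS mf.
    - by move=> u /ftJ Ju; exact: rearrangement_nonincreasing_le.
  apply: (@le_trans _ _ (r / s * Num.min s t)%:E).
    under eq_integral do rewrite EFinM.
    rewrite ge0_integralZl//; first last.
      by apply/measurable_EFinP; exact: measurable_indic.
    have Lst : leb (oint (Order.min s%:E t%:E)) = (Num.min s t)%:E.
      by rewrite lebesgue_measure_oint ?EFin_min// le_min !lee_fin !ltW.
    rewrite (@integral_indic _ _ R leb _ (measurable_oint _))// ointI.
    have -> : (r / s * Num.min s t)%:E = ((r / s)%:E * leb (oint (Order.min s%:E t%:E)))%E.
      by rewrite Lst -EFinM.
    exact: lexx.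
  have [st|ts] := leP s t.
    rewrite divfK ?gt_eqF//; apply: (le_trans (ltW rh)).
    apply: le_integral_oint; rewrite ?lee_fin//; first exact: measurable_rearrangement.
    by move=> u _; exact: rearrangement_ge0.
  apply: le_trans (integral_rearrangement_concave mh t0 (ltW ts)).
  rewrite -mulrAC -mulrA mulrC EFinM; apply: lee_wpmul2l; last exact: ltW.
  by rewrite lee_fin divr_ge0// ltW.
rewrite lee_fin; move: fh; rewrite (E_scale _ Es).2 ger0_norm// => fh.
rewrite -(ler_pM2r (divr_gt0 gs s0)).
have -> : s / gauge E \1_(oint s%:E) * gauge E h * (gauge E \1_(oint s%:E) / s) = gauge E h.
  by rewrite mulrAC mulrA divfK ?gt_eqF// divff ?gt_eqF// mul1r.
by rewrite mulrA mulrAC.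
Qed.

Lemma E_integral_lty h (s : R) : gset E h -> J s ->
  (\int[leb]_(t in oint s%:E) star h t < +oo)%E.
Proof.
move=> Eh [s0 /ltW sb]; apply: le_lt_trans (ltry _); exact: E_integral_le.
Qed.

Lemma E_integral_abs_lty h (s : R) : gset E h -> J s ->
  (\int[leb]_(t in oint s%:E) `|h t|%:E < +oo)%E.
Proof.
move=> Eh Js; apply: le_lt_trans (E_integral_lty Eh Js).
by case: Js => s0 /ltW sb; apply: integral_abs_oint_le => //; exact: E_L0.
Qed.

Lemma E_star h : gset E h ->
  [/\ forall t, J t -> star h t \is a fin_num, gset E (fine \o star h) &
      gauge E (fine \o star h) <= gauge E h].
Proof.
move=> Eh; have mh := E_L0 Eh.
have hf t : J t -> star h t \is a fin_num.
  move=> Jt; have := E_integral_lty Eh Jt; rewrite rearrangement_leb// => hy.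
  by apply: rearrangement_fin => //; case: Jt.
have mfs : measurable_fun J (fine \o star h).
  by apply: measurable_fine_comp; exact: measurable_rearrangement.
suff H t : J t -> (\int[leb]_(s in oint t%:E) star (fine \o star h) s <=
    \int[leb]_(s in oint t%:E) star h s)%E by have [? ?] := E_prec Eh mfs H.
by move=> Jt; rewrite (rearrangement_leb_idem b0 mh hf).
Qed.

End symmetric_space.

(** * Membership in Q_{E,w} *)

Lemma measurable_weightV (R : realType) (a : \bar R) (w : R -> R) : decreasing_weight a w ->
  measurable_fun (oint a) (fun t => (w t)^-1).
Proof.
move=> dw; have -> : (fun t => (w t)^-1) = (fun t => - - (w t)^-1).
  by apply/funext => t; rewrite opprK.
apply: measurable_funN; apply/measurable_EFinP; apply: nonincreasing_on_emeasurable.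
move=> s t Is It st; rewrite lee_fin lerN2 lef_pV2 ?posrE ?(weight_gt0 dw)//.
exact: (weight_noninc dw).
Qed.

Section weighted_space.
Context {R : realType} {a : \bar R} {w : R -> R} {E : gauged_class R}.
Local Notation leb := (@leb R).
Local Notation I := (oint a).
Local Notation b := (total_mass a w).
Local Notation J := (oint b).
Local Notation mu := (weighted_measure w).
Local Notation wstar := (rearrangement mu I).
Local Notation star := (rearrangement leb I).
Hypotheses (a0 : (0 < a)%E) (dw : decreasing_weight a w)
  (fE : fully_symmetric_space J E) (sE : has_support J E).
Implicit Types (f g h u : R -> R).

Let mw : measurable_fun I w := measurable_weight dw.
Let w0 : forall t, I t -> 0 <= w t := weight_ge0 dw.
Let b0 : (0 < b)%E := total_gt0 a0 dw.

(** The control is by integrals of [|h|], which are additive for nonnegative [h]; the passage to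
    [h^*] is made only here, where the full symmetry of [E] is applied. *)
Lemma wstar_E u h : measurable_fun I u -> gset E h ->
  (forall s, J s -> \int[leb]_(t in oint s%:E) wstar u t <=
                    \int[leb]_(t in oint s%:E) `|h t|%:E)%E ->
  [/\ forall s, J s -> wstar u s \is a fin_num, gset E (fine \o wstar u) &
      gauge E (fine \o wstar u) <= gauge E h].
Proof.
move=> mu_ Eh uh.
have ufin s : J s -> wstar u s \is a fin_num.
  move=> Js; apply: rearrangement_fin; first by case: Js.
  have hy := E_integral_abs_lty fE sE Eh Js; have uhs := uh _ Js.
  exact: (le_lt_trans uhs hy).
have mfu : measurable_fun J (fine \o wstar u).
  by apply: measurable_fine_comp; exact: measurable_rearrangement.
suff H t : J t -> (\int[leb]_(s in oint t%:E) rearrangement leb J (fine \o wstar u) s <=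
    \int[leb]_(s in oint t%:E) rearrangement leb J h s)%E by have [? ?] := E_prec fE Eh mfu H.
move=> Jt.
have -> : rearrangement leb J (fine \o wstar u) = wstar u.
  exact: (rearrangement_idem (@measurable_oint R a) mw w0 mu_ ufin).
apply: le_trans (uh _ Jt) _; case: Jt => t0 /ltW tb.
by apply: integral_abs_oint_le => //; exact: (E_L0 fE).
Qed.

(** It suffices that [u] majorizes [g^* / w]: for a decreasing [k = u * w] the rearrangement may lie
    below [k] at jumps. *)
Lemma M_intro g u h : measurable_fun I g -> measurable_fun I u ->
  (forall t, I t -> 0 <= u t) -> (forall t, I t -> (star g t <= (u t * w t)%:E)%E) ->
  gset E h ->
  (forall s, J s -> \int[leb]_(t in oint s%:E) wstar u t <=
                    \int[leb]_(t in oint s%:E) `|h t|%:E)%E ->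
  gset (M_class a w E) g /\ gauge (M_class a w E) g <= gauge E h.
Proof.
move=> mg mu_ u0 gu Eh uh.
pose q t := (star g t * ((w t)^-1)%:E)%E.
have wpos t : I t -> 0 < w t by exact: (weight_gt0 dw).
have q0 t : I t -> (0 <= q t)%E.
  by move=> It; rewrite mule_ge0 ?rearrangement_ge0// lee_fin invr_ge0 w0.
have qu t : I t -> (q t <= (u t)%:E)%E.
  move=> It; rewrite /q -(@lee_pmul2r _ (w t)%:E)//; last by rewrite lte_fin wpos.
  by rewrite -muleA -EFinM mulVf ?mule1 ?gt_eqF ?wpos// gu.
have qfin t : I t -> q t \is a fin_num.
  by move=> It; rewrite ge0_fin_numE ?q0// (le_lt_trans (qu _ It))// ltry.
have mq : measurable_fun I (fine \o q).
  apply: measurable_fine_comp; apply: emeasurable_funM.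
    exact: measurable_rearrangement.
  by apply/measurable_EFinP; exact: measurable_weightV.
have [|Ufin EU gU] := wstar_E mq Eh.
  move=> s Js; apply: le_trans (uh _ Js); apply: ge0_le_integral => //.
  - by move=> t _; exact: rearrangement_ge0.
  - exact: measurable_rearrangement.
  - exact: measurable_rearrangement.
  - move=> t _; apply: le_rearrangement => //; apply: aeW => r Ir /=.
    rewrite ger0_norm ?fine_ge0 ?q0// ger0_norm ?u0//.
    by rewrite -lee_fin fineK ?qfin ?qu.
have iM : gset (M_class a w E) g.
  split=> //; split; first by apply: aeW.
  split=> //; split; last exact: EU.
  by apply: aeW.
by split.
Qed.

(** The a.e. conditions in the definition of the class hold everywhere: an a.e. property holds at
    some point before any given [t], and a rearrangement finite at one point is finite at all later
    ones. *)
Lemma M_elim g : gset (M_class a w E) g -> exists u h,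
  [/\ measurable_fun I g, measurable_fun I u, forall t, I t -> 0 <= u t,
      forall t, I t -> star g t = (u t * w t)%:E &
  [/\ gset E h, forall s, J s -> 0 <= h s, gauge E h = gauge (M_class a w E) g &
      forall s, J s -> wstar u s = (h s)%:E]].
Proof.
move=> [mg [qae [mq [Uae EU]]]].
have wpos t : I t -> 0 < w t by exact: (weight_gt0 dw).
have wV t : I t -> ((w t)^-1)%:E \is a fin_num by [].
have ofin (x : \bar R) (P : R -> Prop) t : oint x t -> ae_on (oint x) P ->
    exists2 s, P s & oint x s /\ s <= t.
  move=> xt aeP; have [||s [s0 st] Ps] := ae_on_exists (@measurable_oint R t%:E) _ _ aeP.
  - by case: xt => t0 _; rewrite lebesgue_measure_oint ?lte_fin// lee_fin ltW.
  - by apply: sub_oint; case: xt => _ /ltW.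
  - exists s => //; split; last exact: ltW.
    by split => //; apply: lt_trans (xt.2); rewrite lte_fin.
have gfin t : I t -> star g t \is a fin_num.
  move=> It; have [s qs [Is st]] := ofin _ _ _ It qae.
  rewrite ge0_fin_numE ?rearrangement_ge0//.
  apply: le_lt_trans (rearrangement_noninc g st) _.
  move: qs; case Es : (star g s) => [r| |]//; rewrite ?ltry// => /=.
  by rewrite gt0_mulye// lte_fin invr_gt0 wpos.
have Ufin t : J t -> wstar (fine \o (fun t => (star g t * ((w t)^-1)%:E)%E)) t \is a fin_num.
  move=> Jt; have [s Us [Js st]] := ofin _ _ _ Jt Uae.
  rewrite ge0_fin_numE ?rearrangement_ge0//.
  apply: le_lt_trans (rearrangement_noninc _ st) _.
  by rewrite -ge0_fin_numE ?rearrangement_ge0.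
exists (fine \o (fun t => (star g t * ((w t)^-1)%:E)%E)).
exists (fine \o wstar (fine \o (fun t => (star g t * ((w t)^-1)%:E)%E))); split => //.
- move=> t It; apply: fine_ge0; apply: mule_ge0; first exact: rearrangement_ge0.
  by rewrite lee_fin invr_ge0 w0.
- move=> t It; rewrite /= -(fineK (gfin _ It)) -EFinM/=.
  by rewrite divfK// gt_eqF// wpos.
split => //.
- by move=> s _; apply: fine_ge0; exact: rearrangement_ge0.
- by move=> s Js; rewrite /= fineK// Ufin.
Qed.

(* The elements of Q_{E,w} of norm at most [gauge E h], without a.e. quantifiers:
   [k = u * w] plays the role of the decreasing function [g^*], and [h] the one of
   [(g^*/w)^{*,w}]. *)
Definition Q_bound f u h : Prop :=
  [/\ measurable_fun I u, forall t, I t -> 0 <= u t,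
      forall s t, I s -> I t -> s <= t -> u t * w t <= u s * w s,
      forall t, I t -> (\int[leb]_(s in oint t%:E) star f s <=
                        \int[leb]_(s in oint t%:E) (u s * w s)%:E)%E &
      gset E h /\ forall s, J s -> (\int[leb]_(t in oint s%:E) wstar u t <=
                    \int[leb]_(t in oint s%:E) `|h t|%:E)%E].

Lemma sub_oint_mem (x : \bar R) t : oint x t -> oint t%:E `<=` oint x.
Proof. by move=> [_ /ltW]; exact: sub_oint. Qed.

Lemma M_gauge_ge0 g : gset (M_class a w E) g -> 0 <= gauge (M_class a w E) g.
Proof. by move=> [_ [_ [_ [_ EU]]]]; exact: (E_gauge_ge0 fE). Qed.

(** The witness is [k = u * w]. Being decreasing it lies above its rearrangement, which bounds its
    gauge, while its integrals over initial intervals are at most those of its rearrangement, which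
    gives [prec]. *)
Lemma Q_intro f u h : measurable_fun I f -> Q_bound f u h ->
  gset (Q_space a w E) f /\ gauge (Q_space a w E) f <= gauge E h.
Proof.
move=> mf [mu_ u0 kd fk [Eh uh]].
pose k t := u t * w t.
have k0 t : I t -> 0 <= k t by move=> It; rewrite mulr_ge0 ?u0 ?w0.
have mk : measurable_fun I k by exact: measurable_funM.
have [Mk gk] : gset (M_class a w E) k /\ gauge (M_class a w E) k <= gauge E h.
  apply: (M_intro mk mu_) => // t It; exact: rearrangement_nonincreasing_le.
have fpk : prec I f k.
  apply/precE => t It; apply: (le_trans (fk _ It)).
  have -> : (\int[leb]_(s in oint t%:E) (u s * w s)%:E =
             \int[leb]_(s in oint t%:E) `|k s|%:E)%E.
    by apply: eq_integral => s /set_mem/(sub_oint_mem It) Is; rewrite ger0_norm ?k0.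
  by case: It => t0 /ltW ta; apply: integral_abs_oint_le.
split; first by split => //; exists k.
apply: le_trans gk; apply: ge_inf; last by exists k.
by exists 0 => _ [g [Mg _] <-]; exact: M_gauge_ge0.
Qed.

Lemma Q_elim f (c : R) : gset (Q_space a w E) f -> gauge (Q_space a w E) f < c ->
  exists u h, [/\ Q_bound f u h, forall s, J s -> 0 <= h s & gauge E h < c].
Proof.
move=> [mf [g0 Mg0 fg0]] fc.
have [|_ [g [Mg fg] <-] gc] := inf_lt _ fc; first by exists (gauge (M_class a w E) g0), g0.
have [u [h [mg mu_ u0 gE [Eh h0 hE uE]]]] := M_elim Mg.
exists u, h; split => //; last by rewrite hE.
split => //.
- move=> s t Is It st; rewrite -lee_fin -!gE//; exact: rearrangement_noninc.
- move=> t It; move/precE: fg => /(_ _ It) fg; apply: (le_trans fg).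
  rewrite le_eqVlt; apply/orP; left; apply/eqP; apply: eq_integral => s /set_mem.
  by move=> /(sub_oint_mem It)/gE.
- split=> // s Js; rewrite le_eqVlt; apply/orP; left; apply/eqP.
  apply: eq_integral => t /set_mem /(sub_oint_mem Js) Jt.
  by rewrite uE// ger0_norm ?h0.
Qed.

Lemma Q_gauge_ge0 f : gset (Q_space a w E) f -> 0 <= gauge (Q_space a w E) f.
Proof.
move=> [mf [g0 Mg0 fg0]]; apply: lb_le_inf; first by exists (gauge (M_class a w E) g0), g0.
by move=> _ [g [Mg _] <-]; exact: M_gauge_ge0.
Qed.

(** The integral of [u * w] over [(0, x)] is one of [u] for [w dm] over a set of mass [W(x)], hence
    at most the integral of [u^{*,w}] up to [W(x)]. *)
Lemma Q_bound_integral f u h x : Q_bound f u h -> I x ->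
  (\int[leb]_(t in oint x%:E) star f t <= \int[leb]_(t in oint (primitive w x)) `|h t|%:E)%E.
Proof.
move=> [mu_ u0 kd fk [Eh uh]] Ix; apply: (le_trans (fk _ Ix)).
have xI := sub_oint_mem Ix.
have Jx : J (fine (primitive w x)).
  split; last by rewrite fineK ?(primitive_fin dw)// (primitive_le_total dw).
  by rewrite -lte_fin fineK ?(primitive_fin dw)// (primitive_gt0 dw).
have := integral_le_rearrangement (@measurable_oint R a) mw w0 (@measurable_oint R x%:E) xI mu_.
rewrite -primitiveE -(fineK (primitive_fin dw Ix)).
move=> H; apply: le_trans (uh _ Jx); apply: le_trans H.
rewrite le_eqVlt; apply/orP; left; apply/eqP.
by apply: eq_integral => s /set_mem/xI Is; rewrite mulrC ger0_norm ?u0.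
Qed.

End weighted_space.

Lemma ler_forall_gt (R : realType) (x y : R) : (forall z, y < z -> x <= z) -> x <= y.
Proof.
move=> H; rewrite leNgt; apply/negP => yx.
by have := H ((x + y) / 2); lra.
Qed.

Lemma ler_forall_gt2 (R : realType) (x y z : R) :
  (forall c d, x < c -> y < d -> z <= c + d) -> z <= x + y.
Proof.
move=> H; apply/ler_addgt0Pr => e e0.
by have := H (x + e / 2) (y + e / 2); lra.
Qed.

Lemma lee_forall_gt_mul (R : realType) (X : \bar R) (C y : R) : 0 <= C ->
  (forall z, y < z -> (X <= (C * z)%:E)%E) -> (X <= (C * y)%:E)%E.
Proof.
move=> C0 H; apply/lee_addgt0Pr => e e0.
(* Dividing by [C + 1] also covers [C = 0]. *)
have C1 : 0 < C + 1 by lra.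
apply: (@le_trans _ _ (C * (y + e / (C + 1)))%:E); first by apply: H; rewrite ltrDl divr_gt0.
rewrite -EFinD lee_fin mulrDr lerD2l mulrCA ler_piMr ?(ltW e0)//.
by rewrite ler_pdivrMr// mul1r lerDl.
Qed.

(** * Linear structure, gauge and domination in Q_{E,w} *)

Section weighted_space.
Context {R : realType} {a : \bar R} {w : R -> R} {E : gauged_class R}.
Local Notation leb := (@leb R).
Local Notation I := (oint a).
Local Notation b := (total_mass a w).
Local Notation J := (oint b).
Local Notation mu := (weighted_measure w).
Local Notation wstar := (rearrangement mu I).
Local Notation star := (rearrangement leb I).
Local Notation Q := (Q_space a w E).
Hypotheses (a0 : (0 < a)%E) (dw : decreasing_weight a w)
  (fE : fully_symmetric_space J E) (sE : has_support J E).
Implicit Types (f g h u : R -> R).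

Let mw : measurable_fun I w := measurable_weight dw.
Let w0 : forall t, I t -> 0 <= w t := weight_ge0 dw.
Let b0 : (0 < b)%E := total_gt0 a0 dw.
Let m1 : measurable_fun I (cst 1 : R -> R).
Proof. exact: measurable_cst. Qed.
Let p1 t : I t -> 0 <= (cst 1 : R -> R) t := fun=> ler01.

Lemma Q_L0 f : gset Q f -> measurable_fun I f. Proof. by case. Qed.

Lemma star_leb f : measurable_fun I f ->
  star f = rearrangement (weighted_measure (cst 1)) I f.
Proof. exact: rearrangement_leb. Qed.

Lemma starD f g t : measurable_fun I f -> measurable_fun I g -> 0 <= t ->
  (\int[leb]_(s in oint t%:E) star (fun s => (f s + g s)%R) s <=
   \int[leb]_(s in oint t%:E) star f s + \int[leb]_(s in oint t%:E) star g s)%E.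
Proof.
move=> mf mg t0; have mfg : measurable_fun I (fun s => f s + g s) by exact: measurable_funD.
rewrite (star_leb mf) (star_leb mg) (star_leb mfg).
exact: (integral_rearrangementD (@measurable_oint R a) m1 p1).
Qed.

Lemma starZ f c t : measurable_fun I f -> 0 <= t ->
  (star (fun s => (c * f s)%R) t <= `|c|%:E * star f t)%E.
Proof.
move=> mf t0; have mcf : measurable_fun I (fun s => c * f s) by exact: measurable_funM.
rewrite (star_leb mf) (star_leb mcf).
exact: (rearrangementZ (@measurable_oint R a) m1 p1).
Qed.

Lemma star_nneseries f (u : nat -> R -> R) t :
  measurable_fun I f -> (forall k, measurable_fun I (u k)) -> 0 <= t ->
  ae_on I (fun s => (`|f s|%:E <= \sum_(0 <= k <oo) `|u k s|%:E)%E) ->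
  (\int[leb]_(s in oint t%:E) star f s <=
   \sum_(0 <= k <oo) \int[leb]_(s in oint t%:E) star (u k) s)%E.
Proof.
move=> mf mu_ t0 fu; rewrite (star_leb mf).
apply: (le_trans (integral_rearrangement_nneseries (@measurable_oint R a) m1 p1 mf mu_ t0 fu)).
apply: lee_nneseries => [k _ _|k _]; last by rewrite (star_leb (mu_ k)).
by apply: integral_ge0 => s _; exact: rearrangement_ge0.
Qed.

Lemma le_star f g t : measurable_fun I f -> measurable_fun I g ->
  ae_on I (fun t => `|f t| <= `|g t|) -> (star f t <= star g t)%E.
Proof.
move=> mf mg fg; rewrite (star_leb mf) (star_leb mg).
exact: (le_rearrangement (@measurable_oint R a) m1 p1).
Qed.

Lemma E_zero : gset E (fun=> 0).
Proof. by case: fE => -[_ [E0 _ _] _ _ _ _ _] _ _. Qed.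

Lemma Q_boundZ c f u h : measurable_fun I f -> Q_bound (a := a) (w := w) (E := E) f u h ->
  Q_bound (a := a) (w := w) (E := E) (fun t => c * f t) (fun t => `|c| * u t) (fun t => c * h t).
Proof.
move=> mf [mu_ u0 kd fk [Eh uh]]; split.
- exact: measurable_funM.
- by move=> t It; rewrite mulr_ge0 ?u0.
- by move=> s t Is It st; rewrite -!mulrA ler_wpM2l// kd.
- move=> t It; have tI := sub_oint_mem It.
  under [leRHS]eq_integral do rewrite -mulrA EFinM.
  rewrite ge0_integralZl//; first last.
  + by move=> s /tI Is; rewrite lee_fin mulr_ge0 ?u0 ?w0.
  + by apply/measurable_EFinP; apply: measurable_funS tI _ => //; exact: measurable_funM.
  apply: (@le_trans _ _ (`|c|%:E * \int[leb]_(s in oint t%:E) star f s)%E); last first.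
    by apply: lee_wpmul2l; [rewrite lee_fin|exact: fk].
  rewrite -ge0_integralZl//; first last.
  + by move=> s _; exact: rearrangement_ge0.
  + exact: measurable_rearrangement.
  apply: ge0_le_integral => //.
  + by move=> s _; exact: rearrangement_ge0.
  + exact: measurable_rearrangement.
  + by apply: emeasurable_funM; [exact: measurable_cst|exact: measurable_rearrangement].
  + by move=> s [s0 _]; apply: starZ => //; exact: ltW.
- split; first exact: (E_scale fE c Eh).1.
  move=> s Js; have sJ := sub_oint_mem Js.
  under [leRHS]eq_integral do rewrite normrM EFinM.
  rewrite ge0_integralZl//; first last.
    apply/measurable_EFinP; apply: measurableT_comp => //.
    by apply: measurable_funS sJ _ => //; exact: (E_L0 fE).
  apply: (@le_trans _ _ (`|c|%:E * \int[leb]_(t in oint s%:E) wstar u t)%E); last first.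
    by apply: lee_wpmul2l; [rewrite lee_fin|exact: uh].
  rewrite -ge0_integralZl//; first last.
  + by move=> t _; exact: rearrangement_ge0.
  + exact: measurable_rearrangement.
  apply: ge0_le_integral => //.
  + by move=> t _; exact: rearrangement_ge0.
  + exact: measurable_rearrangement.
  + by apply: emeasurable_funM; [exact: measurable_cst|exact: measurable_rearrangement].
  + move=> t [t0 _]; have := @rearrangementZ _ _ _ (@measurable_oint R a) mw w0 u `|c| t mu_ (ltW t0).
    by rewrite normr_id.
Qed.

(** All conditions are additive: [(u + v) * w] is decreasing, both rearrangements are subadditive
    under the integral, and [|h + k| = |h| + |k|] by nonnegativity. *)
Lemma Q_boundD f g u v h k : measurable_fun I f -> measurable_fun I g ->
  Q_bound (a := a) (w := w) (E := E) f u h -> Q_bound (a := a) (w := w) (E := E) g v k ->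
  (forall s, J s -> 0 <= h s) -> (forall s, J s -> 0 <= k s) ->
  Q_bound (a := a) (w := w) (E := E) (fun t => f t + g t) (fun t => u t + v t) (fun t => h t + k t).
Proof.
move=> mf mg [mu_ u0 ud fu [Eh uh]] [mv v0 vd gv [Ek vk]] h0 k0; split.
- exact: measurable_funD.
- by move=> t It; rewrite addr_ge0 ?u0 ?v0.
- by move=> s t Is It st; rewrite !mulrDl lerD ?ud ?vd.
- move=> t It; have tI := sub_oint_mem It; have t0 : 0 < t by case: It.
  apply: (le_trans (starD mf mg (ltW t0))).
  under [leRHS]eq_integral do rewrite mulrDl EFinD.
  rewrite ge0_integralD//; [by apply: leeD; [exact: fu|exact: gv]| | | |].
  + by move=> s /tI Is; rewrite lee_fin mulr_ge0 ?u0 ?w0.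
  + by apply/measurable_EFinP; apply: measurable_funS tI _ => //; exact: measurable_funM.
  + by move=> s /tI Is; rewrite lee_fin mulr_ge0 ?v0 ?w0.
  + by apply/measurable_EFinP; apply: measurable_funS tI _ => //; exact: measurable_funM.
- split; first exact: (E_add fE Eh Ek).1.
  move=> s Js; have sJ := sub_oint_mem Js; have s0 : 0 < s by case: Js.
  apply: (le_trans (integral_rearrangementD (@measurable_oint R a) mw w0 mu_ mv (ltW s0))).
  have -> : (\int[leb]_(t in oint s%:E) `|h t + k t|%:E =
     \int[leb]_(t in oint s%:E) (`|h t|%:E + `|k t|%:E))%E.
    apply: eq_integral => t /set_mem/sJ Jt.
    by rewrite -EFinD !ger0_norm ?addr_ge0 ?h0 ?k0.
  rewrite ge0_integralD//; [by apply: leeD; [exact: uh|exact: vk]| |].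
  + apply/measurable_EFinP; apply: measurableT_comp => //.
    by apply: measurable_funS sJ _ => //; exact: (E_L0 fE).
  + apply/measurable_EFinP; apply: measurableT_comp => //.
    by apply: measurable_funS sJ _ => //; exact: (E_L0 fE).
Qed.

Lemma Q_zero : gset Q (fun=> 0) /\ gauge Q (fun=> 0) <= 0.
Proof.
have E0 := E_zero.
have g0 : gauge E (fun=> 0) = 0.
  have [_] := E_scale fE 0 E0; by rewrite normr0 !mul0r.
suff: gset Q (fun=> 0) /\ gauge Q (fun=> 0) <= gauge E (fun=> 0) by rewrite g0.
apply: (@Q_intro _ _ _ _ dw fE sE _ (fun=> 0)); first exact: measurable_cst.
split => //.
- by move=> s t *; rewrite !mul0r.
- move=> t It; under [leRHS]eq_integral do rewrite mul0r.
  rewrite integral0 le_eqVlt; apply/orP; left; apply/eqP.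
  apply: integral0_eq => s [s0 _]; rewrite star_leb; last exact: measurable_cst.
  by rewrite (rearrangement0 (@measurable_oint R a) m1 p1)// ltW.
- split => // s Js; rewrite normr0 integral0 le_eqVlt; apply/orP; left; apply/eqP.
  apply: integral0_eq => t [t0 _].
  by rewrite (rearrangement0 (@measurable_oint R a) mw w0)// ltW.
Qed.

Lemma Q_add f g : gset Q f -> gset Q g -> gset Q (fun t => f t + g t) /\
  gauge Q (fun t => f t + g t) <= gauge Q f + gauge Q g.
Proof.
move=> Qf Qg; have mf := Q_L0 Qf; have mg := Q_L0 Qg.
have H c d : gauge Q f < c -> gauge Q g < d -> gset Q (fun t => f t + g t) /\
    gauge Q (fun t => f t + g t) <= c + d.
  move=> fc gd; have [u [h [Bu h0 hc]]] := Q_elim dw Qf fc.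
  have [v [k [Bv k0 kd]]] := Q_elim dw Qg gd.
  have mfg : measurable_fun I (fun t => f t + g t) by exact: measurable_funD.
  have [Qfg gfg] := Q_intro dw fE sE mfg (Q_boundD mf mg Bu Bv h0 k0).
  split=> //; apply: (le_trans gfg).
  have Eh : gset E h by case: Bu => _ _ _ _ [].
  have Ek : gset E k by case: Bv => _ _ _ _ [].
  by apply: le_trans (E_add fE Eh Ek).2 _; rewrite lerD// ltW.
split; first by have [] := H (gauge Q f + 1) (gauge Q g + 1); rewrite ?ltrDl.
by apply: ler_forall_gt2 => c d fc gd; have [] := H c d fc gd.
Qed.

Lemma Q_scale_le c f : gset Q f -> gset Q (fun t => c * f t) /\
  gauge Q (fun t => c * f t) <= `|c| * gauge Q f.
Proof.
move=> Qf; have mf := Q_L0 Qf.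
have mcf : measurable_fun I (fun t => c * f t) by exact: measurable_funM.
have H d : gauge Q f < d -> gset Q (fun t => c * f t) /\ gauge Q (fun t => c * f t) <= `|c| * d.
  move=> fd; have [u [h [Bu h0 hd]]] := Q_elim dw Qf fd.
  have [Qcf gcf] := Q_intro dw fE sE mcf (Q_boundZ c mf Bu).
  split=> //; apply: (le_trans gcf).
  have Eh : gset E h by case: Bu => _ _ _ _ [].
  by rewrite (E_scale fE c Eh).2 ler_wpM2l// ltW.
split; first by have [] := H (gauge Q f + 1); rewrite ?ltrDl.
have [->|c0] := eqVneq c 0.
  rewrite normr0 mul0r; under [X in gauge Q X]eq_fun do rewrite mul0r.
  exact: Q_zero.2.
apply: ler_forall_gt => z; rewrite mulrC -ltr_pdivlMr ?normr_gt0// => fz.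
have [_] := H _ fz; by rewrite mulrC divfK// normr_eq0.
Qed.

Lemma Q_scale c f : gset Q f -> gauge Q (fun t => c * f t) = `|c| * gauge Q f.
Proof.
move=> Qf; apply/eqP; rewrite eq_le (Q_scale_le c Qf).2 /=.
have [->|c0] := eqVneq c 0.
  rewrite normr0 mul0r; apply: (Q_gauge_ge0 fE).
  by have [] := Q_scale_le 0 Qf.
have [Qcf _] := Q_scale_le c Qf; have := (Q_scale_le c^-1 Qcf).2.
have -> : (fun t => c^-1 * (c * f t)) = f by apply/funext => t; rewrite mulKf.
by rewrite normfV mulrC ler_pdivlMr ?normr_gt0// mulrC.
Qed.

Lemma Q_linear : linear_subspace Q.
Proof.
split; first exact: Q_zero.1.
- by move=> f g Qf Qg; have [] := Q_add Qf Qg.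
- by move=> c f Qf; have [] := Q_scale_le c Qf.
Qed.

Lemma Q_prec f g : measurable_fun I f -> gset Q g -> prec I f g ->
  gset Q f /\ gauge Q f <= gauge Q g.
Proof.
move=> mf Qg /precE fg.
have H d : gauge Q g < d -> gset Q f /\ gauge Q f <= d.
  move=> gd; have [u [h [[mu_ u0 ud gu uh] h0 hd]]] := Q_elim dw Qg gd.
  have [|Qf gf] := @Q_intro _ _ _ _ dw fE sE f u h mf _.
    by split; [exact: mu_|exact: u0|exact: ud| |exact: uh] => t It; apply: le_trans (fg _ It) (gu _ It).
  by split; [exact: Qf|exact: le_trans gf (ltW hd)].
split; first by have [] := H (gauge Q g + 1); rewrite ?ltrDl.
by apply: ler_forall_gt => d /H[].
Qed.

Lemma prec_le f g : measurable_fun I f -> measurable_fun I g ->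
  ae_on I (fun t => `|f t| <= `|g t|) -> prec I f g.
Proof.
move=> mf mg fg; apply/precE => t It; apply: ge0_le_integral => //.
- by move=> s _; exact: rearrangement_ge0.
- exact: measurable_rearrangement.
- exact: measurable_rearrangement.
- by move=> s _; exact: le_star.
Qed.

Lemma Q_solid : solid I Q.
Proof. by move=> f g Qf mg gf; have [] := Q_prec mg Qf (prec_le mg (Q_L0 Qf) gf). Qed.

(** The averaging bound in [E] at the length [W(x)]. It makes elements of norm 0 vanish a.e. *)
Lemma Q_integral_le f x : gset Q f -> I x ->
  (\int[leb]_(t in oint x%:E) star f t <=
   (fine (primitive w x) / gauge E (\1_(oint (primitive w x))) * gauge Q f)%:E)%E.
Proof.
move=> Qf Ix.
have Jx : J (fine (primitive w x)).
  split; last by rewrite fineK ?(primitive_fin dw)// (primitive_le_total dw).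
  by rewrite -lte_fin fineK ?(primitive_fin dw)// (primitive_gt0 dw).
have H d : gauge Q f < d -> (\int[leb]_(t in oint x%:E) star f t <=
   (fine (primitive w x) / gauge E (\1_(oint (primitive w x))) * d)%:E)%E.
  move=> fd; have [u [h [Bu h0 hd]]] := Q_elim dw Qf fd.
  have Eh : gset E h by case: Bu => _ _ _ _ [].
  apply: (le_trans (Q_bound_integral dw Bu Ix)).
  rewrite -(fineK (primitive_fin dw Ix)) /=.
  case: Jx => W0 /ltW Wb.
  apply: (le_trans (integral_abs_oint_le (E_L0 fE Eh) W0 Wb)).
  apply: (le_trans (E_integral_le fE sE Eh W0 Wb)).
  rewrite lee_fin; apply: ler_wpM2l; last exact: ltW.
  by have [_ ?] := E_indic fE sE W0 Wb; rewrite divr_ge0// ltW.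
apply: lee_forall_gt_mul H; case: Jx => W0 /ltW Wb; have [_ ?] := E_indic fE sE W0 Wb.
by rewrite -(fineK (primitive_fin dw Ix)) divr_ge0// ltW.
Qed.

End weighted_space.

(** * Completeness and full symmetry *)

(** Reduces null sets to initial intervals ending inside the domain, on which integrals are known to
    be finite. *)
Lemma negligible_oint (R : realType) (x : \bar R) (Z : set R) : measurable Z -> Z `<=` oint x ->
  (forall t, oint x t -> leb (Z `&` oint t%:E) = 0%E) -> leb Z = 0%E.
Proof.
move=> mZ Zx H; apply/eqP; rewrite eq_le measure_ge0 andbT.
have E (A : set R) : measurable A -> (\int[leb]_(t in A) (\1_Z t)%:E = leb (Z `&` A))%E.
  by move=> mA; rewrite integral_indic.
have -> : leb Z = (\int[leb]_(t in oint x) (\1_Z t)%:E)%E.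
  by rewrite E//; congr (leb _); rewrite setIidl.
apply: integral_oint_le => //.
- by apply/measurable_EFinP; exact: measurable_indic.
- by move=> t xt; rewrite E// H.
Qed.

Lemma normr_max (R : realType) (x : R) : `|x| = Num.max x 0 + Num.max (- x) 0.
Proof.
case/orP: (le_total 0 x) => h.
  by rewrite max_l// max_r ?oppr_le0// ger0_norm// addr0.
by rewrite max_r// max_l ?oppr_ge0// ler0_norm// add0r.
Qed.

Lemma maxrB (R : realType) (x : R) : Num.max x 0 - Num.max (- x) 0 = x.
Proof.
case/orP: (le_total 0 x) => h; first by rewrite max_l// max_r ?oppr_le0// subr0.
by rewrite max_r// max_l ?oppr_ge0// sub0r opprK.
Qed.

Section series.
Context {R : realType} {b : \bar R} {E : gauged_class R}.
Local Notation leb := (@leb R).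
Local Notation J := (oint b).
Hypotheses (b0 : (0 < b)%E) (fE : fully_symmetric_space J E).
Implicit Types (f g h : R -> R).

Lemma E_zero' : gset E (fun=> 0) /\ gauge E (fun=> 0) = 0.
Proof.
have E0 : gset E (fun=> 0) by case: fE => -[_ [E0 _ _] _ _ _ _ _] _ _.
by split=> //; have [_] := E_scale fE 0 E0; rewrite normr0 !mul0r.
Qed.

Lemma E_sum (h : nat -> R -> R) m n : (forall k, gset E (h k)) ->
  gset E (fun t => \sum_(m <= k < m + n) h k t) /\
  gauge E (fun t => \sum_(m <= k < m + n) h k t) <= \sum_(m <= k < m + n) gauge E (h k).
Proof.
move=> Eh; elim: n => [|n [IH1 IH2]].
  have -> : (fun t => \sum_(m <= k < m + 0) h k t) = (fun=> 0).
    by apply/funext => t; rewrite big_geq// addn0.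
  have [? ->] := E_zero'.
  by split; rewrite // big_geq// addn0.
have -> : (fun t => \sum_(m <= k < m + n.+1) h k t) =
    (fun t => \sum_(m <= k < m + n) h k t + h (m + n)%N t).
  by apply/funext => t; rewrite addnS big_nat_recr//= leq_addr.
have [A B] := E_add fE IH1 (Eh (m + n)%N).
split; first exact: A.
by apply: (le_trans B); rewrite addnS big_nat_recr ?leq_addr//= lerD2r.
Qed.

Lemma E_sub g h : gset E g -> gset E h -> gset E (fun t => g t - h t) /\
  gauge E (fun t => g t - h t) <= gauge E g + gauge E h.
Proof.
move=> Eg Eh; have [Eh' gh'] := E_scale fE (-1) Eh.
have [A B] := E_add fE Eg Eh'.
have -> : (fun t => g t - h t) = (fun t => g t + -1 * h t).
  by apply/funext => t; rewrite mulN1r.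
split; first exact: A.
by apply: (le_trans B); rewrite gh' normrN1 mul1r.
Qed.

Lemma half_lt (M e : R) : 0 < e -> exists N : nat, forall n, (N <= n)%N -> M * 2^-1 ^+ n < e.
Proof.
move=> e0; exists (Num.truncn (M / e)).+1 => n Nn.
have n2 : n%:R < 2 ^+ n :> R by rewrite -natrX ltr_nat ltn_expl.
rewrite exprVn ltr_pdivrMr ?exprn_gt0// -ltr_pdivrMl// mulrC.
apply: lt_trans n2; apply: (lt_le_trans (truncnS_gt _)).
by rewrite ler_nat.
Qed.

Lemma half_sum (M : R) m n : 0 <= M ->
  \sum_(m <= k < m + n) M * 2^-1 ^+ k <= 2 * M * 2^-1 ^+ m.
Proof.
move=> M0; suff -> : \sum_(m <= k < m + n) M * 2^-1 ^+ k =
    2 * M * 2^-1 ^+ m - 2 * M * 2^-1 ^+ (m + n).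
  by rewrite gerBl mulr_ge0// ?exprn_ge0// mulr_ge0.
elim: n => [|n IH]; first by rewrite addn0 big_geq// subrr.
rewrite addnS big_nat_recr ?leq_addr//= IH exprS.
set x := 2^-1 ^+ (m + n); set y := 2^-1 ^+ m; lra.
Qed.

(** The partial sums converge in norm to some [F0]. Norm convergence says nothing pointwise
    directly, but for [m >= n] the positive part of [S n - F0] is at most [|S m - F0|]; its norm is
    therefore 0 and [F0] majorizes [S n] a.e. *)
Lemma E_series (M : R) (h : nat -> R -> R) : 0 <= M -> (forall k, gset E (h k)) ->
  (forall k t, J t -> 0 <= h k t) -> (forall k, gauge E (h k) <= M * 2^-1 ^+ k) ->
  exists F, [/\ gset E F, gauge E F <= 2 * M &
    forall n, ae_on J (fun t => \sum_(0 <= k < n) h k t <= F t)].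
Proof.
move=> M0 Eh h0 hM; pose S n t := \sum_(0 <= k < n) h k t.
have ES n : gset E (S n) by have [] := E_sum 0 n Eh.
have gS n : gauge E (S n) <= 2 * M.
  have [_ B] := E_sum 0 n Eh; apply: (le_trans B).
  apply: (@le_trans _ _ (\sum_(0 <= k < 0 + n) M * 2^-1 ^+ k)).
    by apply: ler_sum => k _; exact: hM.
  by apply: (le_trans (half_sum 0 n M0)); rewrite expr0 mulr1.
have gSS m n : (n <= m)%N -> gset E (fun t => S m t - S n t) /\
    gauge E (fun t => S m t - S n t) <= 2 * M * 2^-1 ^+ n.
  move=> nm; have -> : (fun t => S m t - S n t) = (fun t => \sum_(n <= k < n + (m - n)) h k t).
    apply/funext => t; rewrite /S subnKC// (@big_cat_nat _ _ _ n 0%N m)//=.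
    by rewrite addrAC subrr add0r.
  have [A B] := E_sum n (m - n) Eh; split; first exact: A.
  apply: (le_trans B); apply: le_trans (half_sum n (m - n) M0).
  by apply: ler_sum => k _; exact: hM.
have [F0 EF0 cF] : exists2 F0, gset E F0 &
    (fun n => gauge E (fun t => S n t - F0 t)) @ \oo --> (0 : R).
  case: fE => -[_ _ _ _ _ _ compl] _ _; apply: (compl S ES) => e e0.
  have [N HN] := half_lt (2 * M) e0; exists N => m n Nm Nn.
  case: (leqP n m) => [nm|/ltnW mn].
    exact: le_lt_trans (gSS _ _ nm).2 (HN _ Nn).
  have [A B] := gSS _ _ mn.
  have -> : (fun t => S m t - S n t) = (fun t => -1 * (S n t - S m t)).
    by apply/funext => t; rewrite mulN1r opprB.
  rewrite (E_scale fE (-1) A).2 normrN1 mul1r.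
  exact: le_lt_trans B (HN _ Nm).
have small e : 0 < e -> exists N, forall n, (N <= n)%N -> gauge E (fun t => S n t - F0 t) < e.
  move=> e0; move/cvgrPdist_lt : cF => /(_ _ e0) [N _ HN]; exists N => n Nn.
  have := HN n Nn; rewrite /= sub0r normrN; apply: le_lt_trans; exact: ler_norm.
have ESF n : gset E (fun t => S n t - F0 t) by have [] := E_sub (ES n) EF0.
exists F0; split; first exact: EF0.
  apply/ler_addgt0Pr => e e0; have [N HN] := small _ e0.
  have [_ B] := E_sub (ES N) (ESF N).
  have FE : (fun t => S N t - (S N t - F0 t)) = F0.
    by apply/funext => t; rewrite opprB addrCA subrr addr0.
  rewrite FE in B; apply: (le_trans B); apply: lerD; first exact: gS.
  exact: ltW (HN _ (leqnn N)).
move=> n; pose p t := Num.max (S n t - F0 t) 0.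
have mp : measurable_fun J p.
  apply: measurable_maxr; last exact: measurable_cst.
  exact: (E_L0 fE (ESF n)).
have pm m : (n <= m)%N -> gset E p /\ gauge E p <= gauge E (fun t => S m t - F0 t).
  move=> nm; apply: (E_le fE (ESF m) mp); apply: aeW => t Jt.
  rewrite ger0_norm ?le_max ?lexx ?orbT// ge_max normr_ge0 andbT.
  apply: le_trans (ler_norm _); rewrite lerD2r /S (@big_cat_nat _ _ _ n 0%N m)//= lerDl.
  by apply: sumr_ge0 => k _; exact: h0.
have [Ep _] := pm n (leqnn n).
have p0 : gauge E p = 0.
  apply/eqP; rewrite eq_le (E_gauge_ge0 fE Ep) andbT; apply/ler_addgt0Pr => e e0.
  have [N HN] := small _ e0; rewrite add0r.
  apply: le_trans (pm (maxn n N) (leq_maxl _ _)).2 _.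
  exact: ltW (HN _ (leq_maxr _ _)).
case: fE => -[_ _ _ _ [_ np _ _] _ _] _ _.
have [Z [mZ Z0 hZ]] := np _ Ep p0; exists Z; split => //; apply: subset_trans hZ => t /= H H'.
apply: H => Jt; have := H' Jt; rewrite /p => pt0; rewrite -subr_le0.
have : S n t - F0 t <= Num.max (S n t - F0 t) 0 by rewrite le_max lexx.
by rewrite pt0.
Qed.

End series.

(** * Completeness of Q_{E,w} and its support *)

Section complete.
Context {R : realType} {a : \bar R} {w : R -> R} {E : gauged_class R}.
Local Notation leb := (@leb R).
Local Notation I := (oint a).
Local Notation b := (total_mass a w).
Local Notation J := (oint b).
Local Notation mu := (weighted_measure w).
Local Notation wstar := (rearrangement mu I).
Local Notation star := (rearrangement leb I).
Local Notation Q := (Q_space a w E).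
Hypotheses (a0 : (0 < a)%E) (dw : decreasing_weight a w)
  (fE : fully_symmetric_space J E) (sE : has_support J E).
Implicit Types (f g h u : R -> R).

Let mw : measurable_fun I w := measurable_weight dw.
Let w0 : forall t, I t -> 0 <= w t := weight_ge0 dw.
Let b0 : (0 < b)%E := total_gt0 a0 dw.

(** With [v] the sum of the [u k] and [F] a majorant of the partial sums of the [h k], the pair
    [(v, F)] bounds every [g] below the sum of the [|f k|]. Allowing any such [g] makes the lemma
    applicable to the tails of a series whose limit is still to be placed in [Q]. *)
Lemma Q_series (M : R) (f : nat -> R -> R) : 0 < M -> (forall k, gset Q (f k)) ->
  (forall k, gauge Q (f k) < M * 2^-1 ^+ k) ->
  ae_on I (fun t => (\sum_(0 <= k <oo) `|f k t|%:E < +oo)%E) /\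
  forall g, measurable_fun I g ->
    ae_on I (fun t => (`|g t|%:E <= \sum_(0 <= k <oo) `|f k t|%:E)%E) ->
    gset Q g /\ gauge Q g <= 2 * M.
Proof.
move=> M0 Qf fM.
have [u /choice[h H]] := choice (fun k => Q_elim dw (Qf k) (fM k)).
have mf k : measurable_fun I (f k) by exact: Q_L0 (Qf k).
have mu_ k : measurable_fun I (u k) by case: (H k) => -[].
have u0 k t : I t -> 0 <= u k t by case: (H k) => -[_ h' _ _ _] _ _; exact: h'.
have ud k s t : I s -> I t -> s <= t -> u k t * w t <= u k s * w s.
  by case: (H k) => -[_ _ h' _ _] _ _; exact: h'.
have fu k t : I t -> (\int[leb]_(s in oint t%:E) star (f k) s <=
    \int[leb]_(s in oint t%:E) (u k s * w s)%:E)%E.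
  by case: (H k) => -[_ _ _ h' _] _ _; exact: h'.
have Eh k : gset E (h k) by case: (H k) => -[_ _ _ _ []].
have uh k s : J s -> (\int[leb]_(t in oint s%:E) wstar (u k) t <=
    \int[leb]_(t in oint s%:E) `|h k t|%:E)%E.
  by case: (H k) => -[_ _ _ _ [_ h']] _ _; exact: h'.
have h0 k t : J t -> 0 <= h k t by case: (H k) => _ h' _; exact: h'.
have [F [EF gF hF]] := E_series fE (ltW M0) Eh h0 (fun k => ltW (let: And3 _ _ h' := H k in h')).
have uwI k x : I x -> (\int[leb]_(s in oint x%:E) (u k s * w s)%:E <=
    \int[leb]_(t in oint (primitive w x)) wstar (u k) t)%E.
  move=> Ix; have xI := sub_oint_mem Ix.
  have := integral_le_rearrangement (@measurable_oint R a) mw w0 (@measurable_oint R x%:E) xI (mu_ k).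
  rewrite -primitiveE; apply: le_trans.
  rewrite le_eqVlt; apply/orP; left; apply/eqP; apply: eq_integral => s /set_mem/xI Is.
  by rewrite mulrC ger0_norm ?u0.
have mh k A : A `<=` J -> measurable A -> measurable_fun A (fun t => `|h k t|%:E).
  move=> AJ mA; apply/measurable_EFinP; apply: measurableT_comp => //.
  by apply: measurable_funS AJ _ => //; exact: (E_L0 fE).
have sumF s : J s -> (\sum_(0 <= k <oo) \int[leb]_(t in oint s%:E) `|h k t|%:E <=
    \int[leb]_(t in oint s%:E) `|F t|%:E)%E.
  move=> Js; have sJ := sub_oint_mem Js.
  apply: lime_le; first by apply: is_cvg_nneseries => n _ _; exact: integral_ge0.
  apply: nearW => n; rewrite -ge0_integral_sum//; last first.
    by move=> k; exact: mh.
  apply: ae_ge0_le_integral => //.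
  - by move=> t _; apply: sume_ge0.
  - by apply: emeasurable_sum => k; exact: mh.
  - apply/measurable_EFinP; apply: measurableT_comp => //.
    by apply: measurable_funS sJ _ => //; exact: (E_L0 fE).
  - have [Z [mZ Z0 hZ]] := hF n; exists Z; split => //; apply: subset_trans hZ => t /= H1 H2.
    apply: H1 => st; rewrite sumEFin lee_fin; apply: le_trans (ler_norm _).
    apply: le_trans (H2 (sJ _ st)); apply: ler_sum => k _.
    by rewrite ger0_norm// h0//; exact: sJ.
have JW x : I x -> J (fine (primitive w x)).
  move=> Ix; split; last by rewrite fineK ?(primitive_fin dw)// (primitive_le_total dw).
  by rewrite -lte_fin fineK ?(primitive_fin dw)// (primitive_gt0 dw).
have uwF x : I x -> (\sum_(0 <= k <oo) \int[leb]_(s in oint x%:E) (u k s * w s)%:E < +oo)%E.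
  move=> Ix; apply: le_lt_trans (E_integral_abs_lty fE sE EF (JW x Ix)).
  apply: le_trans (sumF _ (JW x Ix)); apply: lee_nneseries => k _; last first.
    by apply: le_trans (uwI k x Ix) _; rewrite -[X in oint X](fineK (primitive_fin dw Ix)); exact: (uh k _ (JW x Ix)).
  move=> _; apply: integral_ge0 => s /(sub_oint_mem Ix) Is.
  by rewrite lee_fin mulr_ge0 ?u0 ?w0.
have mabs k : measurable_fun I (fun t => `|f k t|%:E).
  by apply/measurable_EFinP; exact: measurableT_comp.
have mS : measurable_fun I (fun t => \sum_(0 <= k <oo) `|f k t|%:E)%E.
  by apply: ge0_emeasurable_sum => // k t _ _; rewrite lee_fin.
split.
  (* Divergence is excluded on each [oint x%:E], where the integral of the series is finite;
     [negligible_oint] collects these. *)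
  pose Z := I `&` [set t | (+oo <= \sum_(0 <= k <oo) `|f k t|%:E)%E].
  have mZ : measurable Z by exact: emeasurable_fun_c_infty.
  have ZI : Z `<=` I by exact: subIsetl.
  exists Z; split => //; last first.
    by move=> t /= Ht; apply: contrapT => Zt; apply: Ht => It; rewrite ltNge; apply/negP => Ht; apply: Zt.
  apply: (negligible_oint mZ ZI) => x Ix; have xI := sub_oint_mem Ix.
  have mSx : measurable_fun (oint x%:E) (fun t => \sum_(0 <= k <oo) `|f k t|%:E)%E.
    by apply: measurable_funS mS.
  have intS : leb.-integrable (oint x%:E) (fun t => \sum_(0 <= k <oo) `|f k t|%:E)%E.
    apply/integrableP; split; first exact: mSx.
    under eq_integral => t _ do rewrite gee0_abs ?nneseries_ge0//.
    rewrite integral_nneseries//; last by move=> k; apply: measurable_funS (mabs k).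
    apply: le_lt_trans (uwF x Ix); apply: lee_nneseries => k _; first by move=> _; exact: integral_ge0.
    apply: le_trans (fu k x Ix); case: (Ix) => x0 /ltW xa.
    exact: (integral_abs_oint_le (mf k) x0 xa).
  have [N [mN N0 hN]] := @integrable_ae _ (measurableTypeR R) R leb _ (@measurable_oint R x%:E) _ intS.
  apply: (subset_measure0 _ mN _ N0); first exact: measurableI.
  move=> t [[It Zt] xt]; apply: hN => /= /(_ xt).
  by move: Zt => /=; rewrite leye_eq => /eqP ->.
move=> g mg gf.
pose v t := (\sum_(0 <= k <oo) (u k t)%:E)%E.
have v0 t : I t -> (0 <= v t)%E.
  by move=> It; apply: nneseries_ge0 => k _ _; rewrite lee_fin u0.
have mv : measurable_fun I v.
  apply: ge0_emeasurable_sum => [k t It _|k _]; first by rewrite lee_fin u0.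
  exact/measurable_EFinP.
have vw t : I t -> (\sum_(0 <= k <oo) (u k t * w t)%:E = (w t)%:E * v t)%E.
  move=> It; rewrite -nneseriesZl; last by move=> k _; rewrite lee_fin u0.
  by apply: eq_eseriesr => k _; rewrite -EFinM mulrC.
have vwint x : I x -> (\int[leb]_(t in oint x%:E) ((w t)%:E * v t) =
    \sum_(0 <= k <oo) \int[leb]_(s in oint x%:E) (u k s * w s)%:E)%E.
  move=> Ix; have xI := sub_oint_mem Ix; rewrite -integral_nneseries//.
  - by apply: eq_integral => t /set_mem/xI It; rewrite vw.
  - move=> k; apply/measurable_EFinP; apply: measurable_funS xI _ => //.
    exact: measurable_funM.
  - by move=> k t /xI It; rewrite lee_fin mulr_ge0 ?u0 ?w0.
have vd s t : I s -> I t -> s <= t -> ((w t)%:E * v t <= (w s)%:E * v s)%E.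
  move=> Is It st; rewrite -!vw//; apply: lee_nneseries => k _.
    by move=> _; rewrite lee_fin mulr_ge0 ?u0 ?w0.
  by rewrite lee_fin ud.
have wpos t : I t -> 0 < w t by exact: (weight_gt0 dw).
have mvw x : I x -> measurable_fun (oint x%:E) (fun t => (w t)%:E * v t)%E.
  move=> /sub_oint_mem xI; apply: emeasurable_funM.
    by apply/measurable_EFinP; apply: measurable_funS mw.
  by apply: measurable_funS mv.
(* Since [w * v] is decreasing, [t * w t * v t] is at most its integral up to [t]. The series [v] is
   thus finite everywhere and not just a.e. *)
have vfin t : I t -> v t \is a fin_num.
  move=> It; have tI := sub_oint_mem It; rewrite ge0_fin_numE ?v0//.
  have : ((w t)%:E * v t * t%:E < +oo)%E.
    apply: le_lt_trans (uwF t It); rewrite -vwint// -integral_oint_cst ?lee_fin; last first.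
      by case: It => /ltW.
    apply: ge0_le_integral => //.
    - by move=> s _; rewrite mule_ge0 ?v0// lee_fin w0.
    - exact: mvw.
    - by move=> s st; apply: vd => //; [exact: tI|case: st => _; rewrite lte_fin => /ltW].
  case: (v t) (v0 _ It) => [r _ _|_|//]; first by rewrite ltry.
  rewrite gt0_muley ?lte_fin ?wpos// gt0_mulye ?ltxx// lte_fin.
  by case: It.
have uwE t : I t -> (fine (v t) * w t)%:E = ((w t)%:E * v t)%E.
  by move=> It; rewrite mulrC EFinM fineK ?vfin.
have [|Qg gg] := @Q_intro _ _ _ _ dw fE sE g (fine \o v) F mg; last first.
- by split; [exact: Qg|exact: le_trans gg gF].
split.
- exact: measurable_fine_comp.
- by move=> t It; rewrite fine_ge0// v0.
- by move=> s t Is It st; rewrite -lee_fin/= !uwE// vd.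
- move=> t It; case: (It) => t0 _; have tI := sub_oint_mem It.
  apply: (le_trans (star_nneseries mg mf (ltW t0) gf)).
  have -> : (\int[leb]_(s in oint t%:E) ((fine \o v) s * w s)%:E =
      \int[leb]_(s in oint t%:E) ((w s)%:E * v s))%E.
    by apply: eq_integral => s /set_mem/tI Is; rewrite uwE.
  rewrite vwint//; apply: lee_nneseries => k _; last exact: fu.
  by move=> _; apply: integral_ge0 => s _; exact: rearrangement_ge0.
- split; first exact: EF.
  move=> s Js; case: (Js) => s0 _; apply: le_trans (sumF s Js).
  apply: (@le_trans _ _ (\sum_(0 <= k <oo) \int[leb]_(t in oint s%:E) wstar (u k) t)%E).
    apply: (integral_rearrangement_nneseries (@measurable_oint R a) mw w0) => //.
    + exact: measurable_fine_comp.
    + exact: ltW.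
    + apply: aeW => t It; rewrite ger0_norm ?fine_ge0 ?v0//= fineK ?vfin//.
      by apply: lee_nneseries => k _; [rewrite lee_fin u0|rewrite lee_fin ler_norm].
  apply: lee_nneseries => k _; last exact: uh.
  by move=> _; apply: integral_ge0 => t _; exact: rearrangement_ge0.
Qed.

Lemma Q_complete : gauge_complete (Q_space a w E).
Proof.
move=> u Qu cauchy.
have half0 k : 0 < 2^-1 ^+ k :> R by rewrite exprn_gt0.
have [N HN] := choice (fun k => cauchy _ (half0 k)).
(* Summing the thresholds makes [n] nondecreasing while keeping [n k >= N k]. *)
pose n k := (\sum_(0 <= j < k.+1) N j)%N.
have nN k : (N k <= n k)%N by rewrite /n big_nat_recr//= leq_addl.
have nS k : (n k <= n k.+1)%N by rewrite {2}/n big_nat_recr//= leq_addr.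
pose f k t := u (n k.+1) t - u (n k) t.
have Qsub g h : gset Q g -> gset Q h -> gset Q (fun t => g t - h t).
  move=> Qg Qh; have -> : (fun t => g t - h t) = (fun t => g t + -1 * h t).
    by apply/funext => t; rewrite mulN1r.
  have [Qh' _] := Q_scale_le dw fE sE (-1) Qh.
  exact: (Q_add dw fE sE Qg Qh').1.
have Qf k : gset Q (f k) by exact: Qsub.
have fM k : gauge Q (f k) < 1 * 2^-1 ^+ k.
  rewrite mul1r; apply: HN; last exact: nN.
  exact: leq_trans (nN k) (nS k).
have mu_ k : measurable_fun I (u k) by exact: Q_L0 (Qu k).
have mf k : measurable_fun I (f k) by exact: Q_L0 (Qf k).
have [fae _] := Q_series ltr01 Qf fM.
(* Summing positive and negative parts separately gives measurable functions without any
   convergence; on the null set of divergence an infinite sum is replaced by 0 through [fine]. *)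
pose P t := (\sum_(0 <= k <oo) (Num.max (f k t) 0)%:E)%E.
pose M t := (\sum_(0 <= k <oo) (Num.max (- f k t) 0)%:E)%E.
have p0 (x : R) : 0 <= Num.max x 0 by rewrite le_max lexx orbT.
pose g t := u (n 0%N) t + (fine (P t) - fine (M t)).
have mg : measurable_fun I g.
  apply: measurable_funD => //; apply: measurable_funB; apply: measurable_fine_comp.
    apply: ge0_emeasurable_sum => [k t _ _|k _]; first by rewrite lee_fin.
    by apply/measurable_EFinP; apply: measurable_maxr => //; exact: measurable_cst.
  apply: ge0_emeasurable_sum => [k t _ _|k _]; first by rewrite lee_fin.
  apply/measurable_EFinP; apply: measurable_maxr; last exact: measurable_cst.
  exact: measurable_funN.
have tail m : ae_on I (fun t => (`|u (n m) t - g t|%:E <= \sum_(0 <= k <oo) `|f (k + m)%N t|%:E)%E).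
  have [Z [mZ Z0 hZ]] := fae; exists Z; split; [exact: mZ|exact: Z0|].
  apply: subset_trans hZ => t /= H1 H2; apply: H1 => It; have {}H2 := H2 It.
  have split_tail (F : nat -> R) : (forall k, 0 <= F k) -> (forall k, F k <= `|f k t|) ->
      exists2 c : R, 0 <= c & (\sum_(0 <= k <oo) (F k)%:E = (\sum_(0 <= k < m) F k + c)%:E)%E
        /\ (c%:E = \sum_(0 <= k <oo) (F (k + m)%N)%:E)%E.
    move=> F0 Ff.
    have Fy : (\sum_(0 <= k <oo) (F k)%:E < +oo)%E.
      by apply: le_lt_trans H2; apply: lee_nneseries => k _; rewrite lee_fin.
    have E1 := nneseries_addn m (fun k => (F0 k : 0 <= (F k)%:E)%E).
    have := @nneseries_split R (fun k => (F k)%:E) 0%N m (fun k _ => F0 k : (0 <= (F k)%:E)%E).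
    rewrite add0n -E1 sumEFin => E2.
    have c0 : (0 <= \sum_(0 <= k <oo) (F (k + m)%N)%:E)%E by apply: nneseries_ge0 => k _ _; rewrite lee_fin.
    have cf : (\sum_(0 <= k <oo) (F (k + m)%N)%:E)%E \is a fin_num.
      rewrite ge0_fin_numE//; apply: le_lt_trans Fy; rewrite E2 leeDr// lee_fin.
      by apply: sumr_ge0.
    exists (fine (\sum_(0 <= k <oo) (F (k + m)%N)%:E)%E); first exact: fine_ge0.
    by rewrite EFinD fineK.
  have [c c0 [Pc cE]] : exists2 c : R, 0 <= c & (P t = (\sum_(0 <= k < m) Num.max (f k t) 0 + c)%:E)
        /\ (c%:E = \sum_(0 <= k <oo) (Num.max (f (k + m)%N t) 0)%:E)%E.
    apply: (split_tail (fun k => Num.max (f k t) 0)) => // k.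
    by rewrite ge_max normr_ge0 ler_norm.
  have [d d0 [Md dE]] : exists2 c : R, 0 <= c & (M t = (\sum_(0 <= k < m) Num.max (- f k t) 0 + c)%:E)
        /\ (c%:E = \sum_(0 <= k <oo) (Num.max (- f (k + m)%N t) 0)%:E)%E.
    apply: (split_tail (fun k => Num.max (- f k t) 0)) => // k.
    by rewrite ge_max normr_ge0 -normrN ler_norm.
  have -> : (\sum_(0 <= k <oo) `|f (k + m)%N t|%:E = (c + d)%:E)%E.
    rewrite EFinD cE dE -nneseriesD; last 2 first.
    - by move=> k _ _; rewrite lee_fin.
    - by move=> k _ _; rewrite lee_fin.
    apply: eq_eseriesr => k _; rewrite -EFinD; congr (_%:E).
    exact: normr_max.
  have -> : u (n m) t - g t = d - c.
    rewrite /g Pc Md /=.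
    have : u (n m) t = u (n 0%N) t + \sum_(0 <= k < m) (Num.max (f k t) 0 - Num.max (- f k t) 0).
      elim: m {split_tail c c0 Pc cE d d0 Md dE} => [|m IH]; first by rewrite big_geq ?addr0.
      rewrite big_nat_recr//= addrA -IH.
      rewrite maxrB.
      by rewrite /f addrCA subrr addr0.
    rewrite sumrB => ->.
    set X := \sum_(0 <= _ < m) _; set Y := \sum_(0 <= _ < m) _; lra.
  by rewrite lee_fin; apply: (le_trans (ler_normB _ _)); rewrite !ger0_norm// addrC.
have Qtail m : gset Q (fun t => u (n m) t - g t) /\
    gauge Q (fun t => u (n m) t - g t) <= 2 * 2^-1 ^+ m.
  have [|_ H] := @Q_series (2^-1 ^+ m) (fun k => f (k + m)%N) (half0 m) (fun k => Qf (k + m)%N).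
    by move=> k; have := fM (k + m)%N; rewrite mul1r exprD mulrC.
  by apply: H => //; exact: measurable_funB.
have Qg : gset Q g.
  have -> : g = (fun t => u (n 0%N) t - (u (n 0%N) t - g t)).
    by apply/funext => t; rewrite opprB addrCA subrr addr0.
  exact: Qsub (Qu _) (Qtail 0%N).1.
exists g; first exact: Qg.
have diff i j : gset Q (fun t => u i t - u j t) := Qsub _ _ (Qu i) (Qu j).
apply/cvgrPdist_lt => e e0.
(* The 3 is 1 for the Cauchy condition between [u i] and [u (n m)], plus 2 for the tail after
   [m]. *)
have [m Hm] := half_lt 3 e0; have {}Hm := Hm m (leqnn m).
exists (n m) => // i /= ni.
rewrite sub0r normrN ger0_norm; last exact: (Q_gauge_ge0 fE (Qsub _ _ (Qu i) Qg)).
have -> : (fun t => u i t - g t) = (fun t => (u i t - u (n m) t) + (u (n m) t - g t)).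
  by apply/funext => t; rewrite addrA subrK.
apply: le_lt_trans (Q_add dw fE sE (diff i (n m)) (Qtail m).1).2 _.
have h1 := HN m i (n m) (leq_trans (nN m) ni) (nN m).
have h2 := (Qtail m).2.
apply: lt_trans Hm; rewrite -[3]/(1 + 2) mulrDl mul1r.
exact: ltr_leD.
Qed.

(** On [(0, x)] the weight is at least [w x], so the indicator divided by [w x] is an admissible
    [u]; its [w dm]-rearrangement is at most the indicator of [(0, W(x))] divided by [w x], which
    lies in [E] by the support hypothesis. *)
Lemma M_indic x : I x -> gset (M_class a w E) (\1_(oint x%:E)).
Proof.
move=> Ix; have xI := sub_oint_mem Ix; have wx : 0 < w x by exact: (weight_gt0 dw).
pose k : R -> R := \1_(oint x%:E).
have kd s t : I s -> I t -> s <= t -> k t <= k s.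
  move=> [s0 _] _ st; rewrite /k !indicE.
  case: (boolP (t \in _)) => [/set_mem [_ tx]|_]; last by case: (_ \in _).
  by rewrite mem_set//; split => //; apply: le_lt_trans tx; rewrite lee_fin.
have k0 t : 0 <= k t by [].
have mk A' : measurable_fun A' k by exact: measurable_indic.
pose u t := k t / w x.
have mu_ : measurable_fun I u by apply: measurable_funM => //; exact: measurable_cst.
have JW : J (fine (primitive w x)).
  split; last by rewrite fineK ?(primitive_fin dw)// (primitive_le_total dw).
  by rewrite -lte_fin fineK ?(primitive_fin dw)// (primitive_gt0 dw).
have [W0 /ltW Wb] := JW.
have [Ei _] := E_indic fE sE W0 Wb.
have [Eh _] := E_scale fE ((w x)^-1) Ei.
pose h t := (w x)^-1 * \1_(oint (fine (primitive w x))%:E) t.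
have [Mk _] : gset (M_class a w E) k /\ gauge (M_class a w E) k <= gauge E h.
  apply: (M_intro dw fE sE (mk I) mu_ _ _ Eh).
  - by move=> t _; rewrite mulr_ge0// invr_ge0 ltW.
  - move=> t It; apply: (le_trans (rearrangement_nonincreasing_le kd (fun s _ => k0 s) It)).
    rewrite lee_fin /u /k indicE; case: (boolP (t \in _)) => [/set_mem [_ tx]|_]; last by rewrite !mul0r.
    rewrite mul1r mulrC ler_pdivlMr// mul1r; apply: (weight_noninc dw) => //.
    by move: tx; rewrite lte_fin => /ltW.
  - move=> s Js; have sJ := sub_oint_mem Js; case: (Js) => s0 _.
    have dE r : 0 <= r -> Defs.distribution mu I u r = if r < (w x)^-1 then primitive w x else 0%E.
      move=> r0; rewrite /Defs.distribution /u /k; case: ifPn => rw.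
        rewrite primitiveE; congr weighted_measure; apply/seteqP; split => t.
          move=> [It /=]; rewrite indicE; case: (boolP (t \in _)) => [/set_mem//|_].
          by rewrite mul0r normr0 ltNge r0.
        move=> xt; split; first exact: xI.
        by rewrite /= indicE mem_set// mul1r ger0_norm// invr_ge0 ltW.
      rewrite (_ : _ `&` _ = set0) ?/weighted_measure ?integral_set0//.
      apply/seteqP; split => // t [It /=]; rewrite indicE; case: (_ \in _).
        by rewrite mul1r ger0_norm ?invr_ge0 ?(ltW wx)// (negbTE rw).
      by rewrite mul0r normr0 ltNge r0.
    apply: ge0_le_integral => //.
    + by move=> t _; exact: rearrangement_ge0.
    + exact: measurable_rearrangement.
    + apply/measurable_EFinP; apply: measurableT_comp => //.
      by apply: measurable_funM; [exact: measurable_cst|exact: measurable_indic].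
    + move=> t [t0 ts]; rewrite leNgt; apply/negP.
      rewrite (rearrangement_gt (@measurable_oint R a) mw w0)//.
      rewrite dE//; case: ifPn => [rw tW|_]; last by rewrite lte_fin ltNge (ltW t0).
      move: rw; rewrite indicE mem_set.
        by rewrite mulr1 ger0_norm ?ltxx// invr_ge0 ltW.
      by split => //; rewrite fineK// (primitive_fin dw).
exact: Mk.
Qed.

Lemma M_sub_Q g : gset (M_class a w E) g -> gset Q g.
Proof.
move=> Mg; have mg : measurable_fun I g by case: Mg.
by split; [exact: mg|exists g => //; apply: prec_le => //; exact: aeW].
Qed.

Lemma Q_full : full_support I Q.
Proof.
move=> A mA AI A0.
have [x Ix Ax] : exists2 x, I x & (0 < leb (A `&` oint x%:E))%E.
  apply: contrapT => H; move: A0; rewrite (negligible_oint mA AI) ?ltxx// => x Ix.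
  apply/eqP; rewrite eq_le measure_ge0 andbT leNgt; apply/negP => h.
  by apply: H; exists x.
exists (\1_(oint x%:E)); first by apply: M_sub_Q; exact: M_indic.
move=> k0'; have [||t [At xt] kt] := ae_on_exists _ Ax _ k0'.
- exact: measurableI.
- exact: subIsetl.
by move: kt; rewrite indicE mem_set// => /eqP; rewrite oner_eq0.
Qed.

End complete.

Section fully_symmetric.
Context {R : realType} {a : \bar R} {w : R -> R} {E : gauged_class R}.
Local Notation leb := (@leb R).
Local Notation I := (oint a).
Local Notation b := (total_mass a w).
Local Notation J := (oint b).
Local Notation star := (rearrangement leb I).
Local Notation Q := (Q_space a w E).
Hypotheses (a0 : (0 < a)%E) (dw : decreasing_weight a w)
  (fE : fully_symmetric_space J E) (sE : has_support J E).
Implicit Types (f g : R -> R).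

Lemma Q_gauge_eq0 f : gset Q f -> gauge Q f = 0 -> ae_on I (fun t => f t = 0).
Proof.
move=> Qf f0; have mf := Q_L0 Qf.
have mfI : measurable_fun I (fun t => `|f t|%:E).
  by apply/measurable_EFinP; exact: measurableT_comp.
have int0 : (\int[leb]_(t in I) `|f t|%:E = 0)%E.
  apply/eqP; rewrite eq_le integral_ge0 ?andbT; last by move=> t _; rewrite lee_fin.
  apply: integral_oint_le => // t It; have [t0 ta] := It.
  apply: (le_trans (integral_abs_oint_le mf t0 (ltW ta))).
  by apply: (le_trans (Q_integral_le dw fE sE Qf It)); rewrite f0 mulr0.
have mfE : measurable_fun I (EFin \o f) by exact/measurable_EFinP.
have := (ae_eq_integral_abs leb (@measurable_oint R a) mfE).1 int0.
by apply: filterS => t H It; have [] := H It.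
Qed.

Lemma Q_norm : is_norm I Q.
Proof.
split.
- exact: (Q_gauge_ge0 fE).
- exact: Q_gauge_eq0.
- by move=> c f Qf; exact: (Q_scale dw fE sE c Qf).
- by move=> f g Qf Qg; have [] := Q_add dw fE sE Qf Qg.
Qed.

Lemma Q_banach : banach_function_space I Q.
Proof.
split.
- by move=> f; exact: Q_L0.
- exact: Q_linear.
- exact: Q_solid.
- exact: Q_full.
- exact: Q_norm.
- move=> f g Qf Qg fg.
  by have [] := Q_prec dw fE sE (Q_L0 Qf) Qg (prec_le (Q_L0 Qf) (Q_L0 Qg) fg).
- exact: Q_complete.
Qed.

Lemma Q_fully_symmetric : fully_symmetric_space I Q.
Proof.
split; first exact: Q_banach.
- move=> f g Qf Qg fg.
  have fgE : star f = star g by apply: eq_rearrangement => s _; exact: fg.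
  apply/eqP; rewrite eq_le; apply/andP; split.
    by have [] := Q_prec dw fE sE (Q_L0 Qf) Qg _; first by move=> t _; rewrite fgE.
  by have [] := Q_prec dw fE sE (Q_L0 Qg) Qf _; first by move=> t _; rewrite fgE.
- by move=> f g mf Qg fg; exact: (Q_prec dw fE sE mf Qg fg).
Qed.

Lemma Q_smallest : smallest_fully_symmetric_containing I (M_class a w E) Q.
Proof.
split; first exact: Q_fully_symmetric.
- by move=> g; exact: M_sub_Q.
- by move=> X fX MX f [mf [g Mg fg]]; have [] := fs_prec fX mf (MX _ Mg) fg.
Qed.

End fully_symmetric.

(** * The Koethe dual *)

Section resonance.
Context {R : realType} {x : \bar R}.
Hypothesis x0 : (0 < x)%E.
Local Notation leb := (@leb R).
Local Notation I := (oint x).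
Local Notation star := (rearrangement leb I).
Implicit Types (f g : R -> R).

Let m1 : measurable_fun I (cst 1 : R -> R).
Proof. exact: measurable_cst. Qed.
Let p1 t : I t -> 0 <= (cst 1 : R -> R) t := fun=> ler01.

Lemma leb_weighted (A : set R) : measurable A -> leb A = weighted_measure (cst 1) A.
Proof.
by move=> mA; rewrite /weighted_measure; have := integral_cst leb mA 1%E; rewrite mul1e => <-.
Qed.

Lemma star_gt f s t : measurable_fun I f -> 0 <= s ->
  (s%:E < star f t)%E = (t%:E < leb (I `&` [set t | (s < `|f t|)%R]))%E.
Proof.
move=> mf s0; rewrite rearrangement_leb// (rearrangement_gt (@measurable_oint R x) m1 p1)//.
by rewrite -distribution_leb.
Qed.

Lemma star_excess f l t : measurable_fun I f -> 0 <= l -> 0 <= t ->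
  (\int[leb]_(s in oint t%:E) star f s <=
   \int[leb]_(t in I) (Num.max (`|f t| - l) 0)%:E + (l * t)%:E)%E.
Proof.
move=> mf l0 t0; rewrite rearrangement_leb//.
have t0' : (0 <= t%:E)%E by rewrite lee_fin.
apply: (le_trans (integral_rearrangement_le (@measurable_oint R x) m1 p1 mf l0 t0')).
rewrite EFinM leeD2r// le_eqVlt; apply/orP; left; apply/eqP.
by apply: eq_integral => s _; rewrite mulr1.
Qed.

(** Functions between 0 and 1 of integral at most [tau] stand in for sets of measure [tau]. The
    bound [t] comes from [phi <= 1], the bound [tau] from the excess over level 0. *)
Lemma bounded_star_le (phi : R -> R) (tau t : R) : measurable_fun I phi ->
  (forall s, 0 <= phi s <= 1) -> (\int[leb]_(s in I) (phi s)%:E <= tau%:E)%E -> 0 < t ->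
  (\int[leb]_(s in oint t%:E) star phi s <= (Num.min t tau)%:E)%E.
Proof.
move=> mphi phi01 phitau t0.
rewrite EFin_min le_min; apply/andP; split.
  apply: (@le_trans _ _ (\int[leb]_(s in oint t%:E) cst 1%E s)%E).
    apply: ge0_le_integral => //.
    - by move=> s _; exact: rearrangement_ge0.
    - exact: measurable_rearrangement.
    - move=> s [s0 _]; rewrite leNgt star_gt// (_ : _ `&` _ = set0).
        by rewrite measure0 lte_fin -leNgt ltW.
      apply/seteqP; split => // r [_ /=]; have /andP[r0 r1] := phi01 r.
      by rewrite ger0_norm// ltNge r1.
  by rewrite /cst integral_oint_cst ?mul1e// lee_fin ltW.
apply: (le_trans (star_excess mphi (lexx 0) (ltW t0))).
rewrite mul0r adde0; apply: le_trans phitau.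
rewrite le_eqVlt; apply/orP; left; apply/eqP; apply: eq_integral => s _.
have /andP[s0 s1] := phi01 s.
by rewrite subr0 ger0_norm// max_l.
Qed.

(** [phi] is 1 on [S] and a constant [th] on a further piece of the superlevel set, where each unit
    of mass gains at least [l]. The fractional value replaces the choice of a subset of prescribed
    measure. *)
Lemma resonance_aux f (S : set R) (l tau : R) : measurable_fun I f -> 0 <= l ->
  measurable S -> S `<=` I `&` [set t | l < `|f t|] -> (leb S <= tau%:E)%E ->
  (tau%:E < leb (I `&` [set t | (l < `|f t|)%R]))%E ->
  exists phi : R -> R, [/\ measurable_fun setT phi, forall t, 0 <= phi t <= 1,
    (\int[leb]_(t in I) (phi t)%:E <= tau%:E)%E &
    (\int[leb]_(t in S) `|f t|%:E + (l * (tau - fine (leb S)))%:E <=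
     \int[leb]_(t in I) (phi t * `|f t|)%:E)%E].
Proof.
move=> mf l0 mS SB Stau tauB; set B := I `&` _ in SB tauB.
have mB : measurable B by exact: measurable_superlevel.
have Sfin : leb S \is a fin_num by rewrite ge0_fin_numE// (le_lt_trans Stau)// ltry.
have SE := fineK Sfin; set s := fine (leb S) in SE *.
have st : s <= tau by rewrite -lee_fin SE.
pose C := B `\` S; have mC : measurable C by exact: measurableD.
have mI := @measurable_oint R x.
have CI : C `<=` I by move=> t [[]].
have BSC : (leb B = leb S + leb C)%E.
  rewrite -measureU//; first by rewrite /C setDUK.
  by apply/seteqP; split => // t [St []].
have tauC : ((tau - s)%:E < leb C)%E.
  by move: tauB; rewrite BSC -SE EFinB lteBlDl.
(* [C] may have infinite measure; a bounded part of measure above [tau - s] makes the ratio [th] at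
   most 1 and meaningful. *)
pose F (n : nat) := C `&` oint n%:R%:E.
have ndF : {homo F : n m / (n <= m)%N >-> (n <= m)%O}.
  move=> n m nm; apply/subsetPset => t [Ct nt]; split => //.
  by apply: sub_oint nt; rewrite lee_fin ler_nat.
have mF n : measurable (F n) by exact: measurableI.
have FI n : F n `<=` I by move=> t [/CI].
have FC : \bigcup_n F n = C.
  apply/seteqP; split => [t [n _ []]//|t Ct]; exists (Num.truncn t).+1 => //; split => //.
  by split; [case: (CI _ Ct)|rewrite lte_fin truncnS_gt].
have [n Fn] : exists n, ((tau - s)%:E < leb (F n))%E.
  have := @weighted_measure_bigcup_gt R I (cst 1) mI m1 p1 F (tau - s)%:E ndF mF FI.
  rewrite FC -leb_weighted// => /(_ tauC)[n h]; exists n.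
  by rewrite leb_weighted.
have Ffin : leb (F n) \is a fin_num.
  rewrite ge0_fin_numE//; apply: (@le_lt_trans _ _ (leb (oint n%:R%:E : set R))).
    by apply: le_measure; [rewrite inE; exact: mF|rewrite inE; exact: measurable_oint|exact: subIsetr].
  by rewrite lebesgue_measure_oint ?ltry// lee_fin.
have FE := fineK Ffin; set c := fine (leb (F n)) in FE.
have tsc : tau - s < c by rewrite -lte_fin FE.
have ts0 : 0 <= tau - s by rewrite subr_ge0.
have c0 : 0 < c by exact: le_lt_trans tsc.
pose th := (tau - s) / c.
have th0 : 0 <= th by rewrite divr_ge0// ltW.
have th1 : th <= 1 by rewrite ler_pdivrMr// mul1r ltW.
have thc : th * c = tau - s by rewrite divfK// gt_eqF.
pose phi t := \1_S t + th * \1_(F n) t.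
have SF t : S t -> ~ F n t by move=> St [[]].
have mphi : measurable_fun setT phi.
  apply: measurable_funD; first exact: measurable_indic.
  by apply: measurable_funM; [exact: measurable_cst|exact: measurable_indic].
have SI : S `<=` I by move=> t /SB[].
have mfE (A : set R) : measurable A -> A `<=` I -> measurable_fun A (fun t => `|f t|%:E).
  by move=> mA AI; apply/measurable_EFinP; apply: measurableT_comp => //; exact: measurable_funS mf.
exists phi; split; first exact: mphi.
- move=> t; rewrite /phi !indicE; case: (boolP (t \in S)) => [/set_mem St|_].
    by rewrite memNset ?mulr0 ?addr0 ?ler01 ?lexx//; exact: SF.
  by rewrite add0r; case: (_ \in _); rewrite ?mulr1 ?mulr0 ?lexx ?th0 ?th1 ?ler01.
- have mi (A : set R) : measurable A -> measurable_fun I (fun t => (\1_A t)%:E : \bar R).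
    by move=> mA; apply/measurable_EFinP; exact: measurable_indic.
  rewrite /phi; under eq_integral do rewrite EFinD EFinM.
  rewrite ge0_integralD//; last 3 first.
  + exact: (mi _ mS).
  + by move=> t _; rewrite mule_ge0// lee_fin.
  + by apply: emeasurable_funM; [exact: measurable_cst|exact: (mi _ (mF n))].
  rewrite ge0_integralZl//; last exact: (mi _ (mF n)).
  have E (A : set R) : measurable A -> A `<=` I -> (\int[leb]_(t in I) (\1_A t)%:E = leb A)%E.
    by move=> mA AI; rewrite integral_indic// setIidl.
  by rewrite !E// -SE -FE -EFinM thc -EFinD lee_fin addrCA subrr addr0.
- apply: (@le_trans _ _ (\int[leb]_(t in S) `|f t|%:E + \int[leb]_(t in F n) (phi t * `|f t|)%:E)%E).
    apply: leeD => //; rewrite -thc mulrCA mulrA EFinM.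
    have <- : (\int[leb]_(t in F n) cst (th * l)%:E t = (th * l)%:E * c%:E)%E.
      by rewrite FE; exact: (integral_cst leb (mF n)).
    apply: ge0_le_integral; [exact: mF| |exact: measurable_cst| |].
    + by move=> t _; rewrite lee_fin mulr_ge0.
    + apply/measurable_EFinP; apply: measurable_funM; first exact: measurable_funTS.
      by apply: measurableT_comp => //; exact: measurable_funS mf.
    + move=> t Ft; have NS : ~ S t by move=> /SF.
      rewrite lee_fin /phi !indicE (mem_set Ft) (memNset NS).
      rewrite add0r mulr1 ler_wpM2l//; case: (Ft) => -[[_ /= ?] _] _; exact: ltW.
  have -> : (\int[leb]_(t in S) `|f t|%:E = \int[leb]_(t in S) (phi t * `|f t|)%:E)%E.
    apply: eq_integral => t /set_mem St; rewrite /phi !indicE (mem_set St) (memNset (SF _ St)).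
    by rewrite mulr0 addr0 mul1r.
  have mpf (A : set R) : measurable A -> A `<=` I -> measurable_fun A (fun t => (phi t * `|f t|)%:E).
    move=> mA AI; apply/measurable_EFinP; apply: measurable_funM; first exact: measurable_funTS.
    by apply: measurableT_comp => //; exact: measurable_funS mf.
  have phi0 t : 0 <= phi t by rewrite addr_ge0// mulr_ge0.
  rewrite -(ge0_integral_setU leb mS (mF n)).
  + apply: ge0_subset_integral; [exact: (measurableU _ _ mS (mF n))|exact: mI|exact: mpf| |].
    * by move=> t _; rewrite lee_fin mulr_ge0.
    * by move=> t [/SI|/FI].
  + by apply: mpf; [exact: (measurableU _ _ mS (mF n))|move=> t [/SI|/FI]].
  + by move=> t _; rewrite lee_fin mulr_ge0.
  + by apply/disj_setPS => t [/SF].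
Qed.

(** Everything above the level [f^*(tau)] is taken, and the mass left is filled slightly below that
    level. The strict [X] is essential: when [|f|] increases to a limit at infinity, the supremum is
    not attained. *)
Lemma resonance f (tau X : R) : measurable_fun I f -> 0 < tau ->
  (X%:E < \int[leb]_(s in oint tau%:E) star f s)%E ->
  exists phi : R -> R, [/\ measurable_fun setT phi, forall t, 0 <= phi t <= 1,
    (\int[leb]_(t in I) (phi t)%:E <= tau%:E)%E &
    (X%:E <= \int[leb]_(t in I) (phi t * `|f t|)%:E)%E].
Proof.
move=> mf tau0 XK.
case Es : (star f tau) => [l| |]; last by have := @rearrangement_ge0 _ leb I f tau; rewrite Es.
- have l0 : 0 <= l by rewrite -lee_fin -Es; exact: rearrangement_ge0.
  pose S := I `&` [set t | l < `|f t|].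
  have mS : measurable S by exact: measurable_superlevel.
  have Stau : (leb S <= tau%:E)%E by rewrite leNgt -star_gt// Es ltxx.
  set e := (\int[leb]_(t in I) (Num.max (`|f t| - l) 0)%:E)%E.
  have Xe : (X%:E < e + (l * tau)%:E)%E by apply: lt_le_trans XK (star_excess mf l0 (ltW tau0)).
  have e0 : (0 <= e)%E by apply: integral_ge0 => t _; rewrite lee_fin le_max lexx orbT.
  have eS : (e + l%:E * leb S = \int[leb]_(t in S) `|f t|%:E)%E.
    have -> : e = (\int[leb]_(t in S) (`|f t| - l)%:E)%E.
      rewrite /S integral_mkcondr; apply: eq_integral => t _; rewrite /patch.
      case: ifPn => [/set_mem /= lt|]; first by rewrite max_l// subr_ge0 ltW.
      by rewrite notin_setE/= => /negP; rewrite -leNgt => fl; rewrite max_r// subr_le0.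
    have <- : (\int[leb]_(t in S) cst l%:E t = l%:E * leb S)%E by exact: (integral_cst leb mS).
    rewrite -ge0_integralD//.
    + by apply: eq_integral => t _; rewrite -EFinD subrK.
    + by move=> t [_ /= lt]; rewrite lee_fin subr_ge0 ltW.
    + apply/measurable_EFinP; apply: measurable_funB => //; apply: measurableT_comp => //.
      by apply: measurable_funS mf => // t [].
  (* For [l = 0] the set [S] carries all of [f] and its indicator suffices. Otherwise a level
     [l' < l] is chosen with [X <= e + l' * tau]; its superlevel set has measure above [tau]. *)
  move: l0; rewrite le_eqVlt => /predU1P[l0|l0].
    exists (\1_S); split.
    + exact: measurable_indic.
    + by move=> t; rewrite indicE; case: (_ \in _); rewrite ?lexx ?ler01.
    + by rewrite integral_indic// setIidl//; exact: subIsetl.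
    + apply: (@le_trans _ _ (\int[leb]_(t in S) `|f t|%:E)%E).
        by rewrite -eS -l0 mul0e adde0; move: Xe; rewrite -l0 mul0r adde0 => /ltW.
      rewrite /S [leLHS]integral_mkcondr le_eqVlt; apply/orP; left; apply/eqP.
      apply: eq_integral => t /set_mem It; rewrite /patch indicE.
      case: ifPn => [/set_mem h|/negP h]; first by rewrite mem_set ?mul1r//.
      by rewrite memNset ?mul0r// => -[_ h']; apply: h; rewrite mem_set.
  have [l' [l'0 l'l Xl']] : exists l', [/\ 0 <= l', l' < l & (X%:E <= e + (l' * tau)%:E)%E].
    case: e e0 Xe {eS} => [e||]//; last by exists 0; rewrite lexx l0 addye// leey.
    rewrite lee_fin -EFinD lte_fin => e0 Xe; exists (Num.max 0 ((X - e) / tau)).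
    rewrite le_max lexx gt_max l0 ltr_pdivrMr// ltrBlDl Xe; split => //.
    rewrite -EFinD lee_fin -lerBlDl -ler_pdivrMr// le_max lexx orbT//.
  have [||phi [mphi phi01 itau h]] := resonance_aux mf l'0 mS _ Stau.
  - by move=> t [It /= lt]; split => //=; exact: lt_trans lt.
  - by rewrite -star_gt// Es lte_fin.
  exists phi; split => //; apply: le_trans h; rewrite -eS.
  have Sfin : leb S \is a fin_num by rewrite ge0_fin_numE// (le_lt_trans Stau)// ltry.
  rewrite -(fineK Sfin) -EFinM/= -addeA -EFinD; apply: (le_trans Xl').
  rewrite leeD2l// lee_fin mulrBr addrCA lerDl -mulrBl mulr_ge0// ?fine_ge0//.
  by rewrite subr_ge0 ltW.
(* Here [f^*(tau)] is infinite: [|f|] exceeds [X / tau] on a set of measure above [tau], so one may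
   start from the empty [S]. *)
- pose l := Num.max 0 (X / tau).
  have l0 : 0 <= l by rewrite le_max lexx.
  have [|||phi [mphi phi01 itau h]] := @resonance_aux f set0 l tau mf l0 measurable0.
  - by [].
  - by rewrite measure0 lee_fin ltW.
  - by rewrite -star_gt// Es ltry.
  exists phi; split => //; apply: le_trans h; rewrite integral_set0 add0e measure0/= subr0.
  by rewrite lee_fin -ler_pdivrMr// le_max lexx orbT.
Qed.

End resonance.

(** * Testing against decreasing functions on the original interval *)

Section resonant.
Context {R : realType} {x : \bar R}.
Hypothesis x0 : (0 < x)%E.
Local Notation leb := (@leb R).
Local Notation I := (oint x).
Local Notation star := (rearrangement leb I).
Implicit Types (f g k kap : R -> R).

Let m1 : measurable_fun I (cst 1 : R -> R).
Proof. exact: measurable_cst. Qed.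
Let p1 t : I t -> 0 <= (cst 1 : R -> R) t := fun=> ler01.

(** The integral of [kap * f^*] is nearly reached by integrals of [g |f|] with [g] dominated by
    [kap]. Comparing with the plain integral of [kap] makes the property stable under sums and
    positive multiples, hence accessible from indicators. *)
Definition resonant f kap := forall e : R, 0 < e -> exists g : R -> R,
  [/\ measurable_fun I g, forall t, 0 <= g t,
    forall t, I t -> (\int[leb]_(s in oint t%:E) star g s <= \int[leb]_(s in oint t%:E) (kap s)%:E)%E &
    (\int[leb]_(t in I) ((kap t)%:E * star f t) <= \int[leb]_(t in I) (g t * `|f t|)%:E + e%:E)%E].

Let mkstar f kap (A : set R) : measurable_fun I kap -> measurable A -> A `<=` I ->
  measurable_fun A (fun t => (kap t)%:E * star f t)%E.
Proof.
move=> mk mA AI; apply: emeasurable_funM; last exact: measurable_rearrangement.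
by apply/measurable_EFinP; exact: measurable_funS mk.
Qed.

Let mgf f g : measurable_fun I f -> measurable_fun I g ->
  measurable_fun I (fun t => (g t * `|f t|)%:E).
Proof.
move=> mf mg; apply/measurable_EFinP; apply: measurable_funM => //.
exact: measurableT_comp.
Qed.

Lemma star_leb1 f : measurable_fun I f ->
  star f = rearrangement (weighted_measure (cst 1)) I f.
Proof. exact: rearrangement_leb. Qed.

Lemma resonant0 f : measurable_fun I f -> resonant f (fun=> 0).
Proof.
move=> mf e e0; exists (fun=> 0); split.
- exact: measurable_cst.
- by [].
- move=> t It; rewrite integral0 le_eqVlt; apply/orP; left; apply/eqP.
  apply: integral0_eq => s [s0 _]; rewrite star_leb1; last exact: measurable_cst.
  by rewrite (rearrangement0 (@measurable_oint R x) m1 p1)// ltW.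
- under eq_integral do rewrite mul0e.
  rewrite integral0; apply: adde_ge0; last by rewrite lee_fin ltW.
  by apply: integral_ge0 => t _; rewrite mul0r.
Qed.

Lemma resonantD f kap kap' : measurable_fun I f -> measurable_fun I kap -> measurable_fun I kap' ->
  (forall t, 0 <= kap t) -> (forall t, 0 <= kap' t) ->
  resonant f kap -> resonant f kap' -> resonant f (fun t => kap t + kap' t).
Proof.
move=> mf mk mk' k0 k0' H H' e e0; have e20 : 0 < e / 2 by rewrite divr_gt0.
have [g [mg g0 Kg fg]] := H _ e20; have [g' [mg' g0' Kg' fg']] := H' _ e20.
have mI := @measurable_oint R x.
exists (fun t => g t + g' t); split.
- exact: measurable_funD.
- by move=> t; rewrite addr_ge0.
- move=> t It; have tI := sub_oint_mem It; have t0 : 0 < t by case: It.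
  apply: (@le_trans _ _ (\int[leb]_(s in oint t%:E) star g s + \int[leb]_(s in oint t%:E) star g' s)%E).
    rewrite (star_leb1 mg) (star_leb1 mg') star_leb1; last exact: measurable_funD.
    exact: (integral_rearrangementD mI m1 p1 mg mg' (ltW t0)).
  under [leRHS]eq_integral do rewrite EFinD.
  rewrite ge0_integralD//; [by apply: leeD; [exact: Kg|exact: Kg']| | | |].
  + by move=> s _; rewrite lee_fin.
  + by apply/measurable_EFinP; exact: measurable_funS mk.
  + by move=> s _; rewrite lee_fin.
  + by apply/measurable_EFinP; exact: measurable_funS mk'.
- have -> : (\int[leb]_(t in I) ((kap t + kap' t)%:E * star f t) =
     \int[leb]_(t in I) ((kap t)%:E * star f t) + \int[leb]_(t in I) ((kap' t)%:E * star f t))%E.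
    rewrite -ge0_integralD//; try exact: mkstar.
    + by apply: eq_integral => t _; rewrite EFinD ge0_muleDl// lee_fin.
    + by move=> t _; rewrite mule_ge0 ?lee_fin//; exact: rearrangement_ge0.
    + by move=> t _; rewrite mule_ge0 ?lee_fin//; exact: rearrangement_ge0.
  have -> : (\int[leb]_(t in I) ((g t + g' t) * `|f t|)%:E =
     \int[leb]_(t in I) (g t * `|f t|)%:E + \int[leb]_(t in I) (g' t * `|f t|)%:E)%E.
    rewrite -ge0_integralD//; try exact: mgf.
    + by apply: eq_integral => t _; rewrite mulrDl EFinD.
    + by move=> t _; rewrite lee_fin mulr_ge0.
    + by move=> t _; rewrite lee_fin mulr_ge0.
  have -> : e%:E = ((e / 2)%:E + (e / 2)%:E)%E by rewrite -EFinD -splitr.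
  rewrite [leRHS]addeACA; apply: leeD; [exact: fg|exact: fg'].
Qed.

Lemma resonantZ f kap c : measurable_fun I f -> measurable_fun I kap ->
  (forall t, 0 <= kap t) -> 0 < c -> resonant f kap -> resonant f (fun t => c * kap t).
Proof.
move=> mf mk k0 c0 H e e0; have ec0 : 0 < e / c by rewrite divr_gt0.
have [g [mg g0 Kg fg]] := H _ ec0; have mI := @measurable_oint R x.
have c0' : (0 <= c%:E)%E by rewrite lee_fin ltW.
exists (fun t => c * g t); split.
- exact: measurable_funM.
- by move=> t; rewrite mulr_ge0// ltW.
- move=> t It; have tI := sub_oint_mem It.
  under [leRHS]eq_integral do rewrite EFinM.
  rewrite ge0_integralZl//; [|by apply/measurable_EFinP; exact: measurable_funS mk
    |by move=> s _; rewrite lee_fin].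
  apply: (@le_trans _ _ (c%:E * \int[leb]_(s in oint t%:E) star g s)%E); last first.
    by apply: lee_wpmul2l => //; exact: Kg.
  rewrite -ge0_integralZl//; last 2 first.
  + exact: measurable_rearrangement.
  + by move=> s _; exact: rearrangement_ge0.
  apply: ge0_le_integral => //.
  + by move=> s _; exact: rearrangement_ge0.
  + exact: measurable_rearrangement.
  + by apply: emeasurable_funM; [exact: measurable_cst|exact: measurable_rearrangement].
  + move=> s [s0 _]; have mcg : measurable_fun I (fun t => c * g t) by exact: measurable_funM.
    rewrite (star_leb1 mg) (star_leb1 mcg).
    by have := rearrangementZ mI m1 p1 c mg (ltW s0); rewrite ger0_norm ?(ltW c0).
- under eq_integral do rewrite EFinM -muleA.
  rewrite ge0_integralZl//; [|exact: mkstar|]; last first.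
    by move=> t _; rewrite mule_ge0 ?lee_fin//; exact: rearrangement_ge0.
  under [X in (_ <= X + _)%E]eq_integral do rewrite -mulrA EFinM.
  rewrite ge0_integralZl//; [|exact: mgf|]; last by move=> t _; rewrite lee_fin mulr_ge0.
  have -> : e%:E = (c%:E * (e / c)%:E)%E by rewrite -EFinM mulrC divfK// gt_eqF.
  rewrite -ge0_muleDr; [exact: lee_wpmul2l| |by rewrite lee_fin ltW].
  by apply: integral_ge0 => t _; rewrite lee_fin mulr_ge0.
Qed.

Lemma integral_star_set_le f (A : set R) : measurable_fun I f ->
  (forall t, I t -> star f t \is a fin_num) -> measurable A -> A `<=` I ->
  (\int[leb]_(t in A) star f t <= \int[leb]_(t in oint (leb A)) star f t)%E.
Proof.
move=> mf ffin mA AI; have mI := @measurable_oint R x.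
have mv : measurable_fun I (fine \o star f).
  by apply: measurable_fine_comp; exact: measurable_rearrangement.
have := @integral_le_rearrangement _ _ _ mI m1 p1 (fine \o star f) A mA AI mv.
rewrite -leb_weighted// -(star_leb1 mv) (rearrangement_leb_idem x0 mf ffin).
apply: le_trans; rewrite le_eqVlt; apply/orP; left; apply/eqP.
apply: eq_integral => t /set_mem/AI It.
by rewrite mul1r/= ger0_norm ?fine_ge0 ?rearrangement_ge0// fineK// ffin.
Qed.

(** The function given by [resonance] for [tau = leb A] is dominated by the indicator thanks to
    [bounded_star_le]. [A] is described by downward closure because superlevel sets of a decreasing
    function may or may not contain their right endpoint. *)
Lemma resonant_indic f y (A : set R) : measurable_fun I f ->
  (forall t, I t -> star f t \is a fin_num) -> I y ->
  (\int[leb]_(t in oint y%:E) star f t < +oo)%E ->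
  measurable A -> A `<=` oint y%:E -> (forall s t, A t -> 0 < s -> s <= t -> A s) ->
  resonant f (\1_A).
Proof.
move=> mf ffin Iy fy mA Ay Ad e e0; have mI := @measurable_oint R x.
have yI := sub_oint_mem Iy; have y0 : 0 < y by case: Iy.
have AI : A `<=` I by move=> t /Ay/yI.
have leAy : (leb A <= y%:E)%E.
  rewrite -(@lebesgue_measure_oint R y%:E) ?lee_fin ?(ltW y0)//.
  by apply: le_measure; rewrite ?inE.
have Afin : leb A \is a fin_num by rewrite ge0_fin_numE// (le_lt_trans leAy)// ltry.
have AE := fineK Afin; set tau := fine (leb A) in AE.
have tauy : tau <= y by rewrite -lee_fin AE.
have tau0 : 0 <= tau by rewrite fine_ge0.
have IA : (\int[leb]_(t in I) ((\1_A t)%:E * star f t) = \int[leb]_(t in A) star f t)%E.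
  rewrite -[in RHS](setIidr AI) [RHS]integral_mkcondr; apply: eq_integral => t _.
  by rewrite /patch indicE; case: (t \in A); rewrite ?mul1e ?mul0e.
have fA := integral_star_set_le mf ffin mA AI.
move: tau0; rewrite le_eqVlt => /predU1P[tau0|tau0].
  have [g [mg g0 Kg fg]] := resonant0 mf e0.
  exists g; split => //.
    move=> t It; apply: (le_trans (Kg _ It)); rewrite integral0.
    by apply: integral_ge0 => s _; rewrite lee_fin.
  rewrite IA; apply: (le_trans fA); rewrite -AE -tau0 oint_EFin set_itvoo0 integral_set0.
  apply: adde_ge0; last by rewrite lee_fin ltW.
  by apply: integral_ge0 => s _; rewrite lee_fin mulr_ge0.
set K := (\int[leb]_(t in oint tau%:E) star f t)%E.
have Kfin : K \is a fin_num.
  rewrite ge0_fin_numE; last by apply: integral_ge0 => t _; exact: rearrangement_ge0.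
  apply: le_lt_trans fy; apply: le_integral_oint; rewrite ?lee_fin//.
    exact: measurable_rearrangement.
  by move=> t _; exact: rearrangement_ge0.
have [|phi [mphi phi01 itau h]] := @resonance R x f tau (fine K - e) mf tau0.
  by rewrite EFinB fineK// lteBlDr// lteDl// lte_fin.
have mphiI : measurable_fun I phi by exact: measurable_funTS.
exists phi; split => //.
- by move=> t; have /andP[] := phi01 t.
- move=> t It; case: (It) => t0 _.
  apply: (le_trans (bounded_star_le mphiI phi01 itau t0)).
  have -> : (\int[leb]_(s in oint t%:E) (\1_A s)%:E = leb (A `&` oint t%:E))%E.
    by rewrite (integral_indic leb (@measurable_oint R t%:E) mA).
  rewrite EFin_min ge_min.
  have [tA|/existsNP[s /not_implyP[ts As]]] := pselect (forall s, oint t%:E s -> A s).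
    by rewrite setIidr// lebesgue_measure_oint ?lexx// lee_fin ltW.
  rewrite AE setIidl ?lexx ?orbT// => r Ar.
  have [r0 _] := Ay _ Ar; split => //; case: ts => s0; apply: lt_trans.
  rewrite lte_fin ltNge; apply/negP => sr; apply: As; exact: Ad Ar s0 sr.
- rewrite IA; apply: (le_trans fA); rewrite -AE -/K -leeBlDr// -(fineK Kfin) -EFinB.
  exact: h.
Qed.

(* Staircase approximation of [k] from below by multiples of indicators of initial
   intervals. *)
Lemma integral_star_le f k (N : \bar R) : measurable_fun I f -> (0 <= N)%E ->
  (forall t, I t -> star f t \is a fin_num) ->
  (forall y, I y -> \int[leb]_(t in oint y%:E) star f t < +oo)%E ->
  (forall s t, I s -> I t -> s <= t -> k t <= k s) -> (forall t, I t -> 0 <= k t) ->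
  (forall g : R -> R, measurable_fun I g -> (forall t, 0 <= g t) ->
    (forall t, I t -> \int[leb]_(s in oint t%:E) star g s <= \int[leb]_(s in oint t%:E) (k s)%:E)%E ->
    (\int[leb]_(t in I) (g t * `|f t|)%:E <= N)%E) ->
  (\int[leb]_(t in I) ((k t)%:E * star f t) <= N)%E.
Proof.
move=> mf N0 ffin fK kd k0 H; have mI := @measurable_oint R x.
have mk : measurable_fun I k.
  apply/measurable_EFinP; apply: nonincreasing_on_emeasurable => s t Is It st.
  by rewrite lee_fin kd.
apply: integral_oint_le => //; first exact: mkstar.
  by move=> t It; rewrite mule_ge0 ?lee_fin ?k0//; exact: rearrangement_ge0.
move=> y Iy; have yI := sub_oint_mem Iy; have y0 : 0 < y by case: Iy.
(* With thresholds [(j + 1) * d], the staircase [S d m] stays below [k], and [k <= S d m + d]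
   wherever [k <= m * d]. *)
pose A (d : R) (j : nat) := oint y%:E `&` [set t | j.+1%:R * d < k t].
have mA d j : measurable (A d j).
  have := @emeasurable_fun_o_infty _ _ R (oint y%:E) (EFin \o k) (@measurable_oint R _) _ (j.+1%:R * d)%:E.
  by apply; apply/measurable_EFinP; exact: measurable_funS mk.
pose S d m t : R := \sum_(j < m) d * \1_(A d j) t.
have S0 d m t : 0 < d -> 0 <= S d m t by move=> d0; apply: sumr_ge0 => j _; rewrite mulr_ge0// ltW.
have mS d m : measurable_fun setT (S d m).
  by apply: measurable_sum => j; apply: measurable_funM; [exact: measurable_cst|exact: measurable_indic].
have SS d m t : S d m.+1 t = S d m t + d * \1_(A d m) t by rewrite /S big_ord_recr.
have rS d m : 0 < d -> resonant f (S d m).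
  move=> d0; elim: m => [|m IH].
    have -> : S d 0%N = fun=> 0 by apply/funext => t; rewrite /S big_ord0.
    exact: resonant0.
  have -> : S d m.+1 = (fun t => S d m t + d * \1_(A d m) t) by apply/funext => t; rewrite SS.
  apply: resonantD => //.
  - exact: measurable_funTS.
  - by apply: measurable_funTS; apply: measurable_funM; [exact: measurable_cst|exact: measurable_indic].
  - by move=> t; exact: S0.
  - by move=> t; rewrite mulr_ge0// ltW.
  apply: resonantZ => //.
  apply: (resonant_indic mf ffin Iy (fK _ Iy) (mA d m)); first exact: subIsetl.
  move=> s t [ty kt] s0 st; have sy : oint y%:E s.
    by split => //; case: ty => _; apply: le_lt_trans; rewrite lee_fin.
  by split => //=; apply: (lt_le_trans kt); apply: kd => //; exact: yI.
have AE d j t : oint y%:E t -> \1_(A d j) t = ((j.+1%:R * d < k t)%R : nat)%:R :> R.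
  move=> yt; rewrite indicE; case: (boolP (_ < k t)) => h; first by rewrite mem_set.
  by rewrite memNset// => -[_ /=]; exact/negP.
have Sfull d m t : 0 < d -> oint y%:E t -> m%:R * d < k t -> S d m t = m%:R * d.
  move=> d0 yt; elim: m => [|m IH] kt; first by rewrite /S big_ord0 mul0r.
  rewrite SS AE// kt mulr1 IH; first by rewrite -natr1; lra.
  by apply: le_lt_trans kt; rewrite ler_wpM2r ?ler_nat// ltW.
have Sk d m t : 0 < d -> I t -> S d m t <= k t.
  move=> d0 It; have [yt|nyt] := pselect (oint y%:E t); last first.
    rewrite /S big1 ?k0// => j _; rewrite indicE memNset ?mulr0//.
    by move=> [].
  elim: m => [|m IH]; first by rewrite /S big_ord0 k0.
  have [kt|kt] := ltP (m.+1%:R * d) (k t); first by rewrite Sfull// ltW.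
  by rewrite SS AE// ltNge kt mulr0 addr0.
have kS d m t : 0 < d -> oint y%:E t -> k t <= m%:R * d -> k t <= S d m t + d.
  move=> d0 yt; elim: m => [|m IH] kt.
    by rewrite mul0r in kt; rewrite /S big_ord0 add0r (le_trans kt)// ltW.
  have [kt'|kt'] := ltP (m%:R * d) (k t).
    rewrite SS Sfull//; apply: (le_trans kt); rewrite -natr1 mulrDl mul1r.
    by rewrite -addrA lerD2l lerDr mulr_ge0// ltW.
  by apply: (le_trans (IH kt')); rewrite SS -addrA lerD2l lerDr mulr_ge0// ltW.
pose v := fine \o star f.
have vE t : I t -> star f t = (v t)%:E by move=> It; rewrite /v/= fineK// ffin.
have v0 t : 0 <= v t by rewrite fine_ge0// rearrangement_ge0.
have mv A' : measurable_fun A' v by apply: measurable_fine_comp; exact: measurable_rearrangement.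
pose rho t := k t * v t.
have my := @measurable_oint R y%:E.
have mrho : measurable_fun (oint y%:E) rho by apply: measurable_funM => //; exact: measurable_funS mk.
have rho0 t : oint y%:E t -> 0 <= rho t by move=> /yI It; rewrite mulr_ge0// k0.
have -> : (\int[leb]_(s in oint y%:E) ((k s)%:E * star f s) = weighted_measure rho (oint y%:E))%E.
  by apply: eq_integral => t /set_mem/yI It; rewrite vE// EFinM.
rewrite leNgt; apply/negP => Nrho.
(* [k] may be unbounded near 0. Taking [k * f^*] as a density, continuity from below reduces to the
   sets where [k <= n], on which staircases converge uniformly. *)
pose F (n : nat) := oint y%:E `&` [set t | k t <= n%:R].
have mF n : measurable (F n).
  have := @emeasurable_fun_infty_c _ _ R (oint y%:E) (EFin \o k) my _ n%:R%:E.
  by apply; apply/measurable_EFinP; exact: measurable_funS mk.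
have ndF : {homo F : n m / (n <= m)%N >-> (n <= m)%O}.
  move=> n m nm; apply/subsetPset => t [yt /= kt]; split => //=.
  by apply: (le_trans kt); rewrite ler_nat.
have Fy n : F n `<=` oint y%:E by exact: subIsetl.
have FE : \bigcup_n F n = oint y%:E.
  apply/seteqP; split => [t [n _ []]//|t yt]; exists (Num.truncn (k t)).+1 => //.
  by split => //=; rewrite ltW// truncnS_gt.
have [|n] := @weighted_measure_bigcup_gt R (oint y%:E) rho my mrho rho0 F N ndF mF Fy.
  by rewrite FE.
apply/negP; rewrite -leNgt.
apply/lee_addgt0Pr => e e0; have e20 : 0 < e / 2 by rewrite divr_gt0.
set K := (\int[leb]_(t in oint y%:E) star f t)%E.
have Kfin : K \is a fin_num.
  rewrite ge0_fin_numE; first exact: fK.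
  by apply: integral_ge0 => t _; exact: rearrangement_ge0.
have KE := fineK Kfin; set c := fine K in KE.
have c0 : 0 <= c by rewrite fine_ge0//; apply: integral_ge0 => t _; exact: rearrangement_ge0.
(* The mesh will be [d = (n + 1) / m]: [m] steps reach the height [n + 1], and the error, [d] times
   the integral [c] of [f^*], is at most [e / 2]. *)
have [m [m0 md]] : exists m : nat, (0 < m)%N /\ n.+1%:R / m%:R * c <= e / 2.
  exists (Num.truncn (n.+1%:R * c / (e / 2))).+1; split => //.
  by rewrite mulrAC ler_pdivrMr// [leRHS]mulrC -ler_pdivrMr// ltW// truncnS_gt.
pose d : R := n.+1%:R / m%:R.
have d0 : 0 < d by rewrite divr_gt0// ltr0n.
have md' : m%:R * d = n.+1%:R by rewrite mulrC divfK// pnatr_eq0 -lt0n.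
have [g [mg g0 Kg fg]] := rS d m d0 _ e20.
have Ng : (\int[leb]_(t in I) (g t * `|f t|)%:E <= N)%E.
  apply: H => // t It; apply: (le_trans (Kg _ It)); have tI := sub_oint_mem It.
  apply: ge0_le_integral => //.
  - by move=> s _; rewrite lee_fin S0.
  - by apply/measurable_EFinP; apply: measurable_funTS; exact: mS.
  - by apply/measurable_EFinP; exact: measurable_funS mk.
  - by move=> s /tI Is; rewrite lee_fin Sk.
have mSv : measurable_fun (oint y%:E) (fun t => (S d m t * v t)%:E).
  by apply/measurable_EFinP; apply: measurable_funM => //; exact: measurable_funTS.
have mdv : measurable_fun (oint y%:E) (fun t => (d * v t)%:E).
  by apply/measurable_EFinP; apply: measurable_funM => //; exact: measurable_cst.
apply: (@le_trans _ _ (\int[leb]_(t in oint y%:E) ((S d m t * v t)%:E + (d * v t)%:E))%E).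
  apply: (@le_trans _ _ (\int[leb]_(t in F n) ((S d m t * v t)%:E + (d * v t)%:E))%E).
    apply: ge0_le_integral.
    - exact: mF.
    - by move=> t /Fy yt; rewrite lee_fin rho0.
    - by apply/measurable_EFinP; apply: measurable_funS mrho.
    - by apply: emeasurable_funD; [apply: measurable_funS mSv|apply: measurable_funS mdv].
    - move=> t [yt /= kt]; rewrite -EFinD lee_fin -mulrDl ler_wpM2r// kS//.
      by rewrite md' (le_trans kt)// ler_nat.
  apply: ge0_subset_integral; [exact: mF|exact: my| | |exact: Fy].
  - exact: emeasurable_funD.
  - by move=> t _; rewrite -EFinD lee_fin addr_ge0// mulr_ge0// ?S0// ltW.
rewrite ge0_integralD//; last 2 first.
- by move=> t _; rewrite lee_fin mulr_ge0// S0.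
- by move=> t _; rewrite lee_fin mulr_ge0// ltW.
have -> : e%:E = ((e / 2)%:E + (e / 2)%:E)%E by rewrite -EFinD -splitr.
rewrite [leRHS]addeA; apply: leeD.
  apply: le_trans (leeD Ng (lexx (e / 2)%:E)); apply: le_trans fg.
  have -> : (\int[leb]_(t in oint y%:E) (S d m t * v t)%:E = 
    \int[leb]_(t in oint y%:E) ((S d m t)%:E * star f t))%E.
    by apply: eq_integral => t /set_mem/yI It; rewrite vE// EFinM.
  apply: ge0_subset_integral => //.
  - by apply: mkstar => //; exact: measurable_funTS.
  - by move=> t _; rewrite mule_ge0 ?lee_fin ?S0//; exact: rearrangement_ge0.
have -> : (\int[leb]_(t in oint y%:E) (d * v t)%:E = d%:E * K)%E.
  under eq_integral do rewrite EFinM.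
  rewrite ge0_integralZl//; last 3 first.
  - by apply/measurable_EFinP; exact: mv.
  - by move=> t _; rewrite lee_fin.
  - by rewrite lee_fin ltW.
  by congr (_ * _)%E; apply: eq_integral => t /set_mem/yI It; rewrite vE.
by rewrite -KE -EFinM lee_fin.
Qed.

End resonant.

(** * The two inequalities between dual norms *)

Section duality.
Context {R : realType} {a : \bar R} {w : R -> R} {E : gauged_class R}.
Local Notation leb := (@leb R).
Local Notation I := (oint a).
Local Notation b := (total_mass a w).
Local Notation J := (oint b).
Local Notation mu := (weighted_measure w).
Local Notation wstar := (rearrangement mu I).
Local Notation star := (rearrangement leb I).
Local Notation starJ := (rearrangement leb J).
Local Notation Q := (Q_space a w E).
Hypotheses (a0 : (0 < a)%E) (dw : decreasing_weight a w)
  (fE : fully_symmetric_space J E) (sE : has_support J E).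
Implicit Types (f g h u v : R -> R).

Let mw : measurable_fun I w := measurable_weight dw.
Let w0 : forall t, I t -> 0 <= w t := weight_ge0 dw.
Let b0 : (0 < b)%E := total_gt0 a0 dw.
Let mI := @measurable_oint R a.
Let mJ := @measurable_oint R b.
Let m1 : measurable_fun J (cst 1 : R -> R).
Proof. exact: measurable_cst. Qed.
Let p1 t : J t -> 0 <= (cst 1 : R -> R) t := fun=> ler01.
Let m1I : measurable_fun I (cst 1 : R -> R).
Proof. exact: measurable_cst. Qed.
Let p1I t : I t -> 0 <= (cst 1 : R -> R) t := fun=> ler01.

(* A decreasing function [h^*] on [J] is transported to [I] by [W]: the measure [w dm]
   of an initial interval cut at height [c] of [W] is the minimum of the two. *)
Lemma integral_comp_primitive h (x : \bar R) : measurable_fun J h ->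
  (forall s, J s -> starJ h s \is a fin_num) -> (0 <= x)%E -> (x <= a)%E ->
  (\int[leb]_(t in oint x) (fine (starJ h (fine (primitive w t))) * w t)%:E =
   \int[leb]_(s in oint (mu (oint x))) starJ h s)%E.
Proof.
move=> mh hfin x0 xa; have xI : oint x `<=` I by exact: sub_oint.
have JW t : I t -> J (fine (primitive w t)).
  move=> It; split; last by rewrite fineK ?(primitive_fin dw)// (primitive_le_total dw).
  by rewrite -lte_fin fineK ?(primitive_fin dw)// (primitive_gt0 dw).
pose H t := starJ h (fine (primitive w t)).
have mH : measurable_fun I H.
  apply: nonincreasing_on_emeasurable => s t Is It; rewrite le_eqVlt => /predU1P[->//|st].
  apply: rearrangement_noninc; rewrite -lee_fin !fineK ?(primitive_fin dw)// ltW//.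
  by apply: (primitive_lt dw) => //; case: Is => /ltW.
have -> : (\int[leb]_(t in oint x) (fine (starJ h (fine (primitive w t))) * w t)%:E =
    \int[leb]_(t in oint x) ((w t)%:E * H t))%E.
  apply: eq_integral => t /set_mem/xI It; rewrite mulrC EFinM fineK//.
  exact: hfin (JW _ It).
have mx := @measurable_oint R x.
have mwx : measurable_fun (oint x) (EFin \o w).
  by apply/measurable_EFinP; exact: measurable_funS mw.
rewrite (@layer_cake _ (oint x) (EFin \o w) H mx mwx); last 3 first.
- exact: measurable_funS mH.
- by move=> t /xI It; rewrite lee_fin w0.
- by move=> t _; exact: rearrangement_ge0.
have mux : (0 <= mu (oint x))%E by apply: (weighted_measure_ge0 w0).
rewrite (rearrangement_leb mJ mh) (integral_rearrangement mJ m1 p1 mh mux).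
apply: eq_integral => s /set_mem [s0 _].
rewrite -(weighted_measure_sublevel dw xa); last exact: (distribution_ge0 p1).
congr (weighted_measure _ _); apply/seteqP; split => t [xt /= h']; split => //=.
  move: h'; rewrite /H (rearrangement_leb mJ mh) (rearrangement_gt mJ m1 p1 _ mh (ltW s0)).
  by rewrite fineK// (primitive_fin dw (xI _ xt)).
rewrite /H (rearrangement_leb mJ mh) (rearrangement_gt mJ m1 p1 _ mh (ltW s0)).
by rewrite fineK// (primitive_fin dw (xI _ xt)).
Qed.

(** The Hardy-Littlewood inequality alternates with Hardy's lemma: after each passage to
    rearrangements, for [m] and then for [w dm], Hardy's lemma replaces [g^*] by [u * w],
    respectively [u^{*,w}] by [|h|], as these are compared only through integrals. *)
Lemma Q_unit_pairing_le f u h : measurable_fun I f ->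
  (forall t, I t -> star f t \is a fin_num) ->
  (forall s, J s -> wstar (fine \o star f) s \is a fin_num) ->
  forall g, measurable_fun I g -> Q_bound (a := a) (w := w) (E := E) g u h ->
  (\int[leb]_(t in I) `|f t * g t|%:E <=
   \int[leb]_(t in J) `|(fine \o wstar (fine \o star f)) t * h t|%:E)%E.
Proof.
move=> mf ffin Vfin g mg [mu_ u0 ud gu [Eh uh]].
pose v := fine \o star f.
have mv A : measurable_fun A v by apply: measurable_fine_comp; exact: measurable_rearrangement.
have v0 t : 0 <= v t by rewrite fine_ge0// rearrangement_ge0.
have muw : measurable_fun I (fun t => (u t * w t)%:E).
  by apply/measurable_EFinP; exact: measurable_funM.
have mh : measurable_fun J h by exact: (E_L0 fE).
have sfE : star f = rearrangement (weighted_measure (cst 1)) I f by exact: rearrangement_leb.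
have sgE : star g = rearrangement (weighted_measure (cst 1)) I g by exact: rearrangement_leb.
have step1 : (\int[leb]_(t in I) `|f t * g t|%:E <= \int[leb]_(t in I) (star g t * star f t))%E.
  have := hardy_littlewood mI m1I p1I mf mg.
  rewrite (weighted_measure1 (ltW a0)) sfE sgE.
  by under eq_integral do rewrite mul1r.
have step2 : (\int[leb]_(t in I) (star g t * star f t) <=
    \int[leb]_(t in I) ((u t * w t)%:E * star f t))%E.
  rewrite sfE; apply: (hardy_le mI m1I p1I mf (ltW a0)) => //.
  - exact: measurable_rearrangement.
  - by move=> t _; exact: rearrangement_ge0.
  - by move=> t It; rewrite lee_fin mulr_ge0 ?u0 ?w0.
have step3 : (\int[leb]_(t in I) ((u t * w t)%:E * star f t) <=
    \int[leb]_(t in J) (wstar u t * wstar v t))%E.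
  have := hardy_littlewood mI mw w0 (mv I) mu_.
  apply: le_trans; rewrite le_eqVlt; apply/orP; left; apply/eqP.
  apply: eq_integral => t /set_mem It; rewrite -(fineK (ffin _ It)) -EFinM.
  rewrite ger0_norm ?mulr_ge0 ?u0//; congr (_%:E).
  by rewrite [u t * w t]mulrC -mulrA [u t * _]mulrC.
have step4 : (\int[leb]_(t in J) (wstar u t * wstar v t) <=
    \int[leb]_(t in J) (`|h t|%:E * wstar v t))%E.
  apply: (hardy_le mI mw w0 (mv I) (ltW b0)) => //.
  - exact: measurable_rearrangement.
  - by move=> t _; exact: rearrangement_ge0.
  - by apply/measurable_EFinP; exact: measurableT_comp.
apply: (le_trans step1); apply: (le_trans step2); apply: (le_trans step3); apply: (le_trans step4).
rewrite le_eqVlt; apply/orP; left; apply/eqP; apply: eq_integral => t /set_mem Jt.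
rewrite -(fineK (Vfin _ Jt)) -EFinM normrM [`|fine _|]ger0_norm; first by rewrite mulrC.
by rewrite fine_ge0// rearrangement_ge0.
Qed.

Lemma kothe_Q_le f : measurable_fun I f ->
  (forall t, I t -> star f t \is a fin_num) ->
  (forall s, J s -> wstar (fine \o star f) s \is a fin_num) ->
  (kothe_sup I Q f <= kothe_sup J E (fine \o wstar (fine \o star f)))%E.
Proof.
move=> mf ffin Vfin; set V := fine \o _; set L := kothe_sup J E V.
have VL h : gset E h -> gauge E h <= 1 -> (\int[leb]_(t in J) `|V t * h t|%:E <= L)%E.
  by move=> Eh h1; apply: ereal_sup_ubound; exists h.
have mV : measurable_fun J V by apply: measurable_fine_comp; exact: measurable_rearrangement.
have L0 : (0 <= L)%E.
  have [E0 g0] := E_zero' fE.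
  apply: le_trans (VL _ E0 _); first by apply: integral_ge0 => t _; rewrite lee_fin.
  by rewrite g0.
apply: ge_ereal_sup => _ [g [Qg g1] <-].
have mg : measurable_fun I g by exact: (Q_L0 Qg).
(* The infimum in the gauge need not be attained, so norm at most 1 yields pairs with [h] of norm
   below any [c > 1]; [h] is rescaled by [c^-1]. *)
have key c : 1 < c -> (\int[leb]_(t in I) `|f t * g t|%:E <= c%:E * L)%E.
  move=> c1; have [u [h [Bu h0 hc]]] := Q_elim dw Qg (le_lt_trans g1 c1).
  apply: (le_trans (Q_unit_pairing_le mf ffin Vfin mg Bu)).
  have Eh : gset E h by case: Bu => _ _ _ _ [].
  have c0 : 0 < c by exact: lt_trans c1.
  have [Ech gch] := E_scale fE c^-1 Eh.
  have := VL _ Ech; rewrite gch ger0_norm ?invr_ge0 ?(ltW c0)// mulrC ler_pdivrMr// mul1r.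
  move=> /(_ (ltW hc)) H; apply: le_trans (lee_wpmul2l _ H); last by rewrite lee_fin ltW.
  rewrite -ge0_integralZl//; last 2 first.
  - apply/measurable_EFinP; apply: measurableT_comp => //; apply: measurable_funM => //.
    exact: (E_L0 fE Ech).
  - by rewrite lee_fin ltW.
  rewrite le_eqVlt; apply/orP; left; apply/eqP; apply: eq_integral => t _.
  rewrite -[`|V t * _|%:E]/((`|V t * (c^-1 * h t)|)%:E) mulrCA [`|c^-1 * _|]normrM.
  rewrite (@ger0_norm _ c^-1) ?invr_ge0 ?(ltW c0)// -EFinM mulrA divff ?mul1r//.
  by rewrite gt_eqF.
case: L L0 key {VL} => [L||]// L0 key; last by rewrite leey.
rewrite -[L]mulr1; apply: lee_forall_gt_mul; first by rewrite -lee_fin.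
by move=> c /key; rewrite -EFinM mulrC.
Qed.

Lemma Q_gauge_le1 g u h : measurable_fun I g -> Q_bound (a := a) (w := w) (E := E) g u h ->
  gauge E h <= 1 -> gset Q g /\ gauge Q g <= 1.
Proof.
move=> mg Bg h1; have [Qg gg] := Q_intro dw fE sE mg Bg.
by split; [exact: Qg|exact: le_trans gg h1].
Qed.

(** With [u] the function [h^*] composed with [W], the product [k = u * w] is decreasing and every
    [g] dominated by [k] lies in the unit ball of [Q]. Such [g] nearly reach the integral of
    [k * f^*]. *)
Lemma kothe_Q_ge f : measurable_fun I f ->
  (forall t, I t -> star f t \is a fin_num) ->
  (forall y, I y -> \int[leb]_(t in oint y%:E) star f t < +oo)%E ->
  (forall s, J s -> wstar (fine \o star f) s \is a fin_num) ->
  (kothe_sup J E (fine \o wstar (fine \o star f)) <= kothe_sup I Q f)%E.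
Proof.
move=> mf ffin fK Vfin; set V := fine \o _; set N := kothe_sup I Q f.
pose v := fine \o star f.
have mv A : measurable_fun A v by apply: measurable_fine_comp; exact: measurable_rearrangement.
have v0 t : 0 <= v t by rewrite fine_ge0// rearrangement_ge0.
have mV : measurable_fun J V by apply: measurable_fine_comp; exact: measurable_rearrangement.
have fN g : gset Q g -> gauge Q g <= 1 -> (\int[leb]_(t in I) `|f t * g t|%:E <= N)%E.
  by move=> Qg g1; apply: ereal_sup_ubound; exists g.
have N0 : (0 <= N)%E.
  have [Q0 g0] := Q_zero dw fE sE.
  apply: le_trans (fN _ Q0 (le_trans g0 ler01)).
  by apply: integral_ge0 => t _; rewrite lee_fin.
apply: ge_ereal_sup => _ [h [Eh h1] <-].
have mh : measurable_fun J h by exact: (E_L0 fE).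
have [hfin Eeta geta] := E_star b0 fE sE Eh.
set eta := fine \o starJ h in Eeta geta.
have eta1 : gauge E eta <= 1 by exact: le_trans geta h1.
pose u t := eta (fine (primitive w t)).
pose k t := u t * w t.
have WI s t : I s -> I t -> s <= t -> fine (primitive w s) <= fine (primitive w t).
  move=> Is It; rewrite le_eqVlt => /predU1P[->//|st].
  rewrite -lee_fin !fineK ?(primitive_fin dw)// ltW//.
  by apply: (primitive_lt dw) => //; case: Is => /ltW.
have JW t : I t -> J (fine (primitive w t)).
  move=> It; split; last by rewrite fineK ?(primitive_fin dw)// (primitive_le_total dw).
  by rewrite -lte_fin fineK ?(primitive_fin dw)// (primitive_gt0 dw).
have u0 t : 0 <= u t by rewrite fine_ge0// rearrangement_ge0.
have ud s t : I s -> I t -> s <= t -> u t <= u s.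
  move=> Is It st; apply: fine_le; [exact: hfin (JW _ It)|exact: hfin (JW _ Is)|].
  by apply: rearrangement_noninc; exact: WI.
have mu_ : measurable_fun I u.
  by apply/measurable_EFinP; apply: nonincreasing_on_emeasurable => s t Is It st; rewrite lee_fin ud.
have k0 t : I t -> 0 <= k t by move=> It; rewrite mulr_ge0 ?w0.
have kd s t : I s -> I t -> s <= t -> k t <= k s.
  by move=> Is It st; rewrite ler_pM ?w0 ?ud// (weight_noninc dw).
(* As [W] pushes [w dm] forward to Lebesgue measure, composing [h^*] with it preserves the
   distribution function. *)
have wu : wstar u = starJ h.
  rewrite (rearrangement_leb mJ mh); apply: eq_rearrangement => s s0.
  have dh0 := @distribution_ge0 _ J (cst 1) p1 h s.
  have dhb : (Defs.distribution (weighted_measure (cst 1%R)) J h s <= b)%E.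
    rewrite -[leRHS](weighted_measure1 (ltW b0)).
    by apply: (le_weighted_measure mJ m1 p1) => //; exact: measurable_superlevel.
  rewrite -[RHS](min_idPr dhb) -(weighted_measure_sublevel dw (lexx a) dh0).
  congr (weighted_measure _ _); apply/seteqP; split => t [It /= H']; split => //=.
    rewrite -(fineK (primitive_fin dw It)) -(rearrangement_gt mJ m1 p1 _ mh (ltW s0)).
    rewrite -(rearrangement_leb mJ mh) -(fineK (hfin _ (JW _ It))) lte_fin.
    by move: H'; rewrite ger0_norm.
  rewrite ger0_norm// -lte_fin /u /eta/= fineK; last exact: hfin (JW _ It).
  rewrite (rearrangement_leb mJ mh) (rearrangement_gt mJ m1 p1 _ mh (ltW s0)).
  by rewrite fineK// (primitive_fin dw).
have Bk g : (forall t, I t -> \int[leb]_(s in oint t%:E) star g s <=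
    \int[leb]_(s in oint t%:E) (k s)%:E)%E -> Q_bound (a := a) (w := w) (E := E) g u eta.
  move=> gk; split => //; split => // s Js; rewrite wu le_eqVlt; apply/orP; left; apply/eqP.
  apply: eq_integral => t /set_mem/(sub_oint_mem Js) Jt.
  by rewrite ger0_norm ?fine_ge0 ?rearrangement_ge0// fineK// hfin.
have kN : (\int[leb]_(t in I) ((k t)%:E * star f t) <= N)%E.
  apply: (integral_star_le a0) => // g mg g0 gk.
  have [Qg g1] := Q_gauge_le1 mg (Bk g gk) eta1.
  apply: le_trans (fN g Qg g1); rewrite le_eqVlt; apply/orP; left; apply/eqP.
  by apply: eq_integral => t _; rewrite normrM [`|g t|]ger0_norm// mulrC.
apply: le_trans kN.
have VE : starJ V = wstar v.
  exact: (rearrangement_idem mI mw w0 (mv I) Vfin).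
have step1 : (\int[leb]_(t in J) `|V t * h t|%:E <= \int[leb]_(t in J) (starJ h t * wstar v t))%E.
  have := hardy_littlewood mJ m1 p1 mV mh.
  have hE := rearrangement_leb mJ mh; have VE' := rearrangement_leb mJ mV.
  rewrite (weighted_measure1 (ltW b0)) -VE hE VE'.
  by under eq_integral do rewrite mul1r.
apply: (le_trans step1).
have mk : measurable_fun I (EFin \o k).
  by apply: nonincreasing_on_emeasurable => s t Is It st; rewrite lee_fin kd.
(* Both integrals are sliced at the levels of [f^*]. A superlevel set is an initial interval of [I];
   its [w dm]-mass is the length of the corresponding interval of [J], and [integral_comp_primitive]
   identifies the two inner integrals. *)
rewrite (@layer_cake _ J (starJ h) (wstar v) mJ); last 4 first.
- exact: measurable_rearrangement.
- exact: measurable_rearrangement.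
- by move=> t _; exact: rearrangement_ge0.
- by move=> t _; exact: rearrangement_ge0.
rewrite (@layer_cake _ I (EFin \o k) (star f) mI mk); last 3 first.
- exact: measurable_rearrangement.
- by move=> t It; rewrite lee_fin k0.
- by move=> t _; exact: rearrangement_ge0.
rewrite le_eqVlt; apply/orP; left; apply/eqP; apply: eq_integral => s /set_mem [s0 _].
have sE1 : I `&` [set t | (s%:E < star f t)%E] =
    oint (Order.min a (Defs.distribution (weighted_measure (cst 1%R)) I f s)).
  by rewrite (rearrangement_leb mI mf) (superlevel_rearrangement mI m1I p1I)// ltW.
rewrite (superlevel_rearrangement mI mw w0 _ (mv I) (ltW s0)).
have dE : Defs.distribution mu I v s = mu (I `&` [set t | (s%:E < star f t)%E]).
  rewrite /Defs.distribution; congr (weighted_measure _ _).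
  apply/seteqP; split => t [It /= H']; split => //=.
    by rewrite -(fineK (ffin _ It)) lte_fin; move: H'; rewrite ger0_norm.
  by rewrite ger0_norm// -lte_fin /v/= fineK// ffin.
rewrite dE sE1 (min_idPr _); last first.
  apply: (le_weighted_measure mI mw w0); first exact: measurable_oint.
  - exact: mI.
  - by apply: sub_oint; rewrite ge_min lexx.
  - by [].
rewrite -(integral_comp_primitive mh hfin)//.
- by rewrite le_min (ltW a0) (distribution_ge0 p1I).
- by rewrite ge_min lexx.
Qed.

End duality.

(** * Finiteness of rearrangements and identification of the dual *)

Section duality.
Context {R : realType} {a : \bar R} {w : R -> R} {E : gauged_class R}.
Local Notation leb := (@leb R).
Local Notation I := (oint a).
Local Notation b := (total_mass a w).
Local Notation J := (oint b).
Local Notation mu := (weighted_measure w).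
Local Notation wstar := (rearrangement mu I).
Local Notation star := (rearrangement leb I).
Local Notation starJ := (rearrangement leb J).
Local Notation Q := (Q_space a w E).
Hypotheses (a0 : (0 < a)%E) (dw : decreasing_weight a w)
  (fE : fully_symmetric_space J E) (sE : has_support J E).
Implicit Types (f g h u v : R -> R).

Let mw : measurable_fun I w := measurable_weight dw.
Let w0 : forall t, I t -> 0 <= w t := weight_ge0 dw.
Let mI := @measurable_oint R a.

Lemma ae_fin_rearrangement (nu : set R -> \bar R) D f (x : \bar R) :
  ae_on (oint x) (fun t => rearrangement nu D f t \is a fin_num) ->
  forall t, oint x t -> rearrangement nu D f t \is a fin_num.
Proof.
move=> ae t xt; have [||s [s0 st] fs] := ae_on_exists (@measurable_oint R t%:E) _ _ ae.
- by case: xt => t0 _; rewrite lebesgue_measure_oint ?lte_fin// lee_fin ltW.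
- exact: sub_oint_mem xt.
- rewrite ge0_fin_numE ?rearrangement_ge0//.
  apply: le_lt_trans (rearrangement_noninc f (ltW st)) _.
  by rewrite -ge0_fin_numE ?rearrangement_ge0.
Qed.

(** At [s = W(t)] the value is at most [f^*(t)], since [f^*] exceeds [f^*(t)] only inside [(0, t)],
    a set of mass [s]. *)
Lemma wstar_star_fin f : measurable_fun I f ->
  (forall t, I t -> star f t \is a fin_num) ->
  forall s, J s -> wstar (fine \o star f) s \is a fin_num.
Proof.
move=> mf ffin s Js; have [t It Wt] := primitive_surj dw Js.
have mv : measurable_fun I (fine \o star f).
  by apply: measurable_fine_comp; exact: measurable_rearrangement.
rewrite ge0_fin_numE ?rearrangement_ge0//.
suff h : (wstar (fine \o star f) s <= (fine (star f t))%:E)%E by rewrite (le_lt_trans h) ?ltry.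
rewrite leNgt (rearrangement_gt mI mw w0 _ mv) ?fine_ge0 ?rearrangement_ge0// -leNgt.
rewrite -Wt primitiveE; apply: (le_weighted_measure mI mw w0).
- exact: (measurable_superlevel mI).
- exact: measurable_oint.
- move=> r [Ir]; rewrite /= ger0_norm ?fine_ge0 ?rearrangement_ge0// => h.
  split; first by case: Ir.
  rewrite lte_fin ltNge; apply/negP => tr; move: h; apply/negP; rewrite -leNgt.
  by apply: fine_le; [exact: ffin|exact: ffin|exact: rearrangement_noninc].
- exact: sub_oint_mem.
Qed.

Lemma Q_of_bounded (phi : R -> R) t : I t -> measurable_fun I phi ->
  (forall s, 0 <= phi s <= 1) -> (\int[leb]_(s in I) (phi s)%:E <= t%:E)%E ->
  gset Q phi /\ gauge Q phi <= gauge Q (\1_(oint t%:E)).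
Proof.
move=> It mphi phi01 phit.
have tI := sub_oint_mem It.
apply: (Q_prec dw fE sE mphi (M_sub_Q (M_indic dw fE sE It))).
apply/precE => s Is; have [s0 sa] := Is.
apply: (le_trans (bounded_star_le mphi phi01 phit s0)).
have m1t : measurable_fun I (\1_(oint t%:E) : R -> R) by exact: measurable_indic.
apply: le_trans (integral_abs_oint_le m1t s0 (ltW sa)).
under eq_integral do rewrite ger0_norm ?indicE// -indicE.
rewrite (@integral_indic _ (measurableTypeR R) R leb _ _)//.
rewrite [X in (_ <= X)%E](_ : _ = leb (oint (Order.min s%:E t%:E)))%E; last first.
  by congr (leb _); rewrite setIC ointI.
by rewrite lebesgue_measure_oint -EFin_min// lee_fin le_min (ltW s0) ltW//; case: It.
Qed.

(** The comparison of norms presupposes finite integrals of [f^*], which must be extracted from the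
    dual norm. The test functions of [resonance] for a fixed [t] have uniformly bounded norm in [Q],
    as they are dominated by the indicator of [(0, t)]. *)
Lemma kothe_Q_integral_lty f t : measurable_fun I f -> (kothe_sup I Q f < +oo)%E -> I t ->
  (\int[leb]_(s in oint t%:E) star f s < +oo)%E.
Proof.
move=> mf Nfin It; have [t0 ta] := It.
(* Adding 1 makes the normalizing constant positive at once. *)
pose c := gauge Q (\1_(oint t%:E)) + 1.
have c0 : 0 < c.
  have := Q_gauge_ge0 fE (M_sub_Q (M_indic dw fE sE It)); rewrite -/c /c => ?.
  by rewrite ltr_wpDl.
have key r : 0 <= r -> (r%:E < \int[leb]_(s in oint t%:E) star f s)%E ->
    (r%:E <= c%:E * kothe_sup I Q f)%E.
  move=> r0 rK; have [phi [mphi phi01 phit phif]] := resonance mf t0 rK.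
  have mphiI : measurable_fun I phi by exact: measurable_funTS.
  have [Qphi gphi] := Q_of_bounded It mphiI phi01 phit.
  have [Qc _] := Q_scale_le dw fE sE c^-1 Qphi.
  have gc : gauge Q (fun t => c^-1 * phi t) <= 1.
    rewrite (Q_scale dw fE sE _ Qphi) ger0_norm ?invr_ge0 ?(ltW c0)//.
    rewrite mulrC ler_pdivrMr// mul1r; apply: (le_trans gphi).
    by rewrite /c lerDl.
  apply: (le_trans phif); rewrite -lee_pdivrMl//.
  have H : (\int[leb]_(t in I) `|f t * (c^-1 * phi t)|%:E <= kothe_sup I Q f)%E.
    by apply: ereal_sup_ubound; exists (fun t => c^-1 * phi t).
  apply: le_trans H.
  rewrite -ge0_integralZl//; last 3 first.
  - apply/measurable_EFinP; apply: measurable_funM => //; exact: measurableT_comp.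
  - by move=> s _; rewrite lee_fin mulr_ge0//; case/andP: (phi01 s).
  - by rewrite lee_fin invr_ge0 ltW.
  rewrite le_eqVlt; apply/orP; left; apply/eqP; apply: eq_integral => s _.
  have /andP[p0 _] := phi01 s.
  rewrite -EFinM normrM (@ger0_norm _ (c^-1 * phi s)) ?mulr_ge0 ?invr_ge0 ?(ltW c0)//.
  by rewrite mulrA mulrC.
have N0 : (0 <= kothe_sup I Q f)%E.
  have [Q0 g0] := Q_zero dw fE sE.
  apply: (@le_trans _ _ (\int[leb]_(t in I) `|f t * 0|%:E)%E).
    by apply: integral_ge0 => s _; rewrite lee_fin.
  by apply: ereal_sup_ubound; exists (fun=> 0) => //; split => //; exact: le_trans g0 ler01.
have := lee_lt_real (mule_ge0 _ N0) key; rewrite lee_fin (ltW c0) => /(_ isT) /le_lt_trans.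
by apply; rewrite lte_mul_pinfty// lee_fin ltW.
Qed.

(** Members of the dual of [Q] have finite integrals of [f^*], so both inequalities apply. In the
    reverse inclusion only finiteness of the rearrangements is at hand, and [kothe_Q_le] alone
    concludes. *)
Lemma kothe_dual_Q :
  isometrically_equal (kothe_dual I Q) (Lambda a w (kothe_dual J E)).
Proof.
pose V f := fine \o wstar (fine \o star f).
have mstar f A : measurable_fun A (fine \o star f).
  by apply: measurable_fine_comp; exact: measurable_rearrangement.
have mV f A : measurable_fun A (V f).
  by apply: measurable_fine_comp; exact: measurable_rearrangement.
have ffin f : measurable_fun I f ->
    (forall t, I t -> \int[leb]_(s in oint t%:E) star f s < +oo)%E ->
    forall t, I t -> star f t \is a fin_num.
  by move=> mf H t It; apply: rearrangement_fin (H _ It); case: It.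
have eqsup f : measurable_fun I f -> (kothe_sup I Q f < +oo)%E ->
    kothe_sup I Q f = kothe_sup J E (V f).
  move=> mf Nfin; have K t := kothe_Q_integral_lty mf Nfin (t := t).
  have sfin := ffin _ mf K; have wfin := wstar_star_fin mf sfin.
  apply/eqP; rewrite eq_le (kothe_Q_le a0 dw fE mf sfin wfin)/=.
  exact: (kothe_Q_ge a0 dw fE sE mf sfin K wfin).
split; last by move=> f [mf Nfin]; rewrite /= eqsup.
apply/seteqP; split => f.
  move=> [mf Nfin]; have K t := kothe_Q_integral_lty mf Nfin (t := t).
  have sfin := ffin _ mf K; have wfin := wstar_star_fin mf sfin.
  split; first exact: mf.
  split; first by apply: aeW.
  split; first exact: mstar.
  split; first by apply: aeW.
  split; first exact: mV.
  by rewrite -/(V f) -eqsup.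
move=> [mf [sae [_ [wae [_ VE]]]]]; split; first exact: mf.
have sfin := ae_fin_rearrangement sae; have wfin := ae_fin_rearrangement wae.
exact: le_lt_trans (kothe_Q_le a0 dw fE mf sfin wfin) VE.
Qed.

End duality.

(** * The embedding in L_1 + M_W *)

(** Slopes of chords decrease from [[x, y]] to [[z, t]]; cross-multiplication admits the degenerate
    case [z = t]. *)
Definition concave4 (R : realType) (V : R -> R) := forall x y z t,
  0 <= x -> x < y -> y <= z -> z <= t -> (V t - V z) * (y - x) <= (V y - V x) * (t - z).

(** * Greedy lowering of a step function below a concave curve *)

Section greedy.
Context {R : realType} (lam D : nat -> R) (V : R -> R) (al : R).
Hypotheses (lam0 : forall i, 0 <= lam i) (D0 : forall i, 0 <= D i)
  (lamS : forall i j, (i <= j)%N -> lam j <= lam i)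
  (V0 : 0 <= V 0) (Vnd : forall x y, 0 <= x -> x <= y -> V x <= V y) (Vc : concave4 V)
  (al0 : 0 <= al).

Definition greedy_pos n := \sum_(j < n) D j.
Definition greedy_sum n := \sum_(j < n) lam j * D j.
(** The running maximum of the positive parts of [F - V]: the least nondecreasing loss keeping
    [F - L] below [V] at all nodes, as in Skorokhod's reflection. *)
Fixpoint greedy_loss n := if n is m.+1
  then Num.max (greedy_loss m) (greedy_sum n - V (greedy_pos n)) else 0.
Definition greedy_gain n := greedy_sum n - greedy_loss n.
Definition greedy_slope i := (greedy_gain i.+1 - greedy_gain i) / D i.

Local Notation X := greedy_pos.
Local Notation F := greedy_sum.
Local Notation L := greedy_loss.
Local Notation G := greedy_gain.
Local Notation mu := greedy_slope.
Hypothesis FV : forall n, F n <= al + V (X n).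

Lemma greedy_posS n : X n.+1 = X n + D n. Proof. by rewrite /X big_ord_recr. Qed.
Lemma greedy_sumS n : F n.+1 = F n + lam n * D n. Proof. by rewrite /F big_ord_recr. Qed.
Lemma greedy_pos0 : X 0 = 0. Proof. by rewrite /X big_ord0. Qed.
Lemma greedy_sum0 : F 0 = 0. Proof. by rewrite /F big_ord0. Qed.

Lemma greedy_pos_ge0 n : 0 <= X n. Proof. exact: sumr_ge0. Qed.

Lemma greedy_pos_le m n : (m <= n)%N -> X m <= X n.
Proof.
move=> /subnK <-; elim: (n - m)%N => // k IH; rewrite addSn greedy_posS.
by apply: (le_trans IH); rewrite lerDl.
Qed.

Lemma greedy_lossS n : L n.+1 = Num.max (L n) (F n.+1 - V (X n.+1)). Proof. by []. Qed.

Lemma greedy_loss_ndS n : L n <= L n.+1.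
Proof. by rewrite greedy_lossS le_max lexx. Qed.

Lemma greedy_loss_ge n : F n - V (X n) <= L n.
Proof.
case: n => [|n]; last by rewrite greedy_lossS le_max lexx orbT.
by rewrite greedy_sum0 greedy_pos0 /= sub0r oppr_le0.
Qed.

Lemma greedy_loss_le n : L n <= al.
Proof.
elim: n => [//|n IH]; rewrite greedy_lossS ge_max IH/=.
by have := FV n.+1; lra.
Qed.

Lemma greedy_gain_le n : G n <= V (X n).
Proof. by have := greedy_loss_ge n; rewrite /G; lra. Qed.

Lemma greedy_gain_ndS n : G n <= G n.+1.
Proof.
rewrite /G greedy_lossS greedy_sumS.
have h : 0 <= lam n * D n by rewrite mulr_ge0.
have VS : V (X n) <= V (X n.+1).
  by apply: Vnd; [exact: greedy_pos_ge0|exact: greedy_pos_le].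
have := greedy_loss_ge n.
by case: (leP (L n)) => _; lra.
Qed.

(** For [D i = 0] the slope is 0 by the convention on division; the identity persists because
    neither position, sum nor loss changes. *)
Lemma greedy_slopeD i : mu i * D i = G i.+1 - G i.
Proof.
have [D_0|Dn0] := eqVneq (D i) 0; last by rewrite /mu divfK.
have XS : X i.+1 = X i by rewrite greedy_posS D_0 addr0.
have FS : F i.+1 = F i by rewrite greedy_sumS D_0 mulr0 addr0.
rewrite D_0 mulr0 /G greedy_lossS XS FS max_l ?subrr//.
exact: greedy_loss_ge.
Qed.

Lemma greedy_slope_ge0 i : 0 <= mu i.
Proof. by rewrite divr_ge0// subr_ge0 greedy_gain_ndS. Qed.

Lemma greedy_slope_le i : mu i <= lam i.
Proof.
have [D_0|Dn0] := eqVneq (D i) 0; first by rewrite /mu D_0 invr0 mulr0.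
have Dp : 0 < D i by rewrite lt_neqAle eq_sym Dn0 D0.
rewrite -(ler_pM2r Dp) greedy_slopeD /G greedy_sumS.
by have := greedy_loss_ndS i; lra.
Qed.

Lemma greedy_sum_slope n : \sum_(j < n) mu j * D j = G n.
Proof.
elim: n => [|n IH]; first by rewrite big_ord0 /G greedy_sum0 subr0.
by rewrite big_ord_recr/= IH greedy_slopeD addrC subrK.
Qed.

Lemma greedy_sum_loss n : \sum_(j < n) (lam j - mu j) * D j <= al.
Proof.
apply: le_trans (greedy_loss_le n).
under eq_bigr do rewrite mulrBl.
by rewrite sumrB greedy_sum_slope -/(F n) /G; lra.
Qed.

(* If the slope increased from [k] to [j], then [k] was a contact point [G = V], and the
   levels from [k] to [j] exceed the slope of [V] there, so that contact persists until [j]: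
   the slope at [j] is then one of [V], hence not larger by concavity. *)
Lemma greedy_slope_noninc k j : (k < j)%N -> 0 < D k -> mu j <= mu k.
Proof.
move=> kj Dk; have [D_0|Dn0] := eqVneq (D j) 0.
  by rewrite {1}/mu D_0 invr0 mulr0 greedy_slope_ge0.
have Dj : 0 < D j by rewrite lt_neqAle eq_sym Dn0 D0.
rewrite leNgt; apply/negP => mukj.
have lamk i : (i <= j)%N -> mu k < lam i.
  by move=> ij; apply: lt_le_trans mukj _; apply: le_trans (greedy_slope_le j) (lamS ij).
have contact : L k.+1 = F k.+1 - V (X k.+1).
  move: (greedy_slopeD k); rewrite /G greedy_lossS greedy_sumS; case: (leP (L k)) => // _.
  have : mu k * D k < lam k * D k by rewrite ltr_pM2r ?lamk// ltnW.
  lra.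
have slopeV i : (k < i)%N -> V (X i.+1) - V (X i) <= mu k * D i.
  move=> ki; rewrite -(ler_pM2r Dk).
  have := Vc (greedy_pos_ge0 k) (_ : X k < X k.+1) (greedy_pos_le ki) (greedy_pos_le (leqnSn i)).
  rewrite !greedy_posS ltrDl ![_ + D _ - _]addrAC !subrr !add0r => /(_ Dk) h.
  apply: (le_trans h); rewrite mulrAC ler_wpM2r//.
  have := greedy_slopeD k; have := greedy_gain_le k.
  rewrite [G k.+1]/G contact greedy_posS; lra.
have contactS i : (k < i)%N -> (i <= j)%N -> L i = F i - V (X i).
  move=> ki; rewrite -(subnK ki); elim: (i - k.+1)%N => [//|n IH] nj.
  rewrite addSn in nj *; rewrite greedy_lossS max_r// IH ?(ltnW nj)//.
  have := slopeV (n + k.+1)%N; rewrite greedy_sumS addnS ltnS leq_addl => /(_ isT).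
  have : mu k * D (n + k).+1 <= lam (n + k).+1 * D (n + k).+1.
    by rewrite ler_wpM2r// ltW// lamk//; rewrite addnS in nj; exact: ltnW.
  rewrite addnS in nj *; lra.
have := contactS j kj (leqnn j).
have LSj : L j.+1 = F j.+1 - V (X j.+1).
  rewrite greedy_lossS max_r// contactS//.
  have := slopeV j kj; rewrite greedy_sumS.
  have : mu k * D j <= lam j * D j by rewrite ler_wpM2r// ltW// lamk.
  lra.
have := slopeV j kj; have := greedy_slopeD j; rewrite /G LSj => ? ? Lj.
have : mu k * D j < mu j * D j by rewrite ltr_pM2r.
lra.
Qed.

(** This bounds the integral of the lowered step function up to [x] by an excess over [m]. When [x]
    lies between two nodes, [m] is the slope there and the left side is at most the height at [x] of
    the chord joining the gains at these nodes; both gains are below [V], hence so is the chord, by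
    concavity. When all nodes are before [x], [m = 0]. *)
Lemma greedy_majorant x : 0 < x -> exists2 m, 0 <= m &
  forall n, \sum_(j < n) Num.max (mu j - m) 0 * D j + m * x <= V x.
Proof.
move=> x0; have [H|/existsNP[i0 /negP]] := pselect (forall i, X i < x).
  exists 0 => // n; rewrite mul0r addr0.
  under eq_bigr do rewrite subr0 max_l ?greedy_slope_ge0//.
  rewrite greedy_sum_slope; apply: (le_trans (greedy_gain_le n)).
  by apply: Vnd; [exact: greedy_pos_ge0|exact: ltW].
rewrite -leNgt => xi0.
have [i xi imin] := @ex_minnP (fun i => x <= X i) (ex_intro _ i0 xi0).
case: i xi imin => [|i] xi imin; first by move: xi; rewrite greedy_pos0 leNgt x0.
have ix : X i < x by rewrite ltNge; apply/negP => /imin; rewrite ltnn.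
have Di : 0 < D i by move: (lt_le_trans ix xi); rewrite greedy_posS ltrDl.
exists (mu i); first exact: greedy_slope_ge0.
pose S n := \sum_(j < n) Num.max (mu j - mu i) 0 * D j.
have t0 j : 0 <= Num.max (mu j - mu i) 0 * D j by rewrite mulr_ge0// le_max lexx orbT.
have Sle n : S n <= S i.
  have [ni|/ltnW /subnK <-] := leqP n i.
    rewrite -(subnK ni); elim: (i - n)%N => // k IH; rewrite addSn /S big_ord_recr/=.
    by apply: (le_trans IH); rewrite lerDl.
  elim: (n - i)%N => // k IH; rewrite addSn /S big_ord_recr/= -/(S _).
  apply: le_trans IH; rewrite gerDl.
  have [->|k0] := eqVneq k 0%N; first by rewrite subrr maxxx mul0r.
  rewrite max_r ?mul0r// subr_le0; apply: greedy_slope_noninc => //.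
  by rewrite -[X in (X < _)%N]add0n ltn_add2r lt0n.
have SiE : S i = G i - mu i * X i.
  rewrite -greedy_sum_slope /X mulr_sumr -sumrB; apply: eq_bigr => j _.
  have [D_0|Dn0] := eqVneq (D j) 0; first by rewrite D_0 !mulr0 subr0.
  rewrite max_l ?mulrBl// subr_ge0; apply: greedy_slope_noninc => //.
  by rewrite lt_neqAle eq_sym Dn0 D0.
move=> n; apply: (@le_trans _ _ (S i + mu i * x)); first by rewrite lerD2r Sle.
rewrite SiE -addrA -mulrN -mulrDr addrC [_ + x]addrC.
have := Vc (greedy_pos_ge0 i) ix (lexx x) xi.
have := greedy_gain_le i; have := greedy_gain_le i.+1; have := greedy_slopeD i.
move: (V x) (V (X i)) (V (X i.+1)) (G i) (G i.+1) (mu i) => v vi vi1 g g1 m.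
rewrite greedy_posS; set p := x - X i => mD g1v gv.
have p0 : 0 < p by rewrite subr_gt0.
have r0 : 0 <= X i + D i - x by rewrite subr_ge0 -greedy_posS.
have -> : X i + D i - x = D i - p by rewrite /p; lra.
have r0' : 0 <= D i - p by rewrite /p; lra.
move=> h0; rewrite -(ler_pM2r Di).
have h1 : g1 * p <= vi1 * p by rewrite ler_pM2r.
have h2 : g * (D i - p) <= vi * (D i - p) by rewrite ler_wpM2r.
have h3 : m * D i * p = (g1 - g) * p by rewrite mD.
nra.
Qed.

End greedy.

Lemma nneseries_le (R : realType) (u : (\bar R)^nat) (c : \bar R) : (forall n, (0 <= u n)%E) ->
  (forall n, (\sum_(0 <= i < n) u i <= c)%E) -> (\sum_(0 <= i <oo) u i <= c)%E.
Proof.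
move=> u0 uc; apply: lime_le; first by apply: is_cvg_nneseries => n _ _; exact: u0.
by apply: nearW => n; exact: uc.
Qed.

Lemma integral_bigcup_le (R : realType) (A : nat -> set R) (g : R -> R) (c D : nat -> R) (C : R) :
  (forall i, measurable (A i)) -> trivIset setT A ->
  measurable_fun (\bigcup_i A i) g -> (forall t, (\bigcup_i A i) t -> 0 <= g t) ->
  (forall i t, A i t -> g t <= c i) -> (forall i, leb (A i) = (D i)%:E) ->
  (forall i, 0 <= c i) -> (forall n, \sum_(i < n) c i * D i <= C) ->
  (\int[leb]_(t in \bigcup_i A i) (g t)%:E <= C%:E)%E.
Proof.
move=> mA tA mg g0 gc AD c0 cC.
have mgA i : measurable_fun (A i) g.
  by apply: measurable_funS mg; [exact: bigcup_measurable|exact: bigcup_sup].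
rewrite (@ge0_integral_bigcup _ (measurableTypeR R) R leb A (EFin \o g) mA) //; last first.
  exact/measurable_EFinP.
have gA i t : A i t -> 0 <= g t by move=> At; apply: g0; exists i.
have int_le i : (\int[leb]_(t in A i) (g t)%:E <= (c i * D i)%:E)%E.
  rewrite EFinM -AD -(integral_cst leb (mA i) (c i)%:E).
  apply: ge0_le_integral => //.
  - exact: mA.
  - by move=> t /gA; rewrite lee_fin.
  - by apply/measurable_EFinP; exact: mgA.
  - by move=> t At; rewrite lee_fin; exact: gc At.
apply: nneseries_le => [i|n].
  by apply: integral_ge0 => t /gA; rewrite lee_fin.
rewrite big_mkord; apply: (@le_trans _ _ (\sum_(i < n) (c i * D i)%:E)%E).
  by apply: lee_sum => i _; exact: int_le.
by rewrite sumEFin lee_fin.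
Qed.

Lemma integral_support (R : realType) (D U : set R) (g : R -> \bar R) : U `<=` D ->
  (forall t, D t -> ~ U t -> g t = 0%E) ->
  (\int[leb]_(t in D) g t = \int[leb]_(t in U) g t)%E.
Proof.
move=> UD g0; rewrite -[U](setIidr UD) integral_mkcondr; apply: eq_integral => t /set_mem Dt.
by rewrite patchE; case: (boolP (t \in U)) => // /negP tU; rewrite g0// => /mem_set.
Qed.

Lemma integral_abs_le_star (R : realType) (a : \bar R) (f : R -> R) (A : set R) :
  measurable_fun (oint a) f -> measurable A -> A `<=` oint a ->
  (\int[leb]_(t in A) `|f t|%:E <=
   \int[leb]_(t in oint (leb A)) rearrangement leb (oint a) f t)%E.
Proof.
move=> mf mA AI; rewrite rearrangement_leb// leb_weighted//.
have := @integral_le_rearrangement _ _ _ (@measurable_oint R a) (measurable_cst (1:R))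
  (fun _ _ => ler01) f A mA AI mf.
by under eq_integral do rewrite /cst mul1r.
Qed.

Definition clip (R : realType) (c x : R) := Num.max (Num.min x c) (- c).

Lemma normr_clip (R : realType) (c x : R) : 0 <= c -> `|clip c x| = Num.min `|x| c.
Proof.
move=> c0; rewrite /clip; case: (lerP x c) => xc; last first.
  rewrite max_l ?(le_trans _ c0) ?oppr_le0//.
  by rewrite [`|x|]ger0_norm ?(le_trans c0 (ltW xc))// (min_idPr (ltW xc)) ger0_norm.
case: (lerP x (- c)) => xc'.
  have x0 : x <= 0 by lra.
  by rewrite normrN ger0_norm// ler0_norm// (min_idPr _)//; lra.
by rewrite (min_idPl _)// ler_norml xc ltW.
Qed.

Lemma normrB_clip (R : realType) (c x : R) : 0 <= c -> `|x - clip c x| = Num.max (`|x| - c) 0.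
Proof.
move=> c0; rewrite /clip; case: (lerP x c) => xc; last first.
  rewrite (@max_l _ _ c); last lra.
  rewrite [`|x|]ger0_norm; last lra.
  by rewrite ger0_norm ?subr_ge0 ?(ltW xc)// max_l// subr_ge0 ltW.
case: (lerP x (- c)) => xc'.
  rewrite (@ler0_norm _ x); last lra.
  rewrite opprK ler0_norm; last lra.
  by rewrite max_l; lra.
by rewrite subrr normr0 max_r// subr_le0 ler_norml xc ltW.
Qed.

Lemma measurable_clip (R : realType) (D : set R) (f : R -> R) c : measurable_fun D f ->
  measurable_fun D (fun t => clip c (f t)).
Proof. by move=> mf; apply: measurable_maxr => //; exact: measurable_minr. Qed.

(** * From step heights to clipping on level sets *)

Section step_decomposition.
Context {R : realType} {a : \bar R}.
Local Notation leb := (@leb R).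
Local Notation I := (oint a).
Local Notation star := (rearrangement leb I).
Context (f : R -> R) (A : nat -> set R) (lam D : nat -> R) (V : R -> R) (al q : R).
Hypotheses (a0 : (0 < a)%E) (mf : measurable_fun I f)
  (mA : forall i, measurable (A i)) (AI : forall i, A i `<=` I) (tA : trivIset setT A)
  (lam0 : forall i, 0 <= lam i) (lamS : forall i j, (i <= j)%N -> lam j <= lam i)
  (q1 : 1 <= q) (Alam : forall i t, A i t -> lam i <= `|f t| <= q * lam i)
  (AD : forall i, leb (A i) = (D i)%:E)
  (V0 : 0 <= V 0) (Vnd : forall x y, 0 <= x -> x <= y -> V x <= V y) (Vc : concave4 V)
  (al0 : 0 <= al)
  (fV : forall x, I x -> (\int[leb]_(t in oint x%:E) star f t <= (al + V x)%:E)%E).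

Local Notation U := (\bigcup_i A i).
Local Notation mu := (greedy_slope lam D V).

Let D0 i : 0 <= D i. Proof. by rewrite -lee_fin -AD measure_ge0. Qed.
Let mU : measurable U := bigcup_measurable (fun i _ => mA i).
Let UI : U `<=` I. Proof. by apply: bigcup_sub => i _; exact: AI. Qed.
Let q0 : 0 <= q. Proof. exact: le_trans q1. Qed.

Let greedy_sum_bound n : greedy_sum lam D n <= al + V (greedy_pos D n).
Proof.
pose B := \big[setU/set0]_(0 <= i < n) A i.
have mB : measurable B by apply: bigsetU_measurable => i _; exact: mA.
have BI : B `<=` I.
  by move=> t; rewrite /B big_mkord -bigcup_mkord => -[i _ At]; exact: AI At.
have BE : leb B = (greedy_pos D n)%:E.
  rewrite /B big_mkord measure_semi_additive_ord//; last by rewrite -(big_mkord xpredT A).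
    by rewrite /greedy_pos -sumEFin; apply: eq_bigr => i _; exact: AD.
  - by move=> k; exact: mA.
  - by move=> i j _ _ h; apply: val_inj; apply: tA.
rewrite -lee_fin.
apply: (@le_trans _ _ (\int[leb]_(t in B) `|f t|%:E)%E).
  rewrite /B (@ge0_integral_bigsetU _ (measurableTypeR R) R leb nat A (fun t => `|f t|%:E))//.
  - rewrite big_mkord /greedy_sum -sumEFin; apply: lee_sum => i _.
    rewrite EFinM -AD -(integral_cst leb (mA i) (lam i)%:E).
    apply: ge0_le_integral => //.
    + exact: mA.
    + by move=> t _; rewrite lee_fin.
    + by apply/measurable_EFinP; apply: measurableT_comp => //; exact: measurable_funS mf.
    + by move=> t /Alam/andP[+ _]; rewrite lee_fin.
  - exact: iota_uniq.
  - exact: sub_trivIset tA.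
  - by apply/measurable_EFinP; apply: measurableT_comp => //; exact: measurable_funS mf.
apply: (le_trans (integral_abs_le_star mf mB BI)); rewrite BE.
(* The bound [fV] holds at points of [I], and [greedy_pos D n] may equal [a]. *)
apply: integral_oint_le.
- exact: measurable_rearrangement.
- by move=> t _; exact: rearrangement_ge0.
- move=> t [t0 tX].
  have It : I t.
    split => //; apply: (lt_le_trans tX); rewrite -BE -(@lebesgue_measure_oint R a) ?(ltW a0)//.
    by apply: le_measure; rewrite ?inE//; exact: measurable_oint.
  apply: (le_trans (fV It)); rewrite lee_fin lerD2l; apply: Vnd; exact: ltW.
- rewrite lee_fin addr_ge0//; apply: le_trans V0 _; apply: Vnd => //.
  exact: greedy_pos_ge0.
Qed.

(** On [A i] the function is clipped at [q * mu i]. As [|f| <= q * lam i] there, at most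
    [q * (lam i - mu i)] is lost, and what remains is at most [q * mu i], to which [greedy_majorant]
    applies. The factor [q] pays for treating [|f|] as constant on [A i]. *)
Lemma step_decomposition : exists f2 : R -> R, [/\ measurable_fun I f2,
  forall t, ~ U t -> f2 t = 0,
  (\int[leb]_(t in U) `|f t - f2 t|%:E <= (q * al)%:E)%E &
  forall x, 0 < x -> (\int[leb]_(t in oint x%:E) star f2 t <= (q * V x)%:E)%E].
Proof.
have mu0 i : 0 <= mu i by exact: greedy_slope_ge0.
have qmu0 i : 0 <= q * mu i by exact: mulr_ge0 q0 (mu0 i).
have mul i : mu i <= lam i by exact: greedy_slope_le.
pose idx t := get [set i | A i t].
have idxE i t : A i t -> idx t = i.
  by move=> At; apply: tA => //; exists t; split => //; apply: (@getI _ [set i | A i t] i).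
pose f2 t := if t \in U then clip (q * mu (idx t)) (f t) else 0.
have f2E i t : A i t -> f2 t = clip (q * mu i) (f t).
  by move=> At; rewrite /f2 mem_set ?(idxE _ _ At)//; exists i.
have f20 t : ~ U t -> f2 t = 0 by move=> tU; rewrite /f2 memNset.
have mf2U : measurable_fun U f2.
  apply/measurable_fun_bigcup => // i.
  apply: (@eq_measurable_fun _ _ _ _ _ (fun t => clip (q * mu i) (f t))).
    by move=> t /set_mem At; rewrite (f2E _ _ At).
  by apply: measurable_clip; exact: measurable_funS mf.
have mf2 : measurable_fun I f2.
  rewrite -[I](setDUK UI); apply/measurable_funU => //.
    by apply: measurableD => //; exact: measurable_oint.
  split; first exact: mf2U.
  apply: (@eq_measurable_fun _ _ (measurableTypeR R) (measurableTypeR R) _ (cst 0)).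
    by move=> t /set_mem [_ tU]; rewrite f20.
  exact: measurable_cst.
exists f2; split => //.
- apply: (@integral_bigcup_le _ _ _ (fun i => q * (lam i - mu i)) D) => //.
  + apply: measurableT_comp => //; apply: measurable_funB => //; exact: measurable_funS mf.
  + move=> i t At; rewrite (f2E _ _ At) (normrB_clip _ (qmu0 i)).
    rewrite ge_max mulr_ge0 ?subr_ge0// andbT mulrBr lerD2r.
    by have /andP[] := Alam At.
  + by move=> i; rewrite mulr_ge0// subr_ge0.
  + move=> n; under eq_bigr do rewrite -mulrA.
    by rewrite -mulr_sumr ler_wpM2l//; exact: greedy_sum_loss.
- move=> x x0; have [m m0 hm] := greedy_majorant lam0 D0 lamS V0 Vnd Vc x0.
  apply: (le_trans (star_excess mf2 (mulr_ge0 q0 m0) (ltW x0))).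
  rewrite (@integral_support _ I U); [|exact: UI|]; last first.
    by move=> t _ /f20->; rewrite normr0 sub0r max_r// oppr_le0 mulr_ge0.
  have -> : (q * V x)%:E = ((q * (V x - m * x))%:E + (q * m * x)%:E)%E.
    by rewrite -EFinD -mulrA -mulrDr subrK.
  rewrite leeD2r//.
  apply: (@integral_bigcup_le _ _ _ (fun i => q * Num.max (mu i - m) 0) D) => //.
  + apply: measurable_maxr => //; apply: measurable_funB => //; exact: measurableT_comp.
  + by move=> t _; rewrite le_max lexx orbT.
  + move=> i t At; rewrite (f2E _ _ At) (normr_clip _ (qmu0 i)).
    rewrite ge_max mulr_ge0 ?le_max ?lexx ?orbT// andbT.
    apply: (@le_trans _ _ (q * mu i - q * m)); first by rewrite lerD2r ge_min lexx orbT.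
    by rewrite -mulrBr ler_wpM2l// le_max lexx.
  + by move=> i; rewrite mulr_ge0// le_max lexx orbT.
  + move=> n; under eq_bigr do rewrite -mulrA.
    by rewrite -mulr_sumr ler_wpM2l// lerBrDr.
Qed.

End step_decomposition.

Lemma measurable_ge_level (R : realType) (B : set R) (g : R -> R) (l : R) : measurable B ->
  measurable_fun B g -> measurable (B `&` [set t | l <= g t]).
Proof.
move=> mB mg; rewrite (_ : [set t | _] = g @^-1` `[l, +oo[); first exact: mg.
by apply/seteqP; split => t /=; rewrite in_itv/= andbT.
Qed.

Lemma measurable_lt_level (R : realType) (B : set R) (g : R -> R) (l : R) : measurable B ->
  measurable_fun B g -> measurable (B `&` [set t | g t < l]).
Proof.
move=> mB mg; rewrite (_ : [set t | _] = g @^-1` `]-oo, l[); first exact: mg.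
by apply/seteqP; split => t /=; rewrite in_itv.
Qed.

(** Dominated convergence: the sets [g >= n] decrease to the empty set. *)
Lemma integral_tail (R : realType) (B : set R) (g : R -> R) (e : R) : measurable B ->
  measurable_fun B g -> (forall t, 0 <= g t) -> (\int[leb]_(t in B) (g t)%:E < +oo)%E -> 0 < e ->
  exists n : nat, (\int[leb]_(t in B `&` [set t | (n%:R <= g t)%R]) (g t)%:E <= e%:E)%E.
Proof.
move=> mB mg g0 gfin e0; apply: contrapT => /forallNP H.
pose S n := [set t | n%:R <= g t].
pose u n t := ((EFin \o g) \_ (S n)) t.
have mS n : measurable (B `&` S n).
  exact: measurable_ge_level.
have mu n : measurable_fun B (u n).
  have mBS : measurable_fun (B `&` S n) (EFin \o g).
    by apply/measurable_EFinP; apply: measurable_funS mg.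
  have := (measurable_restrict (EFin \o g) (mS n) mB).1; rewrite setIA setIid => /(_ mBS) h.
  apply: (@eq_measurable_fun _ _ (measurableTypeR R) _ B ((EFin \o g) \_ (B `&` S n)) _ _ h).
  move=> t /set_mem Bt; rewrite /u !patchE; congr (if _ then _ else _).
  by apply/idP/idP => /set_mem; [case=> _|move=> ?]; move=> *; exact: mem_set.
have cvg0 : {ae leb, forall t, B t -> u ^~ t @ \oo --> (cst 0%E : R -> \bar R) t}.
  apply: aeW => t _; apply: cvg_near_cst; near=> n.
  rewrite /u patchE memNset// /S /= => h.
  have : g t < n%:R by near: n; exact: nbhs_infty_gtr.
  by rewrite ltNge h.
have [|||||_ _ +] := @dominated_convergence _ (measurableTypeR R) R leb B mB u (cst 0%E) (EFin \o g).
- exact: mu.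
- exact: measurable_cst.
- exact: cvg0.
- apply/integrableP; split; first exact/measurable_EFinP.
  by under eq_integral do rewrite /= ger0_norm//.
- apply: aeW => t n _; rewrite /u patchE; case: ifP => _ /=; first by rewrite ger0_norm.
  by rewrite normr0 lee_fin.
rewrite integral0 => h; have : (e%:E <= limn (fun n => \int[leb]_(t in B) u n t))%E.
  apply: lime_ge; first by apply/cvg_ex; exists 0%E.
  apply: nearW => n; rewrite /u -integral_mkcondr; apply: ltW.
  by rewrite ltNge; apply/negP; exact: H.
by rewrite (cvg_lim _ h)// lee_fin leNgt e0.
Unshelve. all: by end_near. Qed.

(** * Splitting a general function *)

Section decomposition.
Context {R : realType} {a : \bar R}.
Local Notation leb := (@leb R).
Local Notation I := (oint a).
Local Notation star := (rearrangement leb I).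
Hypothesis a0 : (0 < a)%E.
Implicit Types (f : R -> R) (V : R -> R) (al q e : R).

Let mI := @measurable_oint R a.

Let fin_level f x : measurable_fun I f -> I x ->
  (\int[leb]_(t in oint x%:E) star f t < +oo)%E -> exists2 N : R, 0 < N &
  (leb (I `&` [set t | (N < `|f t|)%R]) <= x%:E)%E.
Proof.
move=> mf [x0 xa] fin; have := rearrangement_fin x0 fin; set s := star f x => sfin.
have s0 : 0 <= fine s by rewrite fine_ge0// rearrangement_ge0.
exists (fine s + 1); first by lra.
rewrite leNgt; apply/negP; rewrite -star_gt//; last lra.
by rewrite -/s -(fineK sfin) lte_fin; lra.
Qed.

(** The levels are [N * q^-i]. The greedy procedure needs a highest level, so values above [N] go to
    the integrable part at cost [e]; finiteness of the measures of superlevel sets makes the widths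
    real numbers. *)
Lemma level_decomposition f V al q e : measurable_fun I f ->
  (forall l, 0 < l -> (leb (I `&` [set t | (l < `|f t|)%R]) < +oo)%E) ->
  0 <= V 0 -> (forall x y, 0 <= x -> x <= y -> V x <= V y) -> concave4 V -> 0 <= al ->
  (forall x, I x -> (\int[leb]_(t in oint x%:E) star f t <= (al + V x)%:E)%E) ->
  1 < q -> 0 < e ->
  exists f2 : R -> R, [/\ measurable_fun I f2,
    (\int[leb]_(t in I) `|f t - f2 t|%:E <= (q * al + e)%:E)%E &
    forall x, 0 < x -> (\int[leb]_(t in oint x%:E) star f2 t <= (q * V x)%:E)%E].
Proof.
move=> mf fd V0 Vnd Vc al0 fV q1 e0.
have mabs : measurable_fun I (fun t => `|f t|) by exact: measurableT_comp.
have mge l : measurable (I `&` [set t | l <= `|f t|]).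
  exact: measurable_ge_level.
have mlt l : measurable (I `&` [set t | `|f t| < l]).
  exact: measurable_lt_level.
have mgt l : measurable (I `&` [set t | l < `|f t|]).
  exact: (measurable_superlevel mI).
have [x Ix] := oint_neq0 a0.
have [N0 N00 dN0] := fin_level mf Ix (le_lt_trans (fV _ Ix) (ltry _)).
pose B := I `&` [set t | N0 < `|f t|].
have [n hn] : exists n : nat, (\int[leb]_(t in B `&` [set t | (n%:R <= `|f t|)%R]) `|f t|%:E <= e%:E)%E.
  apply: (@integral_tail _ B (fun t => `|f t|) e (mgt N0)) => //.
    by apply: measurable_funS mabs => //; exact: subIsetl.
  apply: (le_lt_trans (integral_abs_le_star mf (mgt N0) (@subIsetl _ _ _))).
  apply: (@le_lt_trans _ _ (\int[leb]_(t in oint x%:E) star f t)%E).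
    apply: le_integral_oint => //; first exact: measurable_rearrangement.
    by move=> r _; exact: rearrangement_ge0.
  by apply: le_lt_trans (fV _ Ix) _; exact: ltry.
have mBn : measurable (B `&` [set t | n%:R <= `|f t|]).
  apply: measurable_ge_level; first exact: mgt.
  by apply: measurable_funS mabs => //; exact: subIsetl.
(* A value of at least [N] passes both thresholds: [N0 + 1] places the point in [B], and [n] in the
   tail of integral at most [e]. *)
pose N : R := Num.max (N0 + 1) n%:R.
have N_gt0 : 0 < N by rewrite lt_max ltr_wpDr.
have q0 : 0 < q by lra.
pose p := q^-1; have p0 : 0 < p by rewrite invr_gt0.
have p1 : p < 1 by rewrite invf_lt1.
pose l i := N * p ^+ i.
have l0 i : 0 < l i by rewrite mulr_gt0// exprn_gt0.
have lS i : q * l i.+1 = l i.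
  by rewrite /l exprS mulrCA (mulrA q) mulfV ?mul1r// gt_eqF.
have lle i j : (i <= j)%N -> l j <= l i.
  move=> ij; rewrite ler_wpM2l ?(ltW N_gt0)//.
  by apply: ler_wiXn2l => //; exact: ltW.
pose A i := (I `&` [set t | l i.+1 <= `|f t|]) `&` (I `&` [set t | `|f t| < l i]).
have mA i : measurable (A i) by exact: measurableI.
have AI i : A i `<=` I by move=> t [[]].
have tA : trivIset setT A.
  have H i j t : (i < j)%N -> A i t -> A j t -> False.
    move=> ij [[_ /= h1] _] [_ [_ /= h2]]; move: (lt_le_trans h2 (lle _ _ ij)).
    by rewrite ltNge h1.
  move=> i j _ _ [t [Ai Aj]]; apply/eqP; case: ltngtP => // ij; first by case: (H _ _ _ ij Ai Aj).
  by case: (H _ _ _ ij Aj Ai).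
have Afin i : leb (A i) \is a fin_num.
  rewrite ge0_fin_numE//; have lh : 0 < l i.+1 / 2 by rewrite divr_gt0.
  apply: le_lt_trans (fd _ lh); apply: le_measure; rewrite ?inE; [exact: mA|exact: mgt|].
  move=> t [[It /= h] _]; split => //=; apply: lt_le_trans h.
  by rewrite ltr_pdivrMr// ltr_pMr// ltr1n.
have Alam i t : A i t -> l i.+1 <= `|f t| <= q * l i.+1.
  by move=> [[_ /= ->] [_ /= /ltW]]; rewrite lS.
have [f2 [mf2 f20 f2U f2V]] := @step_decomposition _ _ f A (fun i => l i.+1) (fun i => fine (leb (A i)))
  V al q a0 mf mA AI tA (fun i => ltW (l0 _)) (fun i j ij => lle _ _ (ij : (i < j.+1)%N)) (ltW q1)
  Alam (fun i => esym (fineK (Afin i))) V0 Vnd Vc al0 fV.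
exists f2; split => //.
set U := \bigcup_i A i in f20 f2U.
have UI : U `<=` I by apply: bigcup_sub => i _; exact: AI.
have mU : measurable U by exact: bigcup_measurable.
have mff2 : measurable_fun I (fun t => `|f t - f2 t|%:E).
  by apply/measurable_EFinP; apply: measurableT_comp => //; exact: measurable_funB.
rewrite -[I](setDUK UI) ge0_integral_setU//; last 3 first.
- exact: measurableD.
- by rewrite setDUK.
- by apply/disj_setPS => t [Ut []].
rewrite EFinD; apply: leeD => //.
rewrite (@integral_support _ _ ((I `\` U) `&` (B `&` [set t | (n%:R <= `|f t|)%R]))).
- apply: le_trans hn; rewrite [leLHS](_ : _ =
      \int[leb]_(t in (I `\` U) `&` (B `&` [set t | (n%:R <= `|f t|)%R])) `|f t|%:E)%E; last first.
    by apply: eq_integral => t /set_mem [[_ tU] _]; rewrite f20// subr0.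
  apply: ge0_subset_integral => //.
  + by apply: measurableI; [exact: measurableD|exact: mBn].
  + by apply/measurable_EFinP; apply: measurable_funS mabs => //; move=> t [[]].
- by move=> t [].
- move=> t [It tU] h; rewrite f20// subr0; apply/eqP; rewrite eqe normr_eq0.
  apply/negPn/negP => ft0.
  have ftN : `|f t| < N.
    rewrite ltNge; apply/negP; rewrite ge_max => /andP[h1 h2]; apply: h; split => //; split => //.
    by split => //=; apply: lt_le_trans h1; rewrite ltrDl.
  have ft : 0 < `|f t| by rewrite normr_gt0.
  have [k hk] : exists k, l k <= `|f t|.
    apply: contrapT => /forallNP H.
    have cv : (fun i => l i) @ \oo --> (0 : R).
      rewrite -[0](mulr0 N); apply: cvgM; first exact: cvg_cst.
      by apply: cvg_expr; rewrite ger0_norm// ltW.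
    have : `|f t| <= limn l.
      apply: limr_ge; first by apply/cvg_ex; exists 0.
      by apply: nearW => i; rewrite ltW// ltNge; apply/negP.
    by rewrite (cvg_lim _ cv)// leNgt ft.
  have [[|i] hi imin] := @ex_minnP (fun i => l i <= `|f t|) (ex_intro _ k hk).
    by move: hi; rewrite /l expr0 mulr1 leNgt ftN.
  apply: tU; exists i => //; split; split => //=.
  by rewrite ltNge; apply/negP => /imin; rewrite ltnn.
Qed.

(** A strict decrease from [x] to [y] would continue at least at the same slope and cross any lower
    bound. *)
Lemma concave4_bounded_nondecreasing V (c : R) : concave4 V -> (forall x, 0 < x -> c <= V x) ->
  forall x y, 0 <= x -> x <= y -> V x <= V y.
Proof.
move=> Vc cV x y x0; rewrite le_eqVlt => /predU1P[->//|xy].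
rewrite leNgt; apply/negP => yx.
have y0 : 0 < y by exact: le_lt_trans xy.
have h : 0 <= V y - c + 1 by have := cV _ y0; lra.
pose d := V x - V y; have d0 : 0 < d by rewrite subr_gt0.
(* At this distance the slope [- d / (y - x)] leads from [V y] down to [c - 1]. *)
pose t := y + (y - x) * ((V y - c + 1) / d).
have yt : y <= t by rewrite lerDl mulr_ge0 ?divr_ge0 ?(ltW d0)// subr_ge0 ltW.
have xy0 : 0 < y - x by rewrite subr_gt0.
have := Vc _ _ _ _ x0 xy (lexx y) yt.
have -> : (V y - V x) * (t - y) = (- (V y - c + 1)) * (y - x).
  rewrite /t [y + _]addrC addrK -opprB -/d mulNr mulNr; congr (- _).
  by rewrite mulrCA (mulrC d) divfK ?gt_eqF// mulrC.
rewrite ler_pM2r// => Vt.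
by have := cV _ (lt_le_trans y0 yt); lra.
Qed.

(* [ell] is the limit of [f^*] at infinity: cutting [f] at height [ell] leaves a function
   with superlevel sets of finite measure, and reduces [V] by the linear function [ell * x]. *)
Lemma excess_decomposition f V al q e : measurable_fun I f ->
  0 <= V 0 -> (forall x y, 0 <= x -> x <= y -> V x <= V y) -> concave4 V -> 0 <= al ->
  (forall x, I x -> (\int[leb]_(t in oint x%:E) star f t <= (al + V x)%:E)%E) ->
  1 < q -> 0 < e ->
  exists f2 : R -> R, [/\ measurable_fun I f2,
    (\int[leb]_(t in I) `|f t - f2 t|%:E <= (q * al + e)%:E)%E &
    forall x, 0 < x -> (\int[leb]_(t in oint x%:E) star f2 t <= (q * V x)%:E)%E].
Proof.
move=> mf V0 Vnd Vc al0 fV q1 e0.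
pose d (l : R) := leb (I `&` [set t | (l < `|f t|)%R]).
have d_noninc l m : l <= m -> (d m <= d l)%E.
  move=> lm; apply: le_measure; rewrite ?inE; try exact: (measurable_superlevel mI).
  by move=> t [It /= h]; split => //=; exact: le_lt_trans h.
pose S := [set l : R | 0 < l /\ (d l < +oo)%E].
have [x Ix] := oint_neq0 a0.
have [N N0 dN] := fin_level mf Ix (le_lt_trans (fV _ Ix) (ltry _)).
have SN : S N by split=> //; exact: le_lt_trans dN (ltry _).
have Slb : has_lbound S by exists 0 => l [/ltW].
pose ell : R := inf S.
have ell0 : 0 <= ell by apply: lb_le_inf; [exists N|move=> l [/ltW]].
pose f' t := f t - clip ell (f t).
have mf' : measurable_fun I f' by apply: measurable_funB => //; exact: measurable_clip.
have nf' t : `|f' t| = Num.max (`|f t| - ell) 0 by exact: normrB_clip.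
have f'd l : 0 < l -> (leb (I `&` [set t | (l < `|f' t|)%R]) < +oo)%E.
  move=> l0; have [|m Sm ml] := @inf_adherent _ S l l0; first by split; [exists N|].
  apply: le_lt_trans (Sm.2); apply: le_measure; rewrite ?inE; try exact: (measurable_superlevel mI).
  move=> t [It /= h]; split => //=; move: h; rewrite nf' lt_max [l < 0]ltNge (ltW l0) orbF.
  by move: ml; rewrite -/ell; lra.
(* Positive levels below [ell] have superlevel sets of infinite measure. *)
have star_ge t : I t -> 0 < ell -> (ell%:E <= star f t)%E.
  move=> It el0; apply: lee_lt_real; first exact: rearrangement_ge0.
  move=> r r0; rewrite lte_fin => rl; rewrite leNgt; apply/negP.
  case Es : (star f t) => [s| |] //; last first.
    by have := rearrangement_ge0 (mu := leb) (D := I) f t; rewrite Es.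
  have s0 : 0 <= s by rewrite -lee_fin -Es rearrangement_ge0.
  rewrite lte_fin => sr; have : (star f t <= s%:E)%E by rewrite Es.
  rewrite leNgt => /negP; apply.
  suff : ((r : R)%:E < star f t)%E by apply: lt_trans; rewrite lte_fin.
  rewrite star_gt// -/(d r) ltNge; apply/negP => dr.
  have : ell <= r by apply: ge_inf => //; split; [exact: le_lt_trans sr|exact: le_lt_trans dr (ltry _)].
  by rewrite leNgt rl.
(* With [l = f^*(t)], the excess of [f'] over [l - ell] is that of [f] over [l]; the excess bound
   thus falls by exactly [ell * t]. *)
have f'V t : I t -> (\int[leb]_(s in oint t%:E) star f' s <= (al + (V t - ell * t))%:E)%E.
  move=> It; have [t0 ta] := It.
  have := rearrangement_fin t0 (le_lt_trans (fV _ It) (ltry _)).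
  move=> /fineK; set l := fine _ => lE.
  have ellt : ell <= l.
    have [->|el] := eqVneq ell 0; first by rewrite fine_ge0// rearrangement_ge0.
    by rewrite -lee_fin lE star_ge// lt_neqAle eq_sym el.
  have l0 : 0 <= l - ell by rewrite subr_ge0.
  apply: (le_trans (star_excess mf' l0 (ltW t0))).
  have maxE s : Num.max (`|f' s| - (l - ell)) 0 = Num.max (`|f s| - l) 0.
    rewrite nf' addr_maxl sub0r -maxA (@max_r _ _ (- _)) ?oppr_le0//.
    by rewrite opprB addrA subrK.
  under eq_integral do rewrite maxE.
  have : (\int[leb]_(s in I) (Num.max (`|f s| - l) 0)%:E + l%:E * t%:E <= (al + V t)%:E)%E.
    apply: le_trans (fV _ It); rewrite rearrangement_leb// in lE *.
    have := @integral_rearrangement_eq _ _ _ mI (measurable_cst (1:R)) (fun _ _ => ler01)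
      f l t mf (ltW t0) (esym lE).
    by under eq_integral do rewrite /cst mulr1.
  set Y := (\int[_]_(_ in _) _)%E.
  have : (0 <= Y)%E by apply: integral_ge0 => s _; rewrite lee_fin le_max lexx orbT.
  case: Y => [y| |]// _.
  by rewrite -EFinM -!EFinD !lee_fin; lra.
have V'c : concave4 (fun t => V t - ell * t).
  move=> x1 x2 x3 x4 h1 h2 h3 h4; have := Vc _ _ _ _ h1 h2 h3 h4.
  by rewrite !mulrBl !mulrBr; lra.
have V'nd x1 x2 : 0 <= x1 -> x1 <= x2 -> V x1 - ell * x1 <= V x2 - ell * x2.
  have [->|el] := eqVneq ell 0; first by rewrite !mul0r !subr0; exact: Vnd.
  have el0 : 0 < ell by rewrite lt_neqAle eq_sym el.
  apply: (@concave4_bounded_nondecreasing (fun t => V t - ell * t) (- al)) => // y y0.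
  (* A positive [ell] forces [a = +oo]: on a bounded interval [ell / 2] would belong to [S]. The
     lower bound [- al] therefore holds on the whole half-line. *)
  have Iy : I y.
    split=> //; case Ea : a => [r| |]; rewrite ?ltry//; last by move: a0; rewrite Ea.
    suff : ell <= ell / 2 by move=> h; exfalso; lra.
    apply: ge_inf => //; split; first by lra.
    apply: (@le_lt_trans _ _ (leb I)).
      by apply: le_measure; rewrite ?inE; [exact: (measurable_superlevel mI)|exact: mI|move=> s []].
    by rewrite lebesgue_measure_oint ?(ltW a0)// Ea ltry.
  have : (0 <= (al + (V y - ell * y))%:E)%E.
    by apply: le_trans (f'V _ Iy); apply: integral_ge0 => s _; exact: rearrangement_ge0.
  by rewrite lee_fin; lra.
have V'0 : 0 <= V 0 - ell * 0 by rewrite mulr0 subr0.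
have [g [mg fg gV]] := level_decomposition mf' f'd V'0 V'nd V'c al0 f'V q1 e0.
have mcl : measurable_fun I (fun t => clip ell (f t)) by exact: measurable_clip.
(* The clipped part contributes at most [ell * y], which [q * V y] absorbs because [q > 1] and
   [ell * y] was subtracted from [V]. *)
exists (fun t => g t + clip ell (f t)); split.
- exact: measurable_funD.
- by under eq_integral do rewrite opprD addrA addrAC.
- move=> y y0; apply: (le_trans (starD mg mcl (ltW y0))).
  apply: (@le_trans _ _ ((q * (V y - ell * y))%:E + (ell * y)%:E)%E).
    apply: leeD; first exact: gV.
    apply: (le_trans (star_excess mcl ell0 (ltW y0))).
    rewrite integral0_eq ?add0e// => t _; congr (_%:E).
    by rewrite normr_clip// max_r// subr_le0 ge_min lexx orbT.
  rewrite -EFinD lee_fin mulrBr.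
  have : 0 <= (q - 1) * (ell * y) by rewrite mulr_ge0 ?subr_ge0 ?(ltW q1)// mulr_ge0// ltW.
  by rewrite mulrBl mul1r; lra.
Qed.

End decomposition.

(** * Concavity of the primitive, continued to the half-line *)

Section weight_concave.
Context {R : realType} {a : \bar R} {w : R -> R}.
Local Notation leb := (@leb R).
Local Notation I := (oint a).
Local Notation mu := (weighted_measure w).
Hypotheses (a0 : (0 < a)%E) (dw : decreasing_weight a w).

Let mw : measurable_fun I w := measurable_weight dw.
Let w0 : forall t, I t -> 0 <= w t := weight_ge0 dw.
Let mI := @measurable_oint R a.

(** The primitive continued as a constant beyond [a], since the greedy procedure evaluates the curve
    on all of the half-line. *)
Definition cumulated_weight (x : R) := fine (mu (I `&` oint x%:E)).
Local Notation W := cumulated_weight.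

Let mIco (s t : R) : measurable (I `&` `[s, t[). Proof. exact: measurableI. Qed.

Let mu_split (s t : R) : 0 <= s -> s <= t ->
  mu (I `&` oint t%:E) = (mu (I `&` oint s%:E) + mu (I `&` `[s, t[))%E.
Proof.
move=> s0 st; rewrite /weighted_measure -ge0_integral_setU//.
- congr (integral _ _ _); apply/seteqP; split => r.
    move=> [Ir [r0 rt]]; case: (ltP r s) => rs; [left|right]; split => //.
    by rewrite /= in_itv/= rs.
  move=> [[Ir [r0 rs]]|[Ir str]]; split => //.
    by split => //; apply: (lt_le_trans rs); rewrite lee_fin.
  by move: str; rewrite /= in_itv/= => /andP[_ rt]; split => //; case: Ir.
- exact: measurableI.
- exact: mIco.
- apply/measurable_EFinP; apply: measurable_funS mw => //.
  by move=> r [[]|[]].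
- by move=> r [[/w0]|[/w0]]; rewrite lee_fin.
- apply/disj_setPS => r [[_ [_ rs]] [_]]; rewrite /= in_itv/= => /andP[sr _].
  by move: rs; rewrite lte_fin ltNge sr.
Qed.

Let mu_ge0 A : A `<=` I -> (0 <= mu A)%E.
Proof. by move=> AI; apply: integral_ge0 => t /AI/w0; rewrite lee_fin. Qed.

Let mu_le (y z t : R) : I y -> y <= z -> z <= t -> (mu (I `&` `[z, t[) <= (w y * (t - z))%:E)%E.
Proof.
move=> Iy yz zt; apply: (@le_trans _ _ (\int[leb]_(r in I `&` `[z, t[) cst (w y)%:E r)%E).
  apply: ge0_le_integral.
  - exact: mIco.
  - by move=> r [/w0]; rewrite lee_fin.
  - by apply/measurable_EFinP; apply: measurable_funS mw => // r [].
  - exact: measurable_cst.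
  - move=> r [Ir]; rewrite /= in_itv/= => /andP[zr _]; rewrite lee_fin.
    exact: (weight_noninc dw Iy Ir (le_trans yz zr)).
rewrite (integral_cst leb (mIco _ _) (w y)%:E) EFinM; apply: lee_wpmul2l; first by rewrite lee_fin w0.
apply: (@le_trans _ _ (leb `[z, t[%classic)).
  by apply: le_measure; rewrite ?inE; [exact: mIco|exact: measurable_itv|exact: subIsetr].
by rewrite lebesgue_measure_itv/= lte_fin; case: ltP => //; rewrite ?lee_fin ?subr_ge0// EFinB.
Qed.

Let mu_ge (x y : R) : 0 <= x -> I y -> x < y -> ((w y * (y - x))%:E <= mu (I `&` `[x, y[))%E.
Proof.
move=> x0 Iy xy.
have sI : `]x, y[%classic `<=` I `&` `[x, y[.
  move=> r /=; rewrite !in_itv/= => /andP[xr ry]; split; last by rewrite ltW.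
  by split; [exact: le_lt_trans xr|apply: lt_trans (Iy.2); rewrite lte_fin].
apply: (@le_trans _ _ (\int[leb]_(r in `]x, y[) cst (w y)%:E r)%E).
  rewrite (integral_cst leb (measurable_itv _) (w y)%:E) EFinM.
  apply: lee_wpmul2l; first by rewrite lee_fin w0.
  have <- : leb `]x, y[%classic = (y - x)%:E by rewrite lebesgue_measure_itv/= lte_fin xy EFinB.
  by [].
apply: (@le_trans _ _ (mu `]x, y[%classic)).
  apply: ge0_le_integral => //.
  - by move=> r _; rewrite lee_fin w0.
  - by apply/measurable_EFinP; apply: measurable_funS mw => // r /sI[].
  - move=> r xry; have [Ir _] := sI _ xry; rewrite lee_fin.
    by move: xry; rewrite /= in_itv/= => /andP[_ /ltW]; exact: (weight_noninc dw Ir Iy).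
apply: ge0_subset_integral => //.
- exact: mIco.
- by apply/measurable_EFinP; apply: measurable_funS mw => // r [].
- by move=> r [/w0]; rewrite lee_fin.
Qed.

Let mu_primitive x : I x -> mu (I `&` oint x%:E) = primitive w x.
Proof. by move=> Ix; rewrite primitiveE setIidr//; exact: sub_oint_mem. Qed.

(** Integrability is assumed at points of [I] only. Beyond an interior point [y] the weight is at
    most [w y], so a bounded interval reaching [a] still has finite mass. *)
Lemma cumulated_weight_fin x : mu (I `&` oint x%:E) \is a fin_num.
Proof.
rewrite ge0_fin_numE; last by apply: mu_ge0; exact: subIsetl.
have [y Iy] := oint_neq0 a0; have [y0 _] := Iy.
apply: (@le_lt_trans _ _ (mu (I `&` oint (Num.max y x)%:E))).
  apply: (le_weighted_measure mI mw w0); [exact: measurableI|exact: measurableI| |exact: subIsetl].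
  by apply: setIS; apply: sub_oint; rewrite lee_fin le_max lexx orbT.
have yx : y <= Num.max y x by rewrite le_max lexx.
rewrite (mu_split (ltW y0) yx) mu_primitive//; apply: lte_add_pinfty.
  exact: (weight_locint dw).
by apply: le_lt_trans (mu_le Iy (lexx y) yx) _; exact: ltry.
Qed.

Lemma cumulated_weightE x : I x -> W x = fine (primitive w x).
Proof. by move=> Ix; rewrite /W mu_primitive. Qed.

Lemma cumulated_weight0 : W 0 = 0.
Proof. by rewrite /W oint_EFin set_itvoo0 setI0 /weighted_measure integral_set0. Qed.

Let incr_fin s t : mu (I `&` `[s, t[) \is a fin_num.
Proof.
rewrite ge0_fin_numE; last by apply: mu_ge0; exact: subIsetl.
apply: (@le_lt_trans _ _ (mu (I `&` oint t%:E))); last first.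
  by rewrite -ge0_fin_numE ?cumulated_weight_fin//; apply: mu_ge0; exact: subIsetl.
apply: (le_weighted_measure mI mw w0); [exact: mIco|exact: measurableI| |exact: subIsetl].
by move=> r [Ir]; rewrite /= in_itv/= => /andP[_ rt]; split=> //; split => //; case: Ir.
Qed.

Lemma cumulated_weightB s t : 0 <= s -> s <= t -> W t - W s = fine (mu (I `&` `[s, t[)).
Proof.
move=> s0 st; rewrite /W (mu_split s0 st) fineD ?cumulated_weight_fin ?incr_fin//.
by rewrite addrC addKr.
Qed.

Lemma cumulated_weight_nondecreasing s t : 0 <= s -> s <= t -> W s <= W t.
Proof.
move=> s0 st; rewrite -subr_ge0 (cumulated_weightB s0 st) fine_ge0//.
by apply: mu_ge0; exact: subIsetl.
Qed.

(** The value [w y] separates the slopes: before [y] they are at least [w y], after [y] at most. If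
    [y] is not before [a], the later increment is 0. *)
Lemma cumulated_weight_concave : concave4 W.
Proof.
move=> x y z t x0 xy yz zt.
have y0 : 0 < y by exact: le_lt_trans xy.
have z0 : 0 <= z by exact: le_trans (ltW y0) yz.
rewrite (cumulated_weightB z0 zt) (cumulated_weightB x0 (ltW xy)).
have xy0 : 0 <= y - x by rewrite subr_ge0 ltW.
have tz0 : 0 <= t - z by rewrite subr_ge0.
have [ya|ay] := ltP y%:E a.
  have Iy : I y by [].
  apply: (@le_trans _ _ ((w y * (t - z)) * (y - x))).
    by rewrite ler_wpM2r// -lee_fin fineK ?incr_fin// mu_le.
  by rewrite mulrAC ler_wpM2r// -lee_fin fineK ?incr_fin// mu_ge.
rewrite (_ : I `&` `[z, t[ = set0) ?/weighted_measure ?integral_set0 ?mul0r.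
  by rewrite mulr_ge0// fine_ge0//; apply: mu_ge0; exact: subIsetl.
apply/seteqP; split => // r [[_ ra]]; rewrite /= in_itv/= => /andP[zr _].
by move: ra; rewrite ltNge (le_trans ay)// lee_fin (le_trans yz).
Qed.

End weight_concave.

(** * The norm estimate for the embedding *)

Section sum_space.
Context {R : realType} {a : \bar R} {w : R -> R} {E : gauged_class R}.
Local Notation leb := (@leb R).
Local Notation I := (oint a).
Local Notation b := (total_mass a w).
Local Notation J := (oint b).
Local Notation star := (rearrangement leb I).
Local Notation starJ := (rearrangement leb J).
Local Notation Q := (Q_space a w E).
Hypotheses (a0 : (0 < a)%E) (dw : decreasing_weight a w)
  (fE : fully_symmetric_space J E) (sE : has_support J E).
Implicit Types (f g h u v : R -> R).

Let b0 : (0 < b)%E := total_gt0 a0 dw.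
Let mI := @measurable_oint R a.
Let mJ := @measurable_oint R b.
Let t0 := fine (Order.min 1%E b).

Lemma min_total_mass : [/\ 0 < t0, t0%:E = Order.min 1%E b & (t0%:E <= b)%E].
Proof.
have fin : Order.min 1%E b \is a fin_num.
  rewrite ge0_fin_numE ?le_min ?lee01 ?(ltW b0)//.
  by apply: (@le_lt_trans _ _ 1%E); rewrite ?ge_min ?lexx ?ltry.
have E0 : t0%:E = Order.min 1%E b by rewrite /t0 fineK.
by split => //; rewrite ?E0 ?ge_min ?lexx ?orbT// -lte_fin E0 lt_min lte01.
Qed.

(* [be] is the value [h^*(t0)] and [al] the integral of the excess [(|h| - be)^+], so that
   [al + be * t0] is the integral of [h^*] over [(0, t0)]. If [t0 = b], then [be = 0]. *)
Lemma excess_split h : gset E h -> exists al be : R, [/\ 0 <= al, 0 <= be,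
  forall y, J y -> (\int[leb]_(t in oint y%:E) `|h t|%:E <= (al + be * y)%:E)%E &
  al + be <= t0 / gauge E (\1_(oint t0%:E)) * gauge E h].
Proof.
move=> Eh; have mh : measurable_fun J h := E_L0 fE Eh.
have mha : measurable_fun J (fun t => `|h t|) by exact: measurableT_comp.
have mhE : measurable_fun J (fun t => `|h t|%:E) by exact/measurable_EFinP.
have [t00 t0E t0b] := min_total_mass; have Ht0 := E_integral_le fE sE Eh t00 t0b.
have [b1|b1] := leP b 1%E.
  have t0bE : t0%:E = b by rewrite t0E (min_idPr b1).
  have H : (\int[leb]_(t in J) `|h t|%:E <=
      (t0 / gauge E (\1_(oint t0%:E)) * gauge E h)%:E)%E.
    by apply: le_trans Ht0; rewrite -t0bE; apply: integral_abs_oint_le; rewrite ?t0bE.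
  have H0 : (0 <= \int[leb]_(t in J) `|h t|%:E)%E by apply: integral_ge0 => t _; rewrite lee_fin.
  have Hfin : (\int[leb]_(t in J) `|h t|%:E)%E \is a fin_num.
    by rewrite ge0_fin_numE// (le_lt_trans H) ?ltry.
  exists (fine (\int[leb]_(t in J) `|h t|%:E)%E), 0; split => //; first exact: fine_ge0.
  - move=> y Jy; rewrite mul0r addr0 fineK//; apply: ge0_subset_integral => //.
    exact: sub_oint_mem.
  - by rewrite addr0 -lee_fin fineK.
have t01 : t0 = 1 by apply/EFin_inj; rewrite t0E (min_idPl (ltW b1)).
have J1 : J 1 by [].
have [hfin _ _] := E_star b0 fE sE Eh.
have := fineK (hfin _ J1); set be := fine _ => beE.
have be0 : 0 <= be by rewrite fine_ge0// rearrangement_ge0.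
have Hle : (\int[leb]_(t in J) (Num.max (`|h t| - be) 0)%:E + be%:E <=
    (t0 / gauge E (\1_(oint t0%:E)) * gauge E h)%:E)%E.
  apply: le_trans Ht0; rewrite rearrangement_leb// in beE *.
  have := @integral_rearrangement_eq _ _ _ mJ (measurable_cst (1:R)) (fun _ _ => ler01)
    h be 1 mh ler01 (esym beE).
  by rewrite t01 mule1; under eq_integral do rewrite /cst mulr1.
have ex0 : (0 <= \int[leb]_(t in J) (Num.max (`|h t| - be) 0)%:E)%E.
  by apply: integral_ge0 => t _; rewrite lee_fin le_max lexx orbT.
have exfin : (\int[leb]_(t in J) (Num.max (`|h t| - be) 0)%:E)%E \is a fin_num.
  rewrite ge0_fin_numE//; apply: le_lt_trans (ltry (t0 / gauge E (\1_(oint t0%:E)) * gauge E h)).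
  by apply: le_trans Hle; rewrite leeDl// lee_fin.
exists (fine (\int[leb]_(t in J) (Num.max (`|h t| - be) 0)%:E)%E), be; split => //.
- exact: fine_ge0.
- move=> y Jy; have [y0 _] := Jy; have yJ := sub_oint_mem Jy.
  have mex A : A `<=` J -> measurable_fun A (fun t => (Num.max (`|h t| - be) 0)%:E).
    move=> AJ; apply/measurable_EFinP; apply: measurable_maxr => //.
    by apply: measurable_funB => //; exact: measurable_funS mha.
  apply: (@le_trans _ _ (\int[leb]_(t in oint y%:E) ((Num.max (`|h t| - be) 0)%:E + be%:E))%E).
    apply: ge0_le_integral => //.
    + by apply: measurable_funS mhE.
    + by apply: emeasurable_funD => //; exact: mex.
    + by move=> t _; rewrite -EFinD lee_fin -lerBlDr le_max lexx.
  rewrite ge0_integralD//; last 2 first.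
  + by move=> t _; rewrite lee_fin le_max lexx orbT.
  + exact: mex.
  have -> : (\int[leb]_(_ in oint y%:E) be%:E = (be * y)%:E)%E.
    by rewrite EFinM -integral_oint_cst ?lee_fin ?(ltW y0).
  rewrite EFinD fineK// leeD2r//.
  apply: ge0_subset_integral => //; first exact: mex.
  by move=> t _; rewrite lee_fin le_max lexx orbT.
- by rewrite -lee_fin EFinD fineK.
Qed.

Lemma marcinkiewicz_sup_ge0 f : (0 <= marcinkiewicz_sup a w f)%E.
Proof.
have [x Ix] := oint_neq0 a0.
apply: (@le_trans _ _ (((fine (primitive w x))^-1)%:E *
    \int[leb]_(s in `]0%R, x[) star f s)%E); last by apply: ereal_sup_ubound; exists x.
apply: mule_ge0; last by apply: integral_ge0 => s _; exact: rearrangement_ge0.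
by rewrite lee_fin invr_ge0 fine_ge0// ltW// (primitive_gt0 dw).
Qed.

Lemma marcinkiewicz_intro f c : measurable_fun I f ->
  (forall x, I x -> (\int[leb]_(t in oint x%:E) star f t <= (c * fine (primitive w x))%:E)%E) ->
  gset (marcinkiewicz a w) f /\ gauge (marcinkiewicz a w) f <= c.
Proof.
move=> mf fc; have H : (marcinkiewicz_sup a w f <= c%:E)%E.
  apply: ge_ereal_sup => _ [x Ix <-].
  have W0 : 0 < fine (primitive w x).
    by rewrite -lte_fin fineK ?(primitive_fin dw)// (primitive_gt0 dw).
  by rewrite -oint_EFin lee_pdivrMl// -EFinM mulrC fc.
have fin : marcinkiewicz_sup a w f \is a fin_num.
  by rewrite ge0_fin_numE ?marcinkiewicz_sup_ge0// (le_lt_trans H) ?ltry.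
split; first by split => //; exact: le_lt_trans H (ltry _).
by rewrite /= -lee_fin fineK.
Qed.

Lemma gauge_L1_plus_M_le f g h : measurable_fun I f -> gset (L1 a) g ->
  gset (marcinkiewicz a w) h -> ae_on I (fun t => f t = g t + h t) ->
  gset (L1_plus_M a w) f /\
  gauge (L1_plus_M a w) f <= gauge (L1 a) g + gauge (marcinkiewicz a w) h.
Proof.
move=> mf Lg Mh fgh; split; first by split => //; exists (g, h).
apply: ge_inf; last by exists (g, h).
exists 0 => _ [p _ <-]; apply: addr_ge0; apply: fine_ge0.
  by apply: integral_ge0 => t _; rewrite lee_fin.
exact: marcinkiewicz_sup_ge0.
Qed.

(** With [V = be * W], the splitting of [f] has an integrable part of norm at most [q * al + e] and
    a Marcinkiewicz part of norm at most [q * be], where [al + be <= C * c]. The constant results as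
    [e] tends to 0, [q] to 1 and [c] to the norm. *)
Lemma Q_L1_plus_M f : gset Q f -> gset (L1_plus_M a w) f /\
  gauge (L1_plus_M a w) f <= t0 / gauge E (\1_(oint t0%:E)) * gauge Q f.
Proof.
move=> Qf; have mf : measurable_fun I f := Q_L0 Qf.
have [t00 t0E t0b] := min_total_mass; have [_ g0] := E_indic fE sE t00 t0b.
set C := t0 / _; have C0 : 0 < C by rewrite divr_gt0.
have key c q e : gauge Q f < c -> 1 < q -> 0 < e -> gset (L1_plus_M a w) f /\
    gauge (L1_plus_M a w) f <= q * (C * c) + e.
  move=> fc q1 e0; have q0 : 0 <= q by exact: le_trans (ltW q1).
  have [u [h [Bh h0 hc]]] := Q_elim dw Qf fc.
  have Eh : gset E h by case: Bh => _ _ _ _ [].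
  have [al [be [al0 be0 hab abC]]] := excess_split Eh.
  pose V x := be * cumulated_weight (a := a) (w := w) x.
  have fV x : I x -> (\int[leb]_(t in oint x%:E) star f t <= (al + V x)%:E)%E.
    move=> Ix; apply: (le_trans (Q_bound_integral dw Bh Ix)).
    rewrite /V cumulated_weightE// -[X in oint X](fineK (primitive_fin dw Ix)); apply: hab.
    split; last by rewrite fineK ?(primitive_fin dw)// (primitive_le_total dw).
    by rewrite -lte_fin fineK ?(primitive_fin dw)// (primitive_gt0 dw).
  have V0 : 0 <= V 0 by rewrite /V cumulated_weight0 mulr0.
  have Vnd x y : 0 <= x -> x <= y -> V x <= V y.
    by move=> x0 xy; rewrite ler_wpM2l//; exact: (cumulated_weight_nondecreasing a0 dw).
  have Vc : concave4 V.
    move=> x y z t h1 h2 h3 h4; have := cumulated_weight_concave a0 dw h1 h2 h3 h4.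
    by rewrite /V -!mulrBr -!mulrA; exact: ler_wpM2l.
  have [f2 [mf2 f12 f2V]] := excess_decomposition a0 mf V0 Vnd Vc al0 fV q1 e0.
  have mf1 : measurable_fun I (fun t => f t - f2 t) by exact: measurable_funB.
  have f1L : gset (L1 a) (fun t => f t - f2 t).
    apply/integrableP; split; first exact/measurable_EFinP.
    by apply: le_lt_trans f12 _; exact: ltry.
  have f1g : gauge (L1 a) (fun t => f t - f2 t) <= q * al + e.
    rewrite /= -lee_fin fineK// ge0_fin_numE; first exact: le_lt_trans f12 (ltry _).
    by apply: integral_ge0 => t _; rewrite lee_fin.
  have [f2M f2g] : gset (marcinkiewicz a w) f2 /\ gauge (marcinkiewicz a w) f2 <= q * be.
    apply: marcinkiewicz_intro => // x Ix; have [x0 _] := Ix.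
    by apply: (le_trans (f2V x x0)); rewrite /V cumulated_weightE// mulrA.
  have [|fL fg] := gauge_L1_plus_M_le mf f1L f2M _; first by apply: aeW => t _; rewrite subrK.
  split => //; apply: (le_trans fg); apply: (le_trans (lerD f1g f2g)).
  have : q * (al + be) <= q * (C * c).
    apply: ler_wpM2l => //; apply: (le_trans abC); apply: ler_wpM2l; first exact: ltW.
    exact: ltW.
  by rewrite mulrDr; move: (q * al) (q * be) (q * (C * c)) => x y z; lra.
(* Any admissible [c], [q] and [e] give membership; the limits matter only for the norm. *)
split; first by have [] := key (gauge Q f + 1) 2 1 _ _ _; rewrite ?ltrDl ?ltr1n.
have gQ0 := Q_gauge_ge0 fE Qf.
rewrite -lee_fin; apply: lee_forall_gt_mul; first exact: ltW.
move=> c fc; rewrite -[C * c]mulr1; apply: lee_forall_gt_mul.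
  by rewrite mulr_ge0 ?(ltW C0)// (le_trans gQ0)// ltW.
move=> q q1; apply/lee_addgt0Pr => e e0.
by rewrite -EFinD lee_fin mulrC; have [] := key c q e fc q1 e0.
Qed.

End sum_space.

Theorem theorem6p2 (R : realType) (a : \bar R) (w : R -> R)
    (E : gauged_class R) (phi : R -> R)
    (I := oint a) (b := total_mass a w) (J := oint b)
    (t0 := fine (Order.min 1%E b)) :
  (0 < a)%E ->
  decreasing_weight a w ->
  fully_symmetric_space J E ->
  has_support J E ->
  is_fundamental_function J E phi ->
  [/\ (* (i) *)
      [/\ solid I (Q_space a w E), linear_subspace (Q_space a w E),
          Q_space a w E `<=` L1_plus_M a w &
          exists2 C : R, C <= t0 / phi t0 &
            forall f, gset (Q_space a w E) f ->
              gauge (L1_plus_M a w) f <= C * gauge (Q_space a w E) f],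
      (* (ii) *)
      is_norm I (Q_space a w E),
      (* (iii) *)
      smallest_fully_symmetric_containing I (M_class a w E) (Q_space a w E) &
      (* (iv) *)
      isometrically_equal (kothe_dual I (Q_space a w E))
                          (Lambda a w (kothe_dual J E))].
Proof.
move=> a0 dw fE sE phiE; split.
- split; [exact: Q_solid|exact: Q_linear| |].
    by move=> f Qf; have [] := Q_L1_plus_M a0 dw fE sE Qf.
  exists (t0 / phi t0) => // f Qf.
  have [t00 _ t0b] := min_total_mass a0 dw.
  rewrite (phiE t0 (oint t0%:E)); [|exact: measurable_oint|exact: sub_oint|]; last first.
    by rewrite lebesgue_measure_oint// lee_fin ltW.
  by have [] := Q_L1_plus_M a0 dw fE sE Qf.
- exact: Q_norm.
- exact: Q_smallest.
- exact: kothe_dual_Q.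
Qed.
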